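(* Let $\mathcal{H}$ be a toric hyperplane arrangement on $T^n$ whose induced subdivision is a regular cell complex, with face poset $T_t$ and intersection poset $\mathcal{P}$. Then $$\Psi(T_t)^*=\varphi_t\bigl(\Psi(\mathcal{P}\cup\{\hat0\})\bigr).$$
   Context: $T^n=\mathbb{R}^n/\mathbb{Z}^n$; a toric hyperplane is the image of $\{\vec x:\vec a\cdot\vec x=b\}$, $\vec a\in\mathbb{Q}^n\setminus\{0\}$, $b\in\mathbb R$. The intersection poset $\mathcal{P}$: all connected components of all intersections of the hyperplanes (empty intersection $=T^n$) plus $\emptyset$, ordered by reverse inclusion; $\mathcal{P}\cup\{\hat0\}$ has a new minimum, ranks $\rho(\hat0)=0$, $\rho(x)=n-\dim x+1$, $\rho(\emptyset)=n+2$. $T_t$: cells of the subdivision plus empty face (rank 0) and the torus (rank $n+2$), ordered by closure containment, $i$-cells of rank $i+1$. $\mathbf{ab}$-index: for a poset $P$ with $\hat0,\hat1$, rank function, $\rho(\hat1)=N+1$, let $f_S$ ($S=\{s_1<\dots<s_{k-1}\}\subseteq\{1,\dots,N\}$) count chains $\hat0<x_1<\dots<x_{k-1}<\hat1$ with $\rho(x_j)=s_j$, $h_S=\sum_{T\subseteq S}(-1)^{|S-T|}f_T$, and $\Psi(P)=\sum_S h_Su_S\in\mathbb{Z}\langle\mathbf a,\mathbf b\rangle$ with $u_S=u_1\cdots u_N$, $u_i=\mathbf b$ if $i\in S$, else $\mathbf a$. The involution $^*$ reverses each $\mathbf{ab}$-monomial ($(u_1\cdots u_N)^*=u_N\cdots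 u_1$), extended linearly. Coproduct: for an $\mathbf{ab}$-monomial $u=u_1\cdots u_N$ and $k\ge1$, $\Delta^{k-1}(u)=\sum_{1\le i_1<\dots<i_{k-1}\le N}u_{(1)}\otimes\cdots\otimes u_{(k)}$ where $u_{(1)}=u_1\cdots u_{i_1-1}$, $u_{(j)}=u_{i_{j-1}+1}\cdots u_{i_j-1}$, $u_{(k)}=u_{i_{k-1}+1}\cdots u_N$ (so $\Delta^0=\mathrm{id}$); written $\sum_u u_{(1)}\otimes\cdots\otimes u_{(k)}$, extended linearly. Linear maps on monomials $v$: $\kappa(v)=(\mathbf a-\mathbf b)^m$ if $v=\mathbf a^m$, else $0$; $\eta(v)=2(\mathbf a-\mathbf b)^{m+k}$ if $v=\mathbf b^m\mathbf a^k$ ($m,k\ge0$), else $0$; $\lambda_t(v)=(\mathbf a-\mathbf b)^m$ if $v=\mathbf b^m$, $\lambda_t(v)=(\mathbf a-\mathbf b)^{m+1}$ if $v=\mathbf b^m\mathbf a$, else $0$. Define $\varphi_{t,1}=\kappa$ and for $k\ge2$, $\varphi_{t,k}(v)=\sum_v\kappa(v_{(1)})\,\mathbf b\,\eta(v_{(2)})\,\mathbf b\cdots\mathbf b\,\eta(v_{(k-1)})\,\mathbf b\,\lambda_t(v_{(k)})$ (coproduct into $k$ parts), and $\varphi_t=\sum_{k\ge1}\varphi_{t,k}$. *)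

(* Defs.v *)
From HB Require Import structures.
From mathcomp Require Import all_boot all_order all_algebra generic_quotient.
From mathcomp Require Import finmap.
From mathcomp.multinomials Require Import monalg.
From mathcomp Require Import all_classical all_reals topology normedtype convex.

Set Implicit Arguments.
Unset Strict Implicit.
Unset Printing Implicit Defensive.

Import Order.TTheory GRing.Theory Num.Theory.
Import numFieldNormedType.Exports.

Local Open Scope classical_set_scope.
Local Open Scope ring_scope.
Local Open Scope quotient_scope.

(* ab-words are sequences of booleans, with false for a and true for b. *)
Definition abpoly := {malg int[{fmonom bool}]}.

Definition abword (u : seq bool) : abpoly := << FMonom u >>.

Definition ab_a : abpoly := abword [:: false].
Definition ab_b : abpoly := abword [:: true].

Definition lin_ext (f : seq bool -> abpoly) (p : abpoly) : abpoly :=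
  \sum_(m <- msupp p) p@_m *: f m.

Definition ab_rev : abpoly -> abpoly := lin_ext (fun u => abword (rev u)).

(* cut_at u 0 [:: i_1; ...; i_(k-1)] lists the k words that are left when the
   letters of u at the (0-based, increasing) positions i_j are deleted. *)
Fixpoint cut_at (u : seq bool) (start : nat) (s : seq nat) : seq (seq bool) :=
  if s is i :: s' then drop start (take i u) :: cut_at u i.+1 s'
  else [:: drop start u].

(* The sum over all the terms u_(1) (x) ... (x) u_(k) of the (k-1)-fold
   coproduct of the word u of F [:: u_(1); ...; u_(k)]. *)
Definition coprod_sum (k : nat) (F : seq (seq bool) -> abpoly)
    (u : seq bool) : abpoly :=
  \sum_(I : {set 'I_(size u)} | #|I| == k.-1)
    F (cut_at u 0 [seq val i | i <- enum I]).

Definition kappa (v : seq bool) : abpoly :=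
  if v == nseq (size v) false then (ab_a - ab_b) ^+ size v else 0.

Definition eta (v : seq bool) : abpoly :=
  if `[< exists m k, v = nseq m true ++ nseq k false >]
  then 2%:R * (ab_a - ab_b) ^+ size v else 0.

Definition lambda_t (v : seq bool) : abpoly :=
  if `[< exists m, v = nseq m true \/ v = rcons (nseq m true) false >]
  then (ab_a - ab_b) ^+ size v else 0.

Definition phi_t_term (vs : seq (seq bool)) : abpoly :=
  match vs with
  | [::] => 0
  | [:: v] => kappa v
  | v :: w :: ws =>
      kappa v * (\prod_(x <- belast w ws) (ab_b * eta x))
      * ab_b * lambda_t (last w ws)
  end.

Definition phi_tk (k : nat) : abpoly -> abpoly :=
  lin_ext (coprod_sum k phi_t_term).

(* A word of length N has no decomposition into k parts when k > N + 1, so the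
   sum over all k >= 1 stops at k = N + 1. *)
Definition phi_t : abpoly -> abpoly :=
  lin_ext (fun u => \sum_(1 <= k < (size u).+2) phi_tk k (abword u)).

(* The data entering the ab-index: the elements of the poset form a set in a
   possibly larger type. *)
Record ranked_poset := RankedPoset {
  rp_type : choiceType;
  rp_elt : set rp_type;
  rp_le : rp_type -> rp_type -> Prop;
  rp_bot : rp_type;
  rp_top : rp_type;
  rp_rank : rp_type -> nat
}.

Section AbIndex.
Variable P : ranked_poset.

Definition rp_lt : rel (rp_type P) := fun x y => (x != y) && `[< rp_le x y >].

Definition rp_chains (s : seq nat) : set (seq (rp_type P)) :=
  [set c | [/\ forall x, x \in c -> rp_elt x,
               path rp_lt (rp_bot P) (rcons c (rp_top P)) &
               [seq rp_rank x | x <- c] = s]].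

Definition rp_N : nat := (rp_rank (rp_top P)).-1.

(* The index i : 'I_N stands for the rank i.+1. *)
Definition flag_f (S : {set 'I_rp_N}) : nat :=
  #|` fset_set (rp_chains [seq (val i).+1 | i <- enum S])|.

Definition flag_h (S : {set 'I_rp_N}) : int :=
  \sum_(T : {set 'I_rp_N} | T \subset S) (-1) ^+ #|S :\: T| * (flag_f T)%:Z.

Definition ab_index : abpoly :=
  \sum_(S : {set 'I_rp_N}) flag_h S *: abword [seq i \in S | i <- enum 'I_rp_N].

End AbIndex.

Section Torus.
Variables (R : realType) (n : nat).

Definition lattice_eq : rel 'rV[R]_n := fun x y =>
  `[< exists k : 'rV[int]_n, x - y = map_mx intr k >].

Lemma lattice_eq_refl : reflexive lattice_eq.
Proof. by move=> x; apply/asboolP; exists 0; rewrite subrr map_mx0. Qed.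

Lemma lattice_eq_sym : symmetric lattice_eq.
Proof.
have H x y : lattice_eq x y -> lattice_eq y x.
  move=> /asboolP[k kE]; apply/asboolP; exists (- k).
  by rewrite map_mxN -kE opprB.
by move=> x y; apply/idP/idP; exact: H.
Qed.

Lemma lattice_eq_trans : transitive lattice_eq.
Proof.
move=> y x z /asboolP[k kE] /asboolP[l lE]; apply/asboolP; exists (k + l).
by rewrite map_mxD -kE -lE addrA subrK.
Qed.

Canonical lattice_equiv :=
  EquivRel lattice_eq lattice_eq_refl lattice_eq_sym lattice_eq_trans.

Definition torus := quotient_topology {eq_quot lattice_equiv}.

HB.instance Definition _ := Topological.on torus.

Definition torus_proj (x : 'rV[R]_n) : torus := \pi_torus x.

Definition toric_hyperplane (h : set torus) : Prop :=
  exists (a : 'rV[rat]_n) (b : R),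
    a != 0 /\
    h = torus_proj @` [set x : 'rV[R]_n | \sum_(i < n) ratr (a 0 i) * x 0 i = b].

Definition toric_arrangement (H : set (set torus)) : Prop :=
  finite_set H /\ (forall h, H h -> toric_hyperplane h).

Definition affine_hull_dim (F : set 'rV[R]_n) (d : nat) : Prop :=
  exists (p : 'rV[R]_n) (V : {vspace 'rV[R]_n}),
    [/\ F p, (forall x, F x -> x - p \in V),
        (forall W : {vspace 'rV[R]_n},
           (forall x, F x -> x - p \in W) -> (V <= W)%VS)
      & \dim V = d].

(* Every flat is the image of an affine subspace of R^n and every cell is the
   image of a relatively open convex polyhedron; the dimension does not depend
   on the convex set F, by a Baire category argument. *)
Definition torus_dim (X : set torus) : nat :=
  xget 0%N [set d | exists F : set 'rV[R]_n,
    [/\ convex_set F, X = torus_proj @` F & affine_hull_dim F d]].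

Variable H : set (set torus).

Definition flats : set (set torus) :=
  [set X | exists2 S, S `<=` H &
     exists2 x, (\bigcap_(h in S) h) x &
       X = connected_component (\bigcap_(h in S) h) x].

Definition intersection_poset_elt : set (set torus) := flats `|` [set set0].

Definition intersection_rank (X : set torus) : nat :=
  if X == set0 then n.+2 else ((n - torus_dim X).+1)%N.

(* None is the adjoined minimum; the maximum is the empty set. *)
Definition intersection_poset_bot : ranked_poset :=
  {| rp_type := option (set torus);
     rp_elt := [set x | if x is Some X then intersection_poset_elt X else True];
     rp_le := fun x y => match x, y with
                         | None, _ => True
                         | Some _, None => False
                         | Some X, Some Y => Y `<=` X
                         end;
     rp_bot := None;
     rp_top := Some set0;
     rp_rank := fun x => if x is Some X then intersection_rank X else 0%N |}.

(* The cell through x is the connected component of x in the set of the points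
   that lie on exactly the same hyperplanes as x. *)
Definition toric_cells : set (set torus) :=
  [set C | exists x : torus,
     C = connected_component [set y | forall h, H h -> (h y <-> h x)] x].

End Torus.

Inductive face (X : Type) := EmptyFace | Cell of set X | WholeSpace.
Arguments EmptyFace {X}.
Arguments WholeSpace {X}.

HB.instance Definition _ (X : Type) := gen_eqMixin (face X).
HB.instance Definition _ (X : Type) := gen_choiceMixin (face X).

Definition toric_face_poset (R : realType) (n : nat)
    (H : set (set (torus R n))) : ranked_poset :=
  {| rp_type := face (torus R n);
     rp_elt := [set x | if x is Cell C then toric_cells H C else True];
     rp_le := fun x y => match x, y with
                         | EmptyFace, _ => True
                         | _, WholeSpace => True
                         | Cell C, Cell D => closure C `<=` closure D
                         | _, _ => False
                         end;
     rp_bot := EmptyFace;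
     rp_top := WholeSpace;
     rp_rank := fun x => match x with
                         | EmptyFace => 0%N
                         | Cell C => (torus_dim C).+1
                         | WholeSpace => n.+2
                         end |}.

Section RegularCellComplex.
Variables (R : realType) (X : topologicalType).

Definition closed_disk (d : nat) : set 'rV[R]_d :=
  [set x | \sum_(i < d) x 0 i ^+ 2 <= 1].

Definition open_disk (d : nat) : set 'rV[R]_d :=
  [set x | \sum_(i < d) x 0 i ^+ 2 < 1].

Arguments closed_disk : clear implicits.
Arguments open_disk : clear implicits.

(* The closure of C is a closed d-ball whose interior is C; f and g are mutually
   inverse homeomorphisms. *)
Definition ball_cell (d : nat) (C : set X) : Prop :=
  exists (f : 'rV[R]_d -> X) (g : X -> 'rV[R]_d),
    [/\ {within closed_disk d, continuous f},
        {within closure C, continuous g},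
        {in closed_disk d, cancel f g},
        f @` closed_disk d = closure C
      & f @` open_disk d = C].

(* A finite collection of closed balls in a Hausdorff space, whose interiors
   partition the space and whose boundaries are unions of members of the
   collection; cells collects the open cells. *)
Definition regular_cell_complex (cells : set (set X)) (dim : set X -> nat) :=
  [/\ hausdorff_space X, finite_set cells,
      \bigcup_(C in cells) C = setT, trivIset cells id
    & forall C, cells C ->
        ball_cell (dim C) C /\
        exists2 B, B `<=` cells &
          closure C `\` C = \bigcup_(E in B) closure E].

End RegularCellComplex.

(* Main.v *)
From HB Require Import structures.
Require Import Defs.
From mathcomp Require Import all_boot all_order all_algebra.
From mathcomp Require Import finmap zify lra.
From mathcomp.multinomials Require Import monalg.
From mathcomp Require Import all_classical all_reals topology normedtype convex.
From mathcomp Require Import interval_inference measure lebesgue_measure.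

(* Write c = a - b. Both ab-indices are sums over chains of words in b and
   c, and reversing the ab-index of T_t amounts to dualizing T_t, so that
   its chains run from the largest cell downwards. The coproduct kills c and
   sends b to 1 (x) 1; hence phi_t is given on words in b and c by a short
   recursion, with an auxiliary operator T for the part after the first cut.
   Let Q(x) be the chain sum above the flat x and U(C) the chain sum of the
   cells below the cell C. By induction, T(Q(x)) is the sum of U(C) over the
   cells C that span x, once two Euler relations are known: the signed
   number of the cells of a flat x around a fixed cell is (-1)^(dim x), and
   the signed number of all the cells of x is 0, or 1 when x is a point.

   Both relations come from the fact that cutting a relatively open convex
   set by hyperplanes does not change its signed number of cells. For the
   second one, pass to R^n and superpose on the periodic arrangement its
   image under a homothety of ratio 1/2: the signed number of cells modulo
   the lattice directions of the flat is unchanged, but it is also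
   multiplied by the index of 2 Lambda in Lambda, which is at least 2.

   Regularity enters only through this: no nonzero lattice vector joins two
   points of the closure of a cell of R^n, because the segment between them
   would project to a loop in a closed ball, and contracting that loop shows
   that its winding vector vanishes. *)

Set Implicit Arguments.
Unset Strict Implicit.
Unset Printing Implicit Defensive.

Import Order.TTheory GRing.Theory Num.Theory.
Import numFieldNormedType.Exports.

Local Open Scope classical_set_scope.
Local Open Scope ring_scope.

(** * The operator phi_t on words in a - b and b *)

Definition ab_letter (x : bool) : abpoly := if x then ab_b else ab_a.

Definition ab_c : abpoly := ab_a - ab_b.

Lemma abword_cat u v : abword (u ++ v) = abword u * abword v.
Proof. by rewrite malgM_def fgmulUU mulr1 /= /mmul /= fmmulE. Qed.

Lemma abword_nil : abword [::] = 1.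
Proof. by apply/malgP => k; rewrite mcoeffU mcoeff1 /mone /= fmoneE eq_sym. Qed.

Lemma abword_cons x u : abword (x :: u) = ab_letter x * abword u.
Proof. by rewrite -cat1s abword_cat; case: x. Qed.

Lemma abword_prod u : abword u = \prod_(x <- u) ab_letter x.
Proof.
elim: u => [|x u IH]; first by rewrite big_nil abword_nil.
by rewrite abword_cons IH big_cons.
Qed.

Lemma abpoly_sum_abword (p : abpoly) :
  p = \sum_(m <- msupp p) p@_m *: abword m.
Proof.
rewrite {1}(monalgE p); apply: eq_bigr => m _; apply/malgP => k.
by rewrite mcoeffZ !mcoeffU fmK mulr_natr.
Qed.

Lemma abpoly_scaleAr (k : int) (p q : abpoly) : p * (k *: q) = k *: (p * q).
Proof. by rewrite -(intz k) !scaler_int mulrzAr. Qed.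

Section LinearExtension.
Implicit Types (f g h : seq bool -> abpoly) (p q r : abpoly).

Lemma lin_extEw f p (d : {fset {fmonom bool}}) : (msupp p `<=` d)%fset ->
  lin_ext f p = \sum_(m <- d) p@_m *: f m.
Proof.
move=> le_pd; rewrite /lin_ext (big_fset_incl _ le_pd) //= => m _ mp.
by rewrite mcoeff_outdom // scale0r.
Qed.

Lemma lin_ext_is_linear f : linear (lin_ext f).
Proof.
move=> k p q; set d := (msupp p `|` msupp q)%fset.
have dp : (msupp p `<=` d)%fset by apply: fsubsetUl.
have dq : (msupp q `<=` d)%fset by apply: fsubsetUr.
have dpq : (msupp (k *: p + q) `<=` d)%fset.
  apply: fsubset_trans (msuppD_le _ _) _; apply: fsetUSS => //.
  exact: msuppZ_le.
rewrite (lin_extEw f dp) (lin_extEw f dq) (lin_extEw f dpq).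
rewrite scaler_sumr -big_split /=; apply: eq_bigr => m _.
by rewrite mcoeffD mcoeffZ scalerDl scalerA.
Qed.

HB.instance Definition _ f :=
  GRing.isLinear.Build int abpoly abpoly _ (lin_ext f) (lin_ext_is_linear f).

Lemma lin_ext_abword f u : lin_ext f (abword u) = f u.
Proof.
rewrite (@lin_extEw _ _ [fset (FMonom u)]%fset) ?msuppU_le //.
by rewrite big_seq_fset1 mcoeffUU scale1r.
Qed.

Lemma lin_ext1 f : lin_ext f 1 = f [::].
Proof. by rewrite -abword_nil lin_ext_abword. Qed.

Lemma lin_ext_letter x f p :
  lin_ext f (ab_letter x * p) = lin_ext (fun u => f (x :: u)) p.
Proof.
rewrite {1}(abpoly_sum_abword p) mulr_sumr linear_sum /lin_ext /=.
apply: eq_bigr => m _; rewrite -[RHS]/(p@_m *: f (x :: m)).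
by rewrite abpoly_scaleAr linearZ /= -abword_cons lin_ext_abword.
Qed.

Lemma lin_ext_mulr q f p : lin_ext (fun u => f u * q) p = lin_ext f p * q.
Proof.
by rewrite /lin_ext mulr_suml; apply: eq_bigr => m _; rewrite scalerAl.
Qed.

Lemma lin_ext_letter_rec x f g h q r p :
  (forall u, f (x :: u) = q * g u + r * h u) ->
  lin_ext f (ab_letter x * p) = q * lin_ext g p + r * lin_ext h p.
Proof.
move=> fE; rewrite lin_ext_letter (funext fE) /lin_ext !mulr_sumr -big_split.
by apply: eq_bigr => m _; rewrite scalerDr !abpoly_scaleAr.
Qed.

Lemma lin_ext_c f p :
  lin_ext f (ab_c * p) =
  lin_ext f (ab_letter false * p) - lin_ext f (ab_letter true * p).
Proof. by rewrite /ab_c mulrBl linearB. Qed.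

End LinearExtension.

Fixpoint subseqs (T : Type) (s : seq T) : seq (seq T) :=
  if s is x :: s' then map (cons x) (subseqs s') ++ subseqs s' else [:: [::]].

Lemma mem_subseqs (T : eqType) (s t : seq T) : (t \in subseqs s) = subseq t s.
Proof.
elim: s t => [|x s IH] t /=; first by rewrite inE; case: t.
rewrite mem_cat IH; case: t => [|y t]; first by rewrite !sub0seq orbT.
have [->|yx] := eqVneq y x.
  rewrite mem_map ?IH; last by move=> ? ? [].
  by apply/orb_idr => /(subseq_trans (subseq_cons t x)).
by rewrite orb_idl // => /mapP[z _ [/eqP]]; rewrite (negPf yx).
Qed.

Lemma subseqs_uniq (T : eqType) (s : seq T) : uniq s -> uniq (subseqs s).
Proof.
elim: s => //= x s IH /andP[xs /IH s_uniq].
rewrite cat_uniq map_inj_uniq ?s_uniq ?andbT //=; last by move=> ? ? [].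
apply/hasPn => t; rewrite mem_subseqs => /mem_subseq ts.
apply/mapP => -[u _ tu]; move/negP: xs; apply; apply: ts.
by rewrite tu mem_head.
Qed.

Lemma subseqs_map (T U : Type) (f : T -> U) s :
  subseqs (map f s) = map (map f) (subseqs s).
Proof. by elim: s => //= x s ->; rewrite map_cat -!map_comp. Qed.

Lemma subseqs_iotaS n :
  subseqs (iota 0 n.+1) =
  [seq 0%N :: map S s | s <- subseqs (iota 0 n)] ++
  [seq map S s | s <- subseqs (iota 0 n)].
Proof. by rewrite /= (iotaDl 1 0) subseqs_map -map_comp. Qed.

Lemma perm_subseqs_enum n :
  perm_eq (codom (fun I : {set 'I_n} => [seq val i | i <- enum I]))
          (subseqs (iota 0 n)).
Proof.
have memE (I : {set 'I_n}) (i : 'I_n) :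
    (val i \in [seq val j | j <- enum I]) = (i \in I).
  by rewrite mem_map ?mem_enum //; exact: val_inj.
apply: uniq_perm; last 1 first.
- move=> s; rewrite mem_subseqs; apply/codomP/idP => [[I ->]|s_sub].
    rewrite -val_enum_ord; apply: map_subseq.
    by rewrite enumT; exact: filter_subseq.
  exists [set i : 'I_n | val i \in s]%SET => //.
  have s_sorted := subseq_sorted ltn_trans s_sub (iota_ltn_sorted 0 n).
  apply: (irr_sorted_eq ltn_trans ltnn s_sorted).
    rewrite sorted_map; apply: (subseq_sorted _ (_ : subseq _ (enum 'I_n))).
    - by move=> x y z; exact: ltn_trans.
    - by rewrite enumT; exact: filter_subseq.
    - by rewrite -sorted_map val_enum_ord iota_ltn_sorted.
  move=> k; apply/idP/mapP => [ks|[i + ->]]; last by rewrite mem_enum inE.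
  have kn : (k < n)%N by have := mem_subseq s_sub ks; rewrite mem_iota.
  by exists (Ordinal kn); rewrite // mem_enum inE.
- rewrite /codom /image_mem map_inj_uniq ?enum_uniq // => I J IJ.
  by apply/setP => i; rewrite -!memE IJ.
- exact/subseqs_uniq/iota_uniq.
Qed.

Lemma sum_set_ord (V : nmodType) n (F : seq nat -> V) :
  \sum_(I : {set 'I_n}) F [seq val i | i <- enum I] =
  \sum_(s <- subseqs (iota 0 n)) F s.
Proof. by rewrite -(perm_big _ (perm_subseqs_enum n)) /= big_image. Qed.

Definition cuts (u : seq bool) : seq (seq (seq bool)) :=
  [seq cut_at u 0 s | s <- subseqs (iota 0 (size u))].

Definition cons_head (x : bool) (vs : seq (seq bool)) : seq (seq bool) :=
  (x :: head [::] vs) :: behead vs.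

Lemma cut_atS x u k s : cut_at (x :: u) k.+1 (map S s) = cut_at u k s.
Proof. by elim: s k => //= i s IH k; rewrite IH. Qed.

Lemma sum_cuts_cons (V : nmodType) x u (F : seq (seq bool) -> V) :
  \sum_(vs <- cuts (x :: u)) F vs =
  \sum_(vs <- cuts u) F ([::] :: vs) + \sum_(vs <- cuts u) F (cons_head x vs).
Proof.
rewrite /cuts subseqs_iotaS map_cat big_cat !big_map.
congr (_ + _); apply: eq_bigr => s _ /=; first by rewrite cut_atS.
by case: s => [|i s] /=; rewrite /cons_head /= ?drop0 // cut_atS.
Qed.

Lemma cuts_neq_nil u vs : vs \in cuts u -> vs != [::].
Proof. by move=> /mapP[[|i s] _ ->]. Qed.

Lemma sum_coprod_sum (F : seq (seq bool) -> abpoly) u :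
  \sum_(1 <= k < (size u).+2) coprod_sum k F u = \sum_(vs <- cuts u) F vs.
Proof.
rewrite /cuts big_map -(sum_set_ord _ (fun s => F (cut_at u 0 s))).
rewrite big_add1 big_mkord /= /coprod_sum (exchange_big_dep predT) //=.
apply: eq_bigr => I _; rewrite big_mkcond /=.
have I_lt : (#|I| < (size u).+1)%N.
  by rewrite ltnS -[X in (_ <= X)%N]card_ord max_card.
rewrite (bigD1 (Ordinal I_lt)) //= eqxx big1 ?addr0 // => k.
by rewrite eq_sym -val_eqE /= => /negPf ->.
Qed.

Section WordRecursion.
Variables (A : pzRingType) (b c : A).

(* In [eta_part s v] and [lambda_part s v], the word v is read after a word in
   b^* a^s, and only the letters of v are weighted. *)
Definition b_before_a : rel bool := fun x y => y ==> x.

Definition kappa_part (v : seq bool) : A :=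
  if v == nseq (size v) false then c ^+ size v else 0.

Definition eta_part (s : nat) (v : seq bool) : A :=
  if path b_before_a (s == 0%N) v then 2%:R * c ^+ size v else 0.

Definition lambda_part (s : nat) (v : seq bool) : A :=
  if path b_before_a (s == 0%N) v && (s + count negb v <= 1)%N
  then c ^+ size v else 0.

Fixpoint tail_term (s : nat) (vs : seq (seq bool)) : A :=
  match vs with
  | [::] => 0
  | [:: v] => lambda_part s v
  | v :: ws => eta_part s v * b * tail_term 0 ws
  end.

Definition phi_term (vs : seq (seq bool)) : A :=
  match vs with
  | [::] => 0
  | [:: v] => kappa_part v
  | v :: ws => kappa_part v * b * tail_term 0 ws
  end.

Definition next_state (s : nat) (x : bool) : nat := if x then s else s.+1.

Definition step_weight (s : nat) (x : bool) : A :=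
  if x && (0 < s)%N then 0 else c.

Fixpoint tail_word (s : nat) (u : seq bool) : A :=
  if u is x :: u' then
    2%:R * b * tail_word 0 u' + step_weight s x * tail_word (next_state s x) u'
  else (s <= 1)%N%:R.

Fixpoint phi_word (u : seq bool) : A :=
  if u is x :: u' then
    b * tail_word 0 u' + (if x then 0 else c) * phi_word u'
  else 1.

Lemma kappa_part_cons x v :
  kappa_part (x :: v) = (if x then 0 else c) * kappa_part v.
Proof.
rewrite /kappa_part /= eqseq_cons; case: x; rewrite ?mul0r //=.
by case: ifP; rewrite ?mulr0 // exprS.
Qed.

Lemma eta_part_cons s x v :
  eta_part s (x :: v) = step_weight s x * eta_part (next_state s x) v.
Proof.
rewrite /eta_part /step_weight; case: x s => [] [|s]; rewrite ?mul0r //=;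
  by case: ifP; rewrite ?mulr0 // exprS !mulr_natl mulrnAr.
Qed.

Lemma lambda_part_cons s x v :
  lambda_part s (x :: v) = step_weight s x * lambda_part (next_state s x) v.
Proof.
rewrite /lambda_part /step_weight; case: x s => [] [|s];
  rewrite ?mul0r ?addSnnS //=; by case: ifP; rewrite ?mulr0 // exprS.
Qed.

Lemma tail_term_cons s v vs : vs != [::] ->
  tail_term s (v :: vs) = eta_part s v * b * tail_term 0 vs.
Proof. by case: vs. Qed.

Lemma tail_term_nil s vs : vs != [::] ->
  tail_term s ([::] :: vs) = 2%:R * b * tail_term 0 vs.
Proof. by move=> vs0; rewrite tail_term_cons // /eta_part /= mulr1. Qed.

Lemma tail_term_cons_head s x vs : vs != [::] ->
  tail_term s (cons_head x vs) =
  step_weight s x * tail_term (next_state s x) vs.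
Proof.
case: vs => [//|v [|w vs]] _; first exact: lambda_part_cons.
rewrite (@tail_term_cons s (x :: v)) // (@tail_term_cons _ v) //.
by rewrite eta_part_cons !mulrA.
Qed.

Lemma phi_term_cons v vs : vs != [::] ->
  phi_term (v :: vs) = kappa_part v * b * tail_term 0 vs.
Proof. by case: vs. Qed.

Lemma phi_term_cons_head x vs : vs != [::] ->
  phi_term (cons_head x vs) = (if x then 0 else c) * phi_term vs.
Proof.
case: vs => [//|v [|w vs]] _; first exact: kappa_part_cons.
rewrite (@phi_term_cons (x :: v)) // (@phi_term_cons v) //.
by rewrite kappa_part_cons !mulrA.
Qed.

Lemma sum_tail_term s u : \sum_(vs <- cuts u) tail_term s vs = tail_word s u.
Proof.
elim: u s => [|x u IH] s.
  by rewrite big_seq1 /= /lambda_part /= addn0; case: leqP.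
rewrite sum_cuts_cons [RHS]/= -!IH !mulr_sumr.
congr (_ + _); apply: eq_big_seq => vs /cuts_neq_nil vs0.
  exact: tail_term_nil.
exact: tail_term_cons_head.
Qed.

Lemma sum_phi_term u : \sum_(vs <- cuts u) phi_term vs = phi_word u.
Proof.
elim: u => [|x u IH]; first by rewrite big_seq1 /= /kappa_part eqxx.
rewrite sum_cuts_cons [RHS]/= -IH -sum_tail_term !mulr_sumr.
congr (_ + _); apply: eq_big_seq => vs /cuts_neq_nil vs0.
  by rewrite phi_term_cons // /kappa_part eqxx mul1r.
exact: phi_term_cons_head.
Qed.

Lemma tail_term_prod w ws :
  (\prod_(x <- belast w ws) (b * eta_part 0 x))
  * (b * lambda_part 0 (last w ws))
  = b * tail_term 0 (w :: ws).
Proof.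
elim: ws w => [|w' ws IH] w; first by rewrite big_nil mul1r.
rewrite [belast _ _]/= [last _ _]/= big_cons.
by rewrite -mulrA tail_term_cons // IH !mulrA.
Qed.

Lemma phi_term_prod v w ws :
  phi_term (v :: w :: ws) =
  kappa_part v * (\prod_(x <- belast w ws) (b * eta_part 0 x))
  * b * lambda_part 0 (last w ws).
Proof. by rewrite phi_term_cons // -!mulrA tail_term_prod. Qed.

End WordRecursion.

Lemma path_b_before_aP v :
  reflect (exists m k, v = nseq m true ++ nseq k false)
    (path b_before_a true v).
Proof.
have allE : path b_before_a false =1 all negb.
  by elim=> //= -[] w //= ->.
apply: (iffP idP) => [|[m [k ->]]]; last first.
  elim: m => //=; rewrite -[path _ _ _]/(path b_before_a true (nseq k false)).
  by case: k => //= k; rewrite allE all_nseq orbT.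
elim: v => [|[] v IH] /=; first by exists 0%N, 0%N.
  by move=> /IH[m [k ->]]; exists m.+1, k.
rewrite allE => v_a; exists 0%N, (size v).+1 => /=; congr cons.
by apply/all_pred1P; apply: sub_all v_a => -[].
Qed.

Lemma etaE : eta =1 eta_part ab_c 0.
Proof.
move=> v; rewrite /eta /eta_part; congr (if _ then _ else _).
exact/asboolP/path_b_before_aP.
Qed.

Lemma lambda_tE : lambda_t =1 lambda_part ab_c 0.
Proof.
move=> v; rewrite /lambda_t /lambda_part; congr (if _ then _ else _).
apply/asboolP/andP => [[m vE]|[/path_b_before_aP[m [k ->]]]].
  split.
    apply/path_b_before_aP; case: vE => ->.
      by exists m, 0%N; rewrite cats0.
    by exists m, 1%N; rewrite cats1.
  case: vE => ->; rewrite -?cats1 ?count_cat count_nseq //=.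
rewrite count_cat !count_nseq /= mul0n mul1n add0n => k1; exists m.
by case: k k1 => [|[|//]] _; [left; rewrite cats0|right; rewrite cats1].
Qed.

Lemma phi_t_termE : phi_t_term =1 phi_term ab_b ab_c.
Proof.
case=> [//|v [//|w ws]].
by rewrite phi_term_prod /phi_t_term (funext etaE) lambda_tE.
Qed.

Lemma phi_tE : phi_t =1 lin_ext (phi_word ab_b ab_c).
Proof.
move=> p; rewrite /phi_t; congr (lin_ext _ p); apply/funext => u.
rewrite -sum_phi_term -(eq_bigr _ (fun vs _ => phi_t_termE vs)) -sum_coprod_sum.
by apply: eq_bigr => k _; rewrite /phi_tk lin_ext_abword.
Qed.

Definition tail_op (s : nat) : abpoly -> abpoly :=
  lin_ext (tail_word ab_b ab_c s).

HB.instance Definition _ s := GRing.Linear.on (tail_op s).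

Definition phi_op : abpoly -> abpoly := lin_ext (phi_word ab_b ab_c).

HB.instance Definition _ := GRing.Linear.on phi_op.

Lemma tail_op1 s : tail_op s 1 = (s <= 1)%N%:R.
Proof. exact: lin_ext1. Qed.

Lemma phi_op1 : phi_op 1 = 1.
Proof. exact: lin_ext1. Qed.

Lemma tail_op_letter s x p :
  tail_op s (ab_letter x * p) =
  2%:R * ab_b * tail_op 0 p + step_weight ab_c s x * tail_op (next_state s x) p.
Proof. exact: lin_ext_letter_rec. Qed.

Lemma phi_op_letter x p :
  phi_op (ab_letter x * p) =
  ab_b * tail_op 0 p + (if x then 0 else ab_c) * phi_op p.
Proof. exact: lin_ext_letter_rec. Qed.

(** * From chains of flats to chains of cells *)

Section TailOperator.
Variables (A : pzRingType) (a b : A).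
Variables (tl : nat -> {additive A -> A}) (ph : {additive A -> A}).
Let c := a - b.
Hypothesis tl_1 : forall s, tl s 1 = (s <= 1)%N%:R.
Hypothesis tl_letter : forall s (x : bool) p,
  tl s ((if x then b else a) * p) =
  2%:R * b * tl 0 p + step_weight c s x * tl (next_state s x) p.
Hypothesis ph_1 : ph 1 = 1.
Hypothesis ph_letter : forall (x : bool) p,
  ph ((if x then b else a) * p) = b * tl 0 p + (if x then 0 else c) * ph p.

Lemma tail_mulc s p :
  tl s (c * p) = c * tl s.+1 p - step_weight c s true * tl s p.
Proof.
rewrite /c mulrBl raddfB /= (tl_letter s false) (tl_letter s true).
by rewrite opprD addrACA subrr add0r.
Qed.

Lemma phi_mulc p : ph (c * p) = c * ph p.
Proof.
rewrite /c mulrBl raddfB /= (ph_letter false) (ph_letter true).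
by rewrite mul0r addr0 addrAC subrr add0r.
Qed.

Lemma phi_cX j : ph (c ^+ j) = c ^+ j.
Proof. by elim: j => [|j IH]; rewrite ?ph_1 // exprS phi_mulc IH. Qed.

Lemma phi_cXb j p : ph (c ^+ j * b * p) = c ^+ j * b * tl 0 p.
Proof.
elim: j => [|j IH]; first by rewrite mul1r (ph_letter true) mul0r addr0.
by rewrite exprS -!mulrA phi_mulc !mulrA IH !mulrA.
Qed.

Lemma tailS_cX s j : tl s.+1 (c ^+ j) = c ^+ j * (s + j == 0)%N%:R.
Proof.
elim: j s => [|j IH] s; first by rewrite mul1r tl_1 addn0; case: s.
by rewrite exprS tail_mulc IH mul0r subr0 addnS mulr0 !mulr0.
Qed.

Lemma tail_cX j : tl 0 (c ^+ j) = (j == 0)%N%:R.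
Proof.
elim: j => [|j IH]; first exact: tl_1.
rewrite exprS tail_mulc IH tailS_cX add0n /step_weight /=.
by case: j {IH} => [|j]; rewrite ?expr0 ?mul1r ?mulr0 subrr.
Qed.

Lemma tailS_cXb s j p : tl s.+1 (c ^+ j * b * p) = 2%:R * (c ^+ j * b * tl 0 p).
Proof.
elim: j s => [|j IH] s.
  by rewrite expr0 !mul1r (tl_letter _ true) mul0r addr0 mulrA.
rewrite exprS -!mulrA tail_mulc mul0r subr0 [c ^+ j * (b * p)]mulrA IH.
by rewrite !mulr_natl mulrnAr !mulrA.
Qed.

Lemma tail_cXb j p :
  tl 0 (c ^+ j * b * p) =
  (c ^+ j * b * tl 0 p) *~ (1 + (-1) ^+ j) + (c ^+ j.+1 * tl 0 p) *~ (-1) ^+ j.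
Proof.
elim: j => [|j IH].
  rewrite !expr0 !mul1r expr1 (tl_letter 0 true) mulrzDr !mulr1z -mulrA.
  by rewrite mulr_natl mulr2n.
rewrite exprS -!mulrA tail_mulc [c ^+ j * (b * p)]mulrA IH tailS_cXb.
rewrite /step_weight /= mulrDr !mulrzAr !mulr_natl mulrnAr !mulrA -!exprS.
rewrite opprD addrA -!mulrNz [(-1) ^+ j.+1]exprS mulN1r; congr (_ + _).
by rewrite pmulrn -mulrzDr; congr (_ *~ _); rewrite opprD addrA.
Qed.

End TailOperator.

Section FlatsToCells.
Variables (A : pzRingType) (b c : A) (tl ph : {additive A -> A}).
Hypothesis tl_cX : forall j, tl (c ^+ j) = (j == 0)%N%:R.
Hypothesis tl_cXb : forall j p, tl (c ^+ j * b * p) =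
  (c ^+ j * b * tl p) *~ (1 + (-1) ^+ j) + (c ^+ j.+1 * tl p) *~ (-1) ^+ j.
Hypothesis ph_cX : forall j, ph (c ^+ j) = c ^+ j.
Hypothesis ph_cXb : forall j p, ph (c ^+ j * b * p) = c ^+ j * b * tl p.

Variables (X Y : finType) (N : nat) (ltX : rel X) (gtY : rel Y) (supp : Y -> X).
Variables (rX : X -> nat) (rY : Y -> nat).
Hypothesis rX_le : forall x, (rX x <= N)%N.
Hypothesis ltX_rank : forall x y, ltX x y -> (rX x < rX y)%N.
Hypothesis ltX_trans : transitive ltX.
Hypothesis rY_supp : forall C, rY C = rX (supp C).
Hypothesis gtY_supp : forall C D, gtY C D -> ltX (supp C) (supp D).

Let leX x y := (x == y) || ltX x y.
Let geY C D := (C == D) || gtY C D.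

Hypothesis euler_local : forall x E, ltX x (supp E) ->
  \sum_(C | geY C E && leX x (supp C)) (-1) ^+ rY C = (-1) ^+ rX x :> int.
Hypothesis euler_global : forall x,
  \sum_(C | leX x (supp C)) (-1) ^+ rY C
  = (if rX x == N then (-1) ^+ N else 0) :> int.

Variables (Q : X -> A) (U : Y -> A).
Hypothesis QE : forall x,
  Q x = c ^+ (N - rX x) + \sum_(y | ltX x y) c ^+ (rX y - rX x).-1 * b * Q y.
Hypothesis UE : forall C,
  U C = c ^+ (N - rY C) + \sum_(D | gtY C D) c ^+ (rY D - rY C).-1 * b * U D.

Let sgn x C : int := (-1) ^+ (rY C + rX x).
Let step_sum x C : A := c ^+ (rY C - rX x).-1 * b * U C.
Let shifted_sum x C : A := c ^+ (N - rX x) + \sum_(D | gtY C D) step_sum x D.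

Let ltX_irr x : ltX x x = false.
Proof. by apply/negP => /ltX_rank; rewrite ltnn. Qed.

Let gtY_irr C : gtY C C = false.
Proof. by apply/negP => /gtY_supp; rewrite ltX_irr. Qed.

Lemma sgn_sq x : (-1) ^+ rX x * (-1) ^+ rX x = 1 :> int.
Proof. by rewrite -expr2 sqrr_sign. Qed.

Lemma shifted_sumE x C : leX x (supp C) ->
  c ^+ (rY C - rX x) * U C = shifted_sum x C.
Proof.
move=> xC; have rC : (rX x <= rY C)%N.
  by rewrite rY_supp; case/orP: xC => [/eqP <-//|/ltX_rank/ltnW].
have CN : (rY C <= N)%N by rewrite rY_supp.
rewrite UE mulrDr -exprD.
have -> : (rY C - rX x + (N - rY C) = N - rX x)%N by lia.
congr (_ + _); rewrite mulr_sumr; apply: eq_bigr => D CD.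
rewrite /step_sum !mulrA -exprD; congr (c ^+ _ * _ * _).
by have := ltX_rank (gtY_supp CD); rewrite -!rY_supp; lia.
Qed.

Lemma sum_sgn x : \sum_(C | leX x (supp C)) sgn x C = (rX x == N)%:R.
Proof.
under eq_bigr do rewrite /sgn exprD.
rewrite -mulr_suml euler_global; case: eqP => [<-|_]; rewrite ?mul0r //.
exact: sgn_sq.
Qed.

Lemma sum_sgn_star x E : ltX x (supp E) ->
  \sum_(C | gtY C E && leX x (supp C)) sgn x C = 1 - sgn x E.
Proof.
move=> xE; apply: (canRL (addrK _)).
transitivity (\sum_(C | geY C E && leX x (supp C)) sgn x C).
  rewrite addrC [RHS](bigD1 E) /=; last by rewrite /geY eqxx /leX xE orbT.
  congr (_ + _); apply: eq_bigl => C; rewrite /geY.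
  by case: eqP => [->|_]; rewrite ?gtY_irr ?andbF ?andbT.
under eq_bigr do rewrite /sgn exprD.
by rewrite -mulr_suml euler_local // sgn_sq.
Qed.

Lemma sum_shifted_sum_sgn x :
  \sum_(C | leX x (supp C)) shifted_sum x C *~ sgn x C =
  (N - rX x == 0)%N%:R
  + \sum_(C | ltX x (supp C)) step_sum x C *~ (1 - sgn x C).
Proof.
rewrite /shifted_sum; under eq_bigr do rewrite mulrzDl mulrz_suml.
rewrite big_split /= -mulrz_sumr sum_sgn; congr (_ + _).
  have -> : (N - rX x == 0)%N = (rX x == N) by have := rX_le x; lia.
  by case: eqP => [->|_]; rewrite ?subnn ?mulr1z.
rewrite (exchange_big_dep (fun E => ltX x (supp E))) /=; last first.
  move=> C E xC CE; have := gtY_supp CE.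
  by case/orP: xC => [/eqP <-//|/ltX_trans]; exact.
apply: eq_bigr => E xE; rewrite -mulrz_sumr -sum_sgn_star //; congr (_ *~ _).
by apply: eq_bigl => C; rewrite andbC.
Qed.

Lemma tail_flat_step x :
  (forall y, ltX x y -> tl (Q y) = \sum_(C | supp C == y) U C) ->
  tl (Q x) = (N - rX x == 0)%N%:R +
    \sum_(C | ltX x (supp C))
      (step_sum x C *~ (1 - sgn x C) - shifted_sum x C *~ sgn x C).
Proof.
move=> IH; rewrite QE raddfD raddf_sum tl_cX; congr (_ + _).
rewrite (partition_big supp (ltX x)) //=; apply: eq_bigr => y xy.
rewrite tl_cXb IH // !mulr_sumr !mulrz_suml -big_split.
apply: eq_big => [C|C /eqP Cy] /=.
  by case: eqP => [->|]; rewrite ?xy ?andbF.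
have rxy := ltX_rank xy; rewrite -Cy -rY_supp in rxy *.
rewrite -/(step_sum x C) prednK ?subn_gt0 //.
rewrite shifted_sumE; last by rewrite /leX Cy xy orbT.
have -> : (-1) ^+ (rY C - rX x).-1 = - sgn x C.
  rewrite /sgn -signr_odd -[in RHS]signr_odd.
  have -> : odd (rY C + rX x) = ~~ odd (rY C - rX x).-1 by lia.
  by case: (odd _); rewrite ?opprK.
by rewrite mulrNz.
Qed.

(* The two sums over the cells whose support is strictly above x cancel. *)
Lemma tail_flat x : tl (Q x) = \sum_(C | supp C == x) U C.
Proof.
have [m] := ubnP (N - rX x); elim: m x => // m IH x ltm.
rewrite tail_flat_step => [|y xy]; last first.
  by apply: IH; have := ltX_rank xy; have := rX_le y; lia.
rewrite big_split /= addrA -sum_shifted_sum_sgn sumrN.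
rewrite (bigID (fun C => ltX x (supp C))) /= addrAC.
rewrite [X in X - _ + _](eq_bigl (fun C => ltX x (supp C))); last first.
  by move=> C; rewrite /leX; case: (ltX _ _); rewrite ?orbT ?andbF.
rewrite subrr add0r; apply: eq_big => [C|C].
  rewrite /leX eq_sym; case: eqP => [->|_]; rewrite ?ltX_irr //.
  by case: (ltX _ _).
rewrite /leX => /andP[xC /negPf nxC]; rewrite nxC orbF in xC.
rewrite -shifted_sumE /leX ?xC // /sgn rY_supp (eqP xC) subnn mul1r.
by rewrite addnn -signr_odd odd_double.
Qed.

Lemma phi_flats :
  ph (c ^+ N + \sum_x c ^+ (rX x).-1 * b * Q x) =
  c ^+ N + \sum_C c ^+ (rY C).-1 * b * U C.
Proof.
rewrite raddfD raddf_sum ph_cX; congr (_ + _).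
rewrite [RHS](partition_big supp predT) //=; apply: eq_bigr => x _.
rewrite ph_cXb tail_flat mulr_sumr; apply: eq_bigr => C /eqP <-.
by rewrite rY_supp.
Qed.

End FlatsToCells.

(** * The ab-index as a sum over chains *)

Section Chains.
Variables (A : pzRingType) (b c : A).
Variables (T : eqType) (lt : rel T) (e : seq T) (rho : T -> nat) (N : nat).

Fixpoint chain_list (x : T) (s : seq nat) : seq (seq T) :=
  if s is k :: s' then
    flatten [seq [seq y :: t | t <- chain_list y s'] |
              y <- [seq y <- e | lt x y && (rho y == k)]]
  else [:: [::]].

Lemma mem_chain_list x s t :
  (t \in chain_list x s) = [&& path lt x t, all (mem e) t & map rho t == s].
Proof.
elim: s x t => [|k s IH] x t /=.
  by rewrite inE; case: t => //= y t; rewrite !andbF.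
apply/flatten_mapP/and3P => [[y] | [xt te /eqP]].
  rewrite mem_filter => /andP[/andP[xy /eqP <-] ye] /mapP[u].
  by rewrite IH => /and3P[yu ue /eqP <-] -> /=; rewrite xy yu ue ye.
case: t xt te => //= y t /andP[xy yt] /andP[ye te] [rhoy rhot].
exists y; first by rewrite mem_filter xy rhoy eqxx.
by apply: map_f; rewrite IH yt te rhot eqxx.
Qed.

Lemma chain_list_uniq x s : uniq e -> uniq (chain_list x s).
Proof.
move=> e_uniq; elim: s x => //= k s IH x.
apply: allpairs_uniq_dep => /=; first exact: filter_uniq.
  by move=> y _; exact: IH.
by move=> [y t] [z u] _ _ /= [-> ->].
Qed.

Definition flag_weight (l : nat) (s : seq nat) : A :=
  \prod_(k <- iota 0 l) (if k \in s then b else c).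

Lemma flag_weight_cons l s :
  flag_weight l.+1 (0%N :: map S s) = b * flag_weight l s.
Proof.
rewrite /flag_weight /= big_cons mem_head (iotaDl 1 0) big_map; congr (_ * _).
by apply: eq_bigr => k _; rewrite inE /= mem_map //; exact: succn_inj.
Qed.

Lemma flag_weight_map_succ l s :
  flag_weight l.+1 (map S s) = c * flag_weight l s.
Proof.
rewrite /flag_weight /= big_cons (iotaDl 1 0) big_map.
have /negPf -> : 0%N \notin map S s by apply/mapP => -[].
congr (_ * _); apply: eq_bigr => k _; rewrite mem_map //; exact: succn_inj.
Qed.

(* The weighted sum over the chains that start above x, whose ranks lie strictly
   between r and r + l + 1. *)
Definition chain_sum (l : nat) (x : T) (r : nat) : A :=
  \sum_(s <- subseqs (iota 0 l))
    flag_weight l s *+ size (chain_list x (map (addn r.+1) s)).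

Lemma chain_sum0 x r : chain_sum 0 x r = 1.
Proof. by rewrite /chain_sum big_seq1 /flag_weight big_nil. Qed.

Lemma chain_sumS l x r :
  chain_sum l.+1 x r = c * chain_sum l x r.+1
    + \sum_(y <- e | lt x y && (rho y == r.+1)) b * chain_sum l y r.+1.
Proof.
have addS s : map (addn r.+1) (map S s) = map (addn r.+2) s.
  by rewrite -map_comp; apply: eq_map => k /=; rewrite addnS addSn.
rewrite /chain_sum subseqs_iotaS big_cat /= !big_map addrC; congr (_ + _).
  rewrite mulr_sumr; apply: eq_bigr => s _.
  by rewrite flag_weight_map_succ addS mulrnAr.
under [RHS]eq_bigr do rewrite mulr_sumr.
rewrite exchange_big /=; apply: eq_bigr => s _.
rewrite flag_weight_cons addS addn0 size_flatten /shape -map_comp sumnE big_map.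
rewrite big_filter -sumrMnr.
by apply: eq_bigr => y _; rewrite /= size_map mulrnAr.
Qed.

Hypothesis rho_le : {in e, forall y, (rho y <= N)%N}.

Lemma chain_sum_first l x r : (r + l = N)%N ->
  chain_sum l x r = c ^+ l
    + \sum_(y <- e | lt x y && (r < rho y)%N)
        c ^+ (rho y - r).-1 * b * chain_sum (N - rho y) y (rho y).
Proof.
elim: l r x => [|l IH] r x rlN.
  rewrite chain_sum0 big_seq_cond big_pred0 ?addr0 // => y.
  apply/negbTE/negP => /and3P[/rho_le ye _]; rewrite ltnNge.
  by rewrite -[r]addn0 rlN ye.
rewrite chain_sumS IH ?addSnnS // mulrDr -exprS -addrA; congr (_ + _).
rewrite [RHS](bigID (fun y => rho y == r.+1)) /= addrC; congr (_ + _).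
  apply: eq_big => [y|y /andP[_ /eqP rhoy]].
    rewrite -andbA; congr (_ && _).
    by case: eqP => [->|_]; rewrite ?ltnSn ?andbF.
  by rewrite rhoy subSnn mul1r -rlN addnS subSS addKn.
rewrite mulr_sumr; apply: eq_big => [y|y /andP[_ ry]].
  by case: (lt x y) => //=; lia.
by rewrite !mulrA -exprS prednK ?subn_gt0 // subnS.
Qed.

Definition upper_sum (x : T) : A := chain_sum (N - rho x) x (rho x).

Lemma upper_sum_rec x : (rho x <= N)%N ->
  {in e, forall y, lt x y -> (rho x < rho y)%N} ->
  upper_sum x = c ^+ (N - rho x)
    + \sum_(y <- e | lt x y) c ^+ (rho y - rho x).-1 * b * upper_sum y.
Proof.
move=> xN x_lt; rewrite /upper_sum chain_sum_first ?subnKC //; congr (_ + _).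
rewrite big_seq_cond [RHS]big_seq_cond; apply: eq_bigl => y.
case: (boolP (y \in e)) => //= ye.
by case: (boolP (lt x y)) => //= /(x_lt y ye).
Qed.

End Chains.

Section UpperSumCodom.
Variables (A : pzRingType) (b c : A) (T : eqType) (lt : rel T) (Y : finType).
Variables (f : Y -> T) (rho : T -> nat) (N : nat).
Hypothesis rho_le : forall y, (rho (f y) <= N)%N.
Let upper x : A := upper_sum b c lt (codom f) rho N x.

Lemma upper_sum_codom x : (rho x <= N)%N ->
  (forall y, lt x (f y) -> rho x < rho (f y))%N ->
  upper x = c ^+ (N - rho x)
    + \sum_(y | lt x (f y)) c ^+ (rho (f y) - rho x).-1 * b * upper (f y).
Proof.
move=> xN x_lt; rewrite /upper upper_sum_rec // => [|_ /codomP[y ->]|].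
- by rewrite /codom big_image_cond.
- exact: rho_le.
- by move=> _ /codomP[y ->]; exact: x_lt.
Qed.

Lemma upper_sum_codom_bot x : rho x = 0%N -> (forall y, lt x (f y)) ->
  (forall y, 0 < rho (f y))%N ->
  upper x = c ^+ N + \sum_y c ^+ (rho (f y)).-1 * b * upper (f y).
Proof.
move=> x0 x_lt f_gt0; rewrite upper_sum_codom ?x0 // subn0; congr (_ + _).
by apply: eq_big => [y|y _]; rewrite ?x_lt // subn0.
Qed.

End UpperSumCodom.

Lemma big_enumT (S : Type) (idx : S) (op : S -> S -> S) (J : finType)
    (F : J -> S) :
  \big[op/idx]_(j <- enum J) F j = \big[op/idx]_j F j.
Proof. by rewrite enumT [index_enum _]unlock. Qed.

Section FlagWords.
Variables (A : pzRingType) (a b : A).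

Lemma prodr_sign I (r : seq I) (P : pred I) (F : I -> A) :
  \prod_(i <- r) ((-1) ^+ P i * F i) = (-1) ^+ count P r * \prod_(i <- r) F i.
Proof.
elim: r => [|i r IH]; first by rewrite !big_nil mulr1.
rewrite !big_cons IH /= exprD !mulrA; congr (_ * _).
by rewrite -!mulrA; congr (_ * _); rewrite commr_sign.
Qed.

Lemma prodr_seq_eq0 (I : eqType) (r : seq I) (F : I -> A) i :
  i \in r -> F i = 0 -> \prod_(j <- r) F j = 0.
Proof.
move=> + Fi; elim: r => // j r IH; rewrite inE big_cons.
by case: eqP => [<- _|_ /IH ->]; rewrite ?Fi ?mul0r ?mulr0.
Qed.

(* Expand the product of the (-b) + a over the indices outside T. *)
Lemma sum_superset_prod N (T : {set 'I_N}) :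
  \sum_(S : {set 'I_N} | T \subset S)
     (\prod_(i < N) (if i \in S then b else a)) *~ (-1) ^+ #|S :\: T|
  = \prod_(i < N) (if i \in T then b else a - b).
Proof.
have splitE i : (if i \in T then b else a - b) =
    (if i \in T then b else - b) + (if i \in T then 0 else a).
  by case: ifP; rewrite ?addr0 // addrC.
under [RHS]eq_bigr do rewrite splitE.
rewrite bigA_distr big_mkcond /=; apply: eq_bigr => S _.
case: ifPn => [/fintype.subsetP TS|/fintype.subsetPn[i iT iS]]; last first.
  by rewrite (@prodr_seq_eq0 _ _ _ i) ?mem_index_enum // (negPf iS) iT.
rewrite -mulrzl rmorphXn rmorphN1.
have -> : #|S :\: T|%SET = count [in S :\: T]%SET (index_enum 'I_N).
  by rewrite cardE /enum_mem size_filter.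
rewrite -prodr_sign; apply: eq_bigr => i _; rewrite inE.
case: (boolP (i \in T)) => [/TS ->|_]; first by rewrite mul1r.
by case: (i \in S); rewrite ?mulN1r ?mul1r.
Qed.

Lemma prod_flag_weight N (T : {set 'I_N}) c :
  \prod_(i < N) (if i \in T then b else c) =
  flag_weight b c N [seq val i | i <- enum T].
Proof.
rewrite /flag_weight -val_enum_ord big_map big_enumT.
apply: eq_bigr => i _.
by rewrite mem_map ?mem_enum //; exact: val_inj.
Qed.

End FlagWords.

Lemma scale_mulz (V : lmodType int) (z : int) (m : nat) (v : V) :
  (z * m%:Z) *: v = v *~ z *+ m.
Proof. by rewrite -[_ * _]intz scaler_int mulrzA -pmulrn. Qed.

Lemma ab_index_flag (P : ranked_poset) :
  ab_index P = \sum_(s <- subseqs (iota 0 (rp_N P)))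
    flag_weight ab_b ab_c (rp_N P) s
    *+ #|` fset_set (@rp_chains P (map S s))|.
Proof.
have wordE (S : {set 'I_(rp_N P)}) :
    abword [seq i \in S | i <- enum 'I_(rp_N P)] =
    \prod_(i < rp_N P) (if i \in S then ab_b else ab_a).
  by rewrite abword_prod big_map big_enumT.
rewrite -sum_set_ord /ab_index /flag_h.
under eq_bigr do rewrite scaler_suml wordE.
rewrite (exchange_big_dep predT) //=; apply: eq_bigr => T _.
rewrite -prod_flag_weight -sum_superset_prod -sumrMnl; apply: eq_bigr => S _.
by rewrite scale_mulz /flag_f -map_comp.
Qed.

Section Reversal.

Lemma ab_rev_letter x p : ab_rev (ab_letter x * p) = ab_rev p * ab_letter x.
Proof.
apply: etrans (lin_ext_letter _ _ _) (etrans _ (lin_ext_mulr _ _ _)).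
apply: (congr1 (lin_ext^~ p)); apply/funext => u.
rewrite rev_cons -cats1 abword_cat; congr (_ * _).
by rewrite abword_cons abword_nil mulr1.
Qed.

Lemma ab_rev_b_c (x : bool) p :
  ab_rev ((if x then ab_b else ab_c) * p) =
  ab_rev p * (if x then ab_b else ab_c).
Proof.
case: x; first exact: (ab_rev_letter true).
apply: etrans (lin_ext_c _ _) (etrans (congr2 (fun q r => q - r)
  (ab_rev_letter false p) (ab_rev_letter true p)) _).
exact: esym (mulrBr _ _ _).
Qed.

Lemma ab_rev_prod (I : Type) (r : seq I) (Q : pred I) :
  ab_rev (\prod_(i <- r) (if Q i then ab_b else ab_c))
  = \prod_(i <- rev r) (if Q i then ab_b else ab_c).
Proof.
elim: r => [|i r IH].
  by rewrite !big_nil /ab_rev lin_ext1 abword_nil.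
rewrite big_cons rev_cons -cats1 big_cat big_seq1 -IH; exact: ab_rev_b_c.
Qed.

Variable N : nat.
Implicit Type s : seq nat.

Definition rev_ranks s : seq nat := rev [seq (N.-1 - k)%N | k <- s].

Lemma rev_ranks_iota : rev_ranks (iota 0 N) = iota 0 N.
Proof.
apply: (@eq_from_nth _ 0%N) => [|k].
  by rewrite size_rev size_map size_iota.
rewrite size_rev size_map size_iota => kN.
rewrite nth_rev ?size_map ?size_iota // (nth_map 0%N) ?size_iota; last by lia.
by rewrite !nth_iota; lia.
Qed.

Lemma rev_ranks_subseqs s :
  s \in subseqs (iota 0 N) -> rev_ranks s \in subseqs (iota 0 N).
Proof.
rewrite !mem_subseqs -{2}rev_ranks_iota subseq_rev; exact: map_subseq.
Qed.

Lemma subseqs_iota_lt s : s \in subseqs (iota 0 N) -> {in s, forall k, k < N}%N.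
Proof. by rewrite mem_subseqs => /mem_subseq sN k /sN; rewrite mem_iota. Qed.

Lemma rev_ranksK : {in subseqs (iota 0 N), involutive rev_ranks}.
Proof.
move=> s /subseqs_iota_lt s_lt; rewrite /rev_ranks map_rev revK -map_comp.
by rewrite map_id_in // => k /s_lt /=; lia.
Qed.

Lemma mem_rev_ranks k s : s \in subseqs (iota 0 N) -> (k < N)%N ->
  (k \in rev_ranks s) = ((N.-1 - k)%N \in s).
Proof.
move=> /subseqs_iota_lt s_lt kN; rewrite mem_rev.
apply/mapP/idP => [[j js ->]|ks].
  by rewrite (_ : N.-1 - (N.-1 - j) = j)%N //; have := s_lt j js; lia.
by exists (N.-1 - k)%N => //; lia.
Qed.

Lemma sum_rev_ranks (V : nmodType) (F : seq nat -> V) :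
  \sum_(s <- subseqs (iota 0 N)) F (rev_ranks s) =
  \sum_(s <- subseqs (iota 0 N)) F s.
Proof.
rewrite -(big_map rev_ranks predT F); apply: perm_big.
have ss_uniq := subseqs_uniq (iota_uniq 0 N).
apply: uniq_perm => //.
  rewrite map_inj_in_uniq // => s t sN tN st.
  by rewrite -(rev_ranksK sN) st rev_ranksK.
move=> s; apply/mapP/idP => [[t tN ->]|sN]; first exact: rev_ranks_subseqs.
by exists (rev_ranks s); rewrite ?rev_ranksK // rev_ranks_subseqs.
Qed.

Lemma ab_rev_flag_weight s : s \in subseqs (iota 0 N) ->
  ab_rev (flag_weight ab_b ab_c N s) = flag_weight ab_b ab_c N (rev_ranks s).
Proof.
move=> sN; rewrite /flag_weight ab_rev_prod -{1}rev_ranks_iota revK big_map.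
apply: eq_big_seq => k; rewrite mem_iota => /andP[_ kN].
by rewrite mem_rev_ranks.
Qed.

End Reversal.

Definition dual_poset (P : ranked_poset) : ranked_poset :=
  {| rp_type := rp_type P;
     rp_elt := @rp_elt P;
     rp_le := fun x y => rp_le y x;
     rp_bot := rp_top P;
     rp_top := rp_bot P;
     rp_rank := fun x => (rp_rank (rp_top P) - rp_rank x)%N |}.

Lemma card_fset_set_involution (T : choiceType) (f : T -> T) (A B : set T) :
  involutive f -> (forall x, A (f x) <-> B x) ->
  #|` fset_set A| = #|` fset_set B|.
Proof.
move=> fK AB; have AE : A = f @` B.
  apply/seteqP; split=> [x Ax|_ [x Bx <-]]; last exact/AB.
  by exists (f x); rewrite ?fK //; apply/AB; rewrite fK.
have [Bfin|Binf] := pselect (finite_set B).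
  by rewrite AE fset_set_image // card_imfset //=; exact: inv_inj.
have Ainf : ~ finite_set A.
  move=> /(finite_image f); apply: contra_not Binf.
  apply: sub_finite_set => x Bx.
  by exists (f x); rewrite ?fK //; exact/AB.
by rewrite /fset_set; case: pselect => // _; case: pselect.
Qed.

Lemma eq_map_subn (M : nat) (r s : seq nat) : {in s, forall k, 0 < k <= M}%N ->
  (map (subn M) r = s) <-> (r = map (subn M) s).
Proof.
move=> s_le; split=> [rs|->]; last first.
  by rewrite -map_comp map_id_in // => k /s_le /=; lia.
rewrite -rs -map_comp map_id_in // => k kr /=.
have /s_le : (M - k)%N \in s by rewrite -rs map_f.
lia.
Qed.

Section Dual.
Variable P : ranked_poset.
Hypothesis rank_bot : rp_rank (rp_bot P) = 0%N.
Hypothesis rank_top : (0 < rp_rank (rp_top P))%N.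

Lemma rp_N_dual : rp_N (dual_poset P) = rp_N P.
Proof. by rewrite /rp_N /= rank_bot subn0. Qed.

Lemma path_dual (c : seq (rp_type P)) :
  path (@rp_lt (dual_poset P)) (rp_top P) (rcons c (rp_bot P)) =
  path (@rp_lt P) (rp_bot P) (rcons (rev c) (rp_top P)).
Proof.
rewrite -[LHS]/(sorted (@rp_lt (dual_poset P)) (_ :: rcons c (rp_bot P))).
rewrite -[RHS]/(sorted (@rp_lt P) (rp_bot P :: rcons (rev c) (rp_top P))).
rewrite -rev_cons -rev_rcons rev_sorted; apply: eq_sorted => x y.
by rewrite /rp_lt /= eq_sym.
Qed.

Lemma rp_chains_dual s (c : seq (rp_type P)) : {in s, forall k, k < rp_N P}%N ->
  @rp_chains (dual_poset P) (map S (rev_ranks (rp_N P) s)) (rev c) <->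
  @rp_chains P (map S s) c.
Proof.
move=> s_lt; rewrite /rp_chains /= path_dual revK map_rev.
set M := rp_rank (rp_top P).
have MN : M = (rp_N P).+1 by rewrite /rp_N -/M; lia.
have rankE : rev [seq (M - rp_rank x)%N | x <- c] = map S (rev_ranks (rp_N P) s)
    <-> map (@rp_rank P) c = map S s.
  have rev_eq (l1 l2 : seq nat) : rev l1 = rev l2 <-> l1 = l2.
    by split=> [/(can_inj revK)|->].
  rewrite /rev_ranks map_rev rev_eq.
  have -> : [seq (M - rp_rank x)%N | x <- c] =
      map (subn M) (map (@rp_rank P) c).
    by rewrite -map_comp.
  have -> : [seq k.+1 | k <- [seq ((rp_N P).-1 - k)%N | k <- s]] =
      map (subn M) (map S s).
    by rewrite -!map_comp; apply/eq_in_map => k /s_lt /=; lia.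
  rewrite eq_map_subn => [|_ /mapP[_ /mapP[k /s_lt kN ->] ->]]; last by lia.
  by rewrite -map_comp map_id_in // => _ /mapP[k /s_lt kN ->] /=; lia.
split=> -[cP pc /rankE rc]; split=> //.
  by move=> x xc; apply: cP; rewrite mem_rev.
by move=> x; rewrite mem_rev; exact: cP.
Qed.

Lemma ab_index_dual : ab_index (dual_poset P) = ab_rev (ab_index P).
Proof.
rewrite !ab_index_flag rp_N_dual -sum_rev_ranks /ab_rev linear_sum -/ab_rev.
apply: eq_big_seq => s sN; have s_lt := subseqs_iota_lt sN.
rewrite raddfMn; congr (_ *+ _); first exact/esym/ab_rev_flag_weight.
by apply: (card_fset_set_involution revK) => c; exact: rp_chains_dual.
Qed.

End Dual.

Section ChainIndex.
Variables (P : ranked_poset) (e : seq (rp_type P)).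
Hypothesis e_uniq : uniq e.
Hypothesis mem_e : forall x,
  x \in e <-> rp_elt x /\ (0 < rp_rank x <= rp_N P)%N.
Hypothesis lt_top : {in e, forall x, rp_lt x (rp_top P)}.
Hypothesis lt_bot_top : rp_lt (rp_bot P) (rp_top P).
Hypothesis rank_bot : rp_rank (rp_bot P) = 0%N.

Lemma rp_chainsP s c : {in s, forall k, k < rp_N P}%N ->
  rp_chains (map S s) c <->
  c \in chain_list (@rp_lt P) e (@rp_rank P) (rp_bot P) (map S s).
Proof.
move=> s_lt; rewrite mem_chain_list /rp_chains /=.
have path_top : {subset c <= e} ->
    path (@rp_lt P) (rp_bot P) (rcons c (rp_top P)) =
    path (@rp_lt P) (rp_bot P) c.
  move=> ce; rewrite rcons_path andb_idr // => _.
  have := mem_last (rp_bot P) c; rewrite inE => /predU1P[->//|/ce].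
  exact: lt_top.
split=> [[cP pc cs]|/and3P[pc /allP ce /eqP cs]].
  have ce : {subset c <= e}.
    move=> x xc; apply/mem_e; split; first exact: cP.
    have : rp_rank x \in map S s by rewrite -cs; exact: (map_f (@rp_rank P)).
    by case/mapP => k /s_lt kN ->.
  by rewrite -path_top // pc cs eqxx andbT; exact/allP.
by split=> // [x /ce/mem_e[] //|]; rewrite path_top.
Qed.

Lemma ab_index_upper_sum :
  ab_index P =
  upper_sum ab_b ab_c (@rp_lt P) e (@rp_rank P) (rp_N P) (rp_bot P).
Proof.
rewrite ab_index_flag /upper_sum rank_bot subn0 /chain_sum.
apply: eq_big_seq => s /subseqs_iota_lt s_lt; congr (_ *+ _).
have -> : map (addn 1) s = map S s by apply: eq_map => k; rewrite add1n.
have l_uniq := chain_list_uniq (@rp_lt P) (@rp_rank P) (rp_bot P)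
  (map S s) e_uniq.
have -> : @rp_chains P (map S s) =
    [set` chain_list (@rp_lt P) e (@rp_rank P) (rp_bot P) (map S s)].
  by apply/seteqP; split=> c /(rp_chainsP _ s_lt).
apply: perm_size; apply: uniq_perm => // c.
rewrite in_fset_set; last exact: finite_seq.
by apply/idP/idP; rewrite inE.
Qed.

End ChainIndex.

(** * Affine arrangements and their Euler relation *)

Section Transversal.
Variable T : eqType.
Implicit Types (E : T -> T -> Prop) (K : set T) (s : seq T).

Definition transversal_of E K s :=
  [/\ {in s, forall x, K x}, forall x, K x -> exists2 y, y \in s & E x y,
      {in s &, forall x y, E x y -> x = y} & uniq s].

Lemma eq_transversal E E' K s : (forall x y, K x -> K y -> E x y <-> E' x y) ->
  transversal_of E K s -> transversal_of E' K s.
Proof.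
move=> EE' [sK cov inj s_uniq]; split=> //.
  by move=> x Kx; have [y ys xy] := cov x Kx; exists y => //; apply/EE'; auto.
by move=> x y xs ys /EE' xy; apply: inj; auto.
Qed.

Lemma sum_transversal (V : nmodType) E K s s' (F : T -> V) :
  (forall x y, K x -> K y -> E x y -> E y x) ->
  (forall x y z, K x -> K y -> K z -> E x y -> E y z -> E x z) ->
  (forall x y, K x -> K y -> E x y -> F x = F y) ->
  transversal_of E K s -> transversal_of E K s' ->
  \sum_(x <- s) F x = \sum_(x <- s') F x.
Proof.
move=> Esym Etrans EF [sK cov inj s_uniq] [sK' cov' inj' s_uniq'].
have /choice[h hP] : forall x, exists y, K x -> y \in s' /\ E x y.
  move=> x; have [Kx|nKx] := pselect (K x); last by exists x.
  by have [y ys' xy] := cov' x Kx; exists y.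
transitivity (\sum_(x <- map h s) F x).
  rewrite big_map; apply: eq_big_seq => x /sK Kx.
  by have [hs' xh] := hP x Kx; apply: EF => //; exact: sK'.
apply: perm_big; apply: uniq_perm => //.
  rewrite map_inj_in_uniq // => x y xs ys hxy.
  have [hxs' xh] := hP x (sK x xs); have [hys' yh] := hP y (sK y ys).
  apply: inj => //; apply: (Etrans _ (h x)); auto.
  by apply: Esym; auto; rewrite hxy.
move=> y; apply/mapP/idP => [[x xs ->]|ys'].
  by have [] := hP x (sK x xs).
have [x xs yx] := cov y (sK' y ys'); exists x => //.
have [hxs' xh] := hP x (sK x xs).
by apply: inj' => //; apply: (Etrans _ x); auto.
Qed.

Lemma transversal_allpairs (I : eqType) (r : seq I) (S : I -> seq T) E K :
  uniq r -> (forall x, K x -> E x x) ->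
  {in r, forall i, {in S i, forall x, K x} /\ uniq (S i)} ->
  (forall x, K x -> exists i y, [/\ i \in r, y \in S i & E x y]) ->
  {in r &, forall i j, {in S i & S j, forall x y, E x y -> i = j /\ x = y}} ->
  transversal_of E K [seq x | i <- r, x <- S i].
Proof.
move=> r_uniq Erefl SP cov inj; split.
- by move=> _ /allpairsPdep[i [x [ir xS ->]]]; exact: (SP i ir).1.
- move=> x /cov[i [y [ir yS xy]]]; exists y => //.
  by apply/allpairsPdep; exists i, y.
- move=> _ _ /allpairsPdep[i [x [ir xS ->]]] /allpairsPdep[j [y [jr yS ->]]].
  by move=> /(inj i j ir jr x y xS yS)[].
- apply: (allpairs_uniq_dep (f := fun _ x => x)) => // [i ir|].
    exact: (SP i ir).2.
  move=> u v /allpairsPdep[i [x [ir xS ->]]].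
  move=> /allpairsPdep[j [y [jr yS ->]]] /= xy.
  subst y; have [|-> _ //] := inj i j ir jr x x xS yS.
  exact/Erefl/((SP i ir).1).
Qed.

End Transversal.

Section Signs.
Variable R : realFieldType.
Implicit Types r s h t d : R.

Lemma sgr_addr_small r d : `|d| < `|r| -> Num.sg (r + d) = Num.sg r.
Proof.
case: (sgrP r) => [->|r0|r0]; rewrite ?normr_lt0 // ltr_norml => /andP[? ?].
  by apply: gtr0_sg; lra.
by apply: ltr0_sg; lra.
Qed.

Lemma sgr_mix r s t : 0 < t -> t <= 1 -> r = 0 \/ Num.sg r = Num.sg s ->
  Num.sg ((1 - t) * r + t * s) = Num.sg s.
Proof.
move=> t0 t1 [->|]; first by rewrite mulr0 add0r sgrM (gtr0_sg t0) mul1r.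
case: (sgrP s) => [->|s0|s0] /eqP; rewrite sgr_cp0 => r0.
- by rewrite (eqP r0) !mulr0 addr0 sgr0.
- by apply: gtr0_sg; nra.
- by apply: ltr0_sg; nra.
Qed.

Lemma sgr_mix_closed r s h t : 0 <= t <= 1 ->
  r = 0 \/ Num.sg r = Num.sg h -> s = 0 \/ Num.sg s = Num.sg h ->
  (1 - t) * r + t * s = 0 \/ Num.sg ((1 - t) * r + t * s) = Num.sg h.
Proof.
move=> /andP[t0 t1] rh sh; have [->|tn0] := eqVneq t 0.
  by rewrite subr0 mul1r mul0r addr0.
have [->|tn1] := eqVneq t 1; first by rewrite subrr mul0r add0r mul1r.
case: sh => [->|sh].
  rewrite mulr0 addr0; case: rh => [->|<-]; first by left; rewrite mulr0.
  by right; rewrite sgrM gtr0_sg ?mul1r // subr_gt0 lt_neqAle tn1.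
by right; rewrite -sh; apply: sgr_mix; rewrite ?lt0r ?tn0 // sh.
Qed.

Lemma normr_mix_lt r s t (e : R) : 0 <= t <= 1 -> `|r| < e -> `|s| < e ->
  `|(1 - t) * r + t * s| < e.
Proof.
move=> /andP[t0 t1]; have [->|tn0] := eqVneq t 0.
  by rewrite subr0 mul1r mul0r addr0.
have {tn0}t0 : 0 < t by rewrite lt0r tn0.
by rewrite !ltr_norml => /andP[? ?] /andP[? ?]; apply/andP; split; nra.
Qed.

Definition signs : seq R := [:: 1; 0; -1].

Lemma signs_uniq : uniq signs.
Proof.
by rewrite /= !inE ![_ == -1]eq_sym eqNr oppr_eq0 !oner_eq0.
Qed.

Lemma sgr_signs r : Num.sg r \in signs.
Proof. by rewrite !inE; case: (sgrP r); rewrite eqxx ?orbT. Qed.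

End Signs.

Definition segment_convex (R : numDomainType) (V : lmodType R) (F : set V) :=
  forall x y (t : R), F x -> F y -> 0 <= t <= 1 -> F (x + t *: (y - x)).

Section RelativelyOpen.
Variables (R : realFieldType) (V : vectType R).
Implicit Types (f : 'Hom(V, R^o)) (h : 'Hom(V, R^o) * R) (x y u : V) (g t : R).
Implicit Types (W : {vspace V}) (K : set V) (fs : seq ('Hom(V, R^o) * R)).

Definition side f g x : R := f x - g.

Lemma side_eq0 f g x : (side f g x == 0) = (f x == g).
Proof. exact: subr_eq0. Qed.

Lemma sg_side_eq0 f g x : Num.sg (side f g x) = 0 <-> f x = g.
Proof.
split=> [/eqP|fx]; first by rewrite sgr_eq0 side_eq0 => /eqP.
by rewrite /side fx subrr sgr0.
Qed.

Lemma side_line f g x t u : side f g (x + t *: u) = side f g x + t * f u.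
Proof. by rewrite /side linearD linearZ addrAC. Qed.

Lemma side_segment f g x y t :
  side f g (x + t *: (y - x)) = (1 - t) * side f g x + t * side f g y.
Proof.
have fB : f (y - x) = f y - f x :> R by exact: linearB.
by rewrite side_line fB /side; lra.
Qed.

Lemma dim_cap_lker W f u : u \in W -> f u != 0 ->
  \dim W = (\dim (W :&: lker f)).+1.
Proof.
move=> uW fu; rewrite -(limg_ker_dim f W) -[RHS]addn1.
congr (_ + _)%N; apply/eqP; rewrite eqn_leq; apply/andP; split.
  by apply: leq_trans (dimvS (subvf _)) _; rewrite dimvf.
rewrite lt0n dimv_eq0; apply: contraNneq fu => W0.
by have := memv_img f uW; rewrite W0 memv0.
Qed.

Definition relopen_convex K W :=
  [/\ forall x y, K x -> K y -> y - x \in W,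
      forall x u, K x -> u \in W ->
        exists2 e, 0 < e & forall t, `|t| < e -> K (x + t *: u)
    & segment_convex K].

Lemma relopenI K K' W W' : relopen_convex K W -> relopen_convex K' W' ->
  relopen_convex (K `&` K') (W :&: W')%VS.
Proof.
move=> [KW Kopen Kconv] [KW' Kopen' Kconv'].
split=> [x y [Kx Kx'] [Ky Ky']|x u [Kx Kx']|x y t [Kx Kx'] [Ky Ky'] t01].
- by rewrite memv_cap KW ?KW'.
- rewrite memv_cap => /andP[uW uW'].
  have [e e0 Ke] := Kopen x u Kx uW; have [e' e0' Ke'] := Kopen' x u Kx' uW'.
  exists (Num.min e e') => [|t]; first by rewrite lt_min e0.
  by rewrite lt_min => /andP[? ?]; split; [exact: Ke|exact: Ke'].
- by split; [exact: Kconv|exact: Kconv'].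
Qed.

Definition slice K h (sg : R) : set V :=
  [set x | K x /\ Num.sg (side h.1 h.2 x) = sg].

Definition slice_dir W h (sg : R) : {vspace V} :=
  if sg == 0 then (W :&: lker h.1)%VS else W.

Lemma relopen_slice0 K W h : relopen_convex K W ->
  relopen_convex (slice K h 0) (W :&: lker h.1)%VS.
Proof.
move=> [KW Kopen Kconv].
split=> [x y [Kx /sg_side_eq0 hx] [Ky /sg_side_eq0 hy]|x u [Kx hx]|].
- by rewrite memv_cap KW // memv_ker linearB /= hx hy subrr.
- rewrite memv_cap memv_ker => /andP[uW /eqP hu].
  have [e e0 Ke] := Kopen x u Kx uW; exists e => // t te.
  split; first exact: Ke.
  by rewrite side_line hu mulr0 addr0.
- move=> x y t [Kx /sg_side_eq0 hx] [Ky /sg_side_eq0 hy] t01.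
  split; first exact: Kconv.
  by rewrite side_segment /side hx hy !subrr !mulr0 addr0 sgr0.
Qed.

Lemma relopen_slice_neq0 K W h (sg : R) : sg != 0 -> relopen_convex K W ->
  relopen_convex (slice K h sg) W.
Proof.
move=> sg0 [KW Kopen Kconv]; split=> [x y [Kx _] [Ky _]|x u [Kx hx] uW|].
- exact: KW.
- have [e e0 Ke] := Kopen x u Kx uW.
  have r0 : side h.1 h.2 x != 0.
    by apply: contraNneq sg0 => r0; rewrite -hx r0 sgr0.
  exists (Num.min e (`|side h.1 h.2 x| / (`|h.1 u| + 1))).
    by rewrite lt_min e0 divr_gt0 ?normr_gt0 // ltr_wpDl.
  move=> t; rewrite lt_min => /andP[te]; rewrite ltr_pdivlMr ?ltr_wpDl // => tr.
  split; first exact: Ke.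
  rewrite -hx side_line sgr_addr_small // normrM.
  by apply: le_lt_trans tr; rewrite ler_wpM2l // lerDl.
- move=> x y t [Kx hx] [Ky hy] t01; split; first exact: Kconv.
  have hxy : Num.sg (side h.1 h.2 x) = Num.sg (side h.1 h.2 y) by rewrite hx hy.
  rewrite side_segment -hy; case/andP: t01 => t0 t1.
  have [->|t'0] := eqVneq t 0; first by rewrite subr0 mul1r mul0r addr0.
  by apply: sgr_mix => //; [rewrite lt0r t'0|right].
Qed.

Lemma relopen_slice K W h (sg : R) : relopen_convex K W ->
  relopen_convex (slice K h sg) (slice_dir W h sg).
Proof.
rewrite /slice_dir; case: eqP => [->|/eqP sg0]; first exact: relopen_slice0.
exact: relopen_slice_neq0.
Qed.

Lemma slice_crossing K W h x y : relopen_convex K W ->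
  slice K h 1 x -> slice K h (-1) y -> slice K h 0 !=set0.
Proof.
move=> [_ _ Kconv] [Kx /eqP]; rewrite sgr_cp0 => x0.
move=> [Ky /eqP]; rewrite sgr_cp0 => y0.
set p := side h.1 h.2 x in x0; set q := side h.1 h.2 y in y0.
have pq0 : 0 < p - q by lra.
pose t := p / (p - q); have tE : t * (p - q) = p by rewrite divfK // gt_eqF.
exists (x + t *: (y - x)); split.
  apply: Kconv => //; rewrite /t ler_pdivrMr // mul1r.
  rewrite (divr_ge0 (ltW x0) (ltW pq0)).
  by rewrite /=; lra.
rewrite side_segment -/p -/q; apply/eqP; rewrite sgr_cp0; apply/eqP.
by move: tE; lra.
Qed.

Lemma slices_around K W h x u : relopen_convex K W -> slice K h 0 x ->
  u \in W -> h.1 u != 0 -> slice K h 1 !=set0 /\ slice K h (-1) !=set0.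
Proof.
move=> [_ Kopen _] [Kx /eqP hx].
wlog hu : u / 0 < (h.1 u : R).
  move=> wl uW hu; have [hu0|hu0] := ltrP 0 (h.1 u : R).
    exact: wl hu0 uW hu.
  apply: (wl (- u)); rewrite ?rpredN // linearN ?oppr_eq0 //= oppr_gt0.
  by rewrite lt_neqAle hu.
move=> uW _; have [e e0 Ke] := Kopen x u Kx uW.
have e2 : 0 < e / 2 by lra.
rewrite sgr_cp0 in hx.
split; [exists (x + (e / 2) *: u)|exists (x + (- (e / 2)) *: u)]; split.
- by apply: Ke; rewrite gtr0_norm //; lra.
- by rewrite side_line (eqP hx) add0r gtr0_sg // mulr_gt0.
- by apply: Ke; rewrite normrN gtr0_norm //; lra.
- by rewrite side_line (eqP hx) add0r ltr0_sg // mulNr oppr_lt0 mulr_gt0.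
Qed.

(* If the hyperplane properly crosses K, then (-1)^d is replaced by
   (-1)^d - (-1)^d + (-1)^d. *)
Lemma euler_slices K W h : relopen_convex K W -> K !=set0 ->
  \sum_(sg <- signs R)
     (if `[< slice K h sg !=set0 >] then (-1) ^+ \dim (slice_dir W h sg) else 0)
  = (-1) ^+ \dim W :> int.
Proof.
move=> KW [x Kx]; rewrite !big_cons big_nil addr0 /slice_dir eqxx.
rewrite oner_eq0 oppr_eq0 oner_eq0.
have [[y y0]|nz] := pselect (slice K h 0 !=set0).
  rewrite (asboolT (ex_intro _ y y0)); have [Ky /sg_side_eq0 hy] := y0.
  have [/subvP Wker|/subvPn[u uW]] := boolP (W <= lker h.1)%VS; last first.
    rewrite memv_ker => hu; have [pos neg] := slices_around KW y0 uW hu.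
    rewrite (asboolT pos) (asboolT neg) (dim_cap_lker uW hu) exprS mulN1r.
    exact: addKr.
  have K0 z : K z -> Num.sg (side h.1 h.2 z) = 0.
    have [KdW _ _] := KW; move=> Kz; apply/sg_side_eq0.
    have := Wker _ (KdW _ _ Ky Kz).
    rewrite memv_ker linearB subr_eq0 => /eqP ->.
    exact: hy.
  rewrite !asboolF => [|[z [/K0 ->]]|[z [/K0 ->]]].
  - by rewrite add0r addr0 (capv_idPl _) //; exact/subvP.
  - by move/eqP; rewrite eq_sym oppr_eq0 oner_eq0.
  - by move/eqP; rewrite eq_sym oner_eq0.
rewrite (asboolF nz) add0r; case: (sgrP (side h.1 h.2 x)) => [/eqP|x0|x0].
- by rewrite -sgr_cp0 => /eqP hx; case: nz; exists x.
- have x1 : slice K h 1 x by split=> //; exact: gtr0_sg.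
  rewrite (asboolT (ex_intro _ x x1)) asboolF ?addr0 // => -[y].
  by move=> /(slice_crossing KW x1).
- have x1 : slice K h (-1) x by split=> //; exact: ltr0_sg.
  rewrite (asboolT (ex_intro _ x x1)) asboolF ?add0r // => -[y yp].
  exact/nz/(slice_crossing KW yp x1).
Qed.

Definition same_sides fs x y :=
  all (fun h => Num.sg (side h.1 h.2 x) == Num.sg (side h.1 h.2 y)) fs.

Definition sides_dir fs x : {vspace V} :=
  (\bigcap_(h <- fs | h.1 x == h.2) lker h.1)%VS.

Lemma sides_dirP fs x u :
  reflect {in fs, forall h, h.1 x = h.2 -> h.1 u = 0} (u \in sides_dir fs x).
Proof.
rewrite /sides_dir; elim: fs => [|h fs IH].
  by rewrite big_nil memvf; constructor.
rewrite big_cons; case: (h.1 x =P h.2) => [hx|hx]; last first.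
  apply: (iffP IH) => ux k; last by move=> kfs; apply: ux; rewrite inE kfs orbT.
  by rewrite inE => /predU1P[-> //|]; exact: ux.
rewrite memv_cap memv_ker; apply: (iffP andP) => [[/eqP hu /IH ux] k|ux].
  by rewrite inE => /predU1P[-> //|]; exact: ux.
split; first by apply/eqP/ux; rewrite ?mem_head.
by apply/IH => k kfs; apply: ux; rewrite inE kfs orbT.
Qed.

Lemma sides_dir_cons W h fs x :
  (W :&: sides_dir (h :: fs) x)%VS =
  (slice_dir W h (Num.sg (side h.1 h.2 x)) :&: sides_dir fs x)%VS.
Proof.
rewrite /sides_dir big_cons /slice_dir sgr_eq0 side_eq0.
by case: ifP => // _; rewrite capvA.
Qed.

Lemma euler_relopen fs K W : relopen_convex K W -> K !=set0 ->
  exists2 s, transversal_of (same_sides fs) K s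
    & \sum_(x <- s) (-1) ^+ \dim (W :&: sides_dir fs x) = (-1) ^+ \dim W :> int.
Proof.
elim: fs K W => [|h fs IH] K W KW Kne.
  have [x Kx] := Kne; exists [:: x].
    split=> // [y|y Ky|y z]; rewrite ?inE; first by move/eqP->.
      by exists x; rewrite ?mem_head.
    by move=> /eqP -> /eqP ->.
  by rewrite big_seq1 /sides_dir big_nil capvf.
have /choice[S SP] : forall sg, exists s,
    transversal_of (same_sides fs) (slice K h sg) s /\
    \sum_(x <- s) (-1) ^+ \dim (slice_dir W h sg :&: sides_dir fs x) =
    if `[< slice K h sg !=set0 >] then (-1) ^+ \dim (slice_dir W h sg) else 0
    :> int.
  move=> sg; have [ne|nne] := pselect (slice K h sg !=set0).
    have [s] := IH _ _ (relopen_slice h sg KW) ne.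
    by rewrite asboolT //; exists s.
  exists [::]; rewrite big_nil asboolF //; split=> //.
  by split=> // x Kx; case: nne; exists x.
exists [seq x | sg <- signs R, x <- S sg]; last first.
  rewrite -(euler_slices h KW Kne) big_allpairs_dep; apply: eq_bigr => sg _.
  rewrite -(SP sg).2; apply: eq_big_seq => x xS.
  have [[SK _ _ _] _] := SP sg; have [_ <-] := SK x xS.
  by rewrite sides_dir_cons.
apply: transversal_allpairs => [|x _|sg _|x Kx|sg sg' _ _ x y xS yS].
- exact: signs_uniq.
- by rewrite /same_sides; apply/allP => ? _.
- by have [[SK _ _ ?] _] := SP sg; split=> // x /SK[].
- have [[_ cov _ _] _] := SP (Num.sg (side h.1 h.2 x)).
  have [y yS xy] := cov x (conj Kx erefl).
  have [[SK _ _ _] _] := SP (Num.sg (side h.1 h.2 x)); have [_ hy] := SK y yS.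
  exists (Num.sg (side h.1 h.2 x)), y; rewrite /= hy eqxx; split=> //.
  exact: sgr_signs.
- have [[SK _ inj _] _] := SP sg; have [[SK' _ _ _] _] := SP sg'.
  have [_ hx] := SK x xS; have [_ hy] := SK' y yS.
  rewrite /= hx hy => /andP[/eqP ss' xy]; split=> //.
  by apply: inj => //; rewrite ss'.
Qed.

End RelativelyOpen.

Lemma seq_lower_bound (R : realDomainType) (T : eqType) (s : seq T)
    (F : T -> R) :
  (forall x, 0 < F x) -> exists2 e, 0 < e & {in s, forall x, e <= F x}.
Proof.
move=> F0; elim: s => [|x s [e e0 es]]; first by exists 1.
exists (Num.min (F x) e); first by rewrite lt_min F0.
by move=> y; rewrite inE ge_min => /predU1P[->|/es ->]; rewrite ?lexx ?orbT.
Qed.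

Section Arrangement.
Variables (R : realFieldType) (V : vectType R) (I : finType).
Variable a : I -> 'Hom(V, R^o).
Implicit Types (G : I -> set R) (S : {set I}) (x y z u p q : V) (t : R).

(* The hyperplanes are the a i = g with g in G i. *)
Definition locally_finite G :=
  forall i (M : R), finite_set [set g | G i g /\ `|g| <= M].

Definition same_cell G x y := forall i g, G i g ->
  Num.sg (side (a i) g x) = Num.sg (side (a i) g y).

Definition cell G x : set V := [set y | same_cell G x y].

(* The cell of x is contained in the closure of the cell of y. *)
Definition face_le G x y := forall i g, G i g ->
  side (a i) g x = 0 \/ Num.sg (side (a i) g x) = Num.sg (side (a i) g y).

Definition flat S x : set V := [set y | forall i, i \in S -> a i y = a i x].

Definition flat_dir S : {vspace V} := (\bigcap_(i in S) lker (a i))%VS.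

Definition in_levels G S x := forall i, i \in S -> G i (a i x).

Definition through G x : {set I} := [set i | `[< G i (a i x) >]]%SET.

Definition cell_dir G x : {vspace V} := flat_dir (through G x).

Lemma flat_dirP S u :
  reflect (forall i, i \in S -> a i u = 0) (u \in flat_dir S).
Proof.
rewrite memvE; apply: (iffP subv_bigcapP) => uS i iS.
  by have := uS i iS; rewrite -memvE memv_ker => /eqP.
by rewrite -memvE memv_ker uS.
Qed.

Lemma throughP G x i : reflect (G i (a i x)) (i \in through G x).
Proof. by rewrite inE; exact: asboolP. Qed.

Lemma in_levels_through G x : in_levels G (through G x) x.
Proof. by move=> i /throughP. Qed.

Lemma cell_dirP G x u :
  reflect (forall i, G i (a i x) -> a i u = 0) (u \in cell_dir G x).
Proof.
by apply: (iffP (flat_dirP _ _)) => ux i => [/throughP|/throughP]; exact: ux.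
Qed.

Lemma flat_refl S x : flat S x x. Proof. by []. Qed.

Lemma flat_eq S x y : flat S x y -> flat S x = flat S y.
Proof. by move=> xy; apply/seteqP; split=> z xz i iS; rewrite xz // xy. Qed.

Lemma flat_sub S x y z : flat S x y -> flat S x z -> z - y \in flat_dir S.
Proof.
by move=> xy xz; apply/flat_dirP => i iS; rewrite linearB /= xz ?xy // subrr.
Qed.

Lemma flat_add S x y u : flat S x y -> u \in flat_dir S -> flat S x (y + u).
Proof.
by move=> xy /flat_dirP uS i iS; rewrite linearD /= xy // uS // addr0.
Qed.

Lemma flat_shift S x y u : flat S (x + u) (y + u) <-> flat S x y.
Proof.
split=> xy i iS; last by rewrite !linearD /= xy.
by have := xy i iS; rewrite !linearD => /addIr.
Qed.

Lemma flat_convex S x : segment_convex (flat S x).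
Proof.
move=> y z t xy xz _ i iS; rewrite linearD linearZ linearB /= xy ?xz // subrr.
by rewrite scaler0 addr0.
Qed.

Lemma same_cell_refl G x : same_cell G x x. Proof. by []. Qed.

Lemma same_cell_sym G x y : same_cell G x y -> same_cell G y x.
Proof. by move=> xy i g Gg; rewrite xy. Qed.

Lemma same_cell_trans G x y z :
  same_cell G x y -> same_cell G y z -> same_cell G x z.
Proof. by move=> xy yz i g Gg; rewrite xy ?yz. Qed.

Lemma sub_same_cell G G' x y : (forall i, G i `<=` G' i) ->
  same_cell G' x y -> same_cell G x y.
Proof. by move=> GG' xy i g /GG'; exact: xy. Qed.

Lemma same_cell_on G x y i : same_cell G x y -> G i (a i x) -> a i y = a i x.
Proof.
by move=> xy Gx; apply/sg_side_eq0; rewrite -xy //; exact/sg_side_eq0.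
Qed.

Lemma same_cell_dir G x y : same_cell G x y -> cell_dir G x = cell_dir G y.
Proof.
have dir_sub x' y' : same_cell G x' y' -> (cell_dir G x' <= cell_dir G y')%VS.
  move=> xy; apply/subvP => u /cell_dirP ux; apply/cell_dirP => i Gi.
  by apply: ux; rewrite (same_cell_on (same_cell_sym xy)).
by move=> xy; apply/eqP; rewrite eqEsubv !dir_sub //; exact: same_cell_sym.
Qed.

Lemma same_cell_face G x y : same_cell G x y -> face_le G x y.
Proof. by move=> xy i g Gg; right; exact: xy. Qed.

Lemma same_cell_face_le G x y z :
  same_cell G x y -> face_le G x z -> face_le G y z.
Proof.
move=> xy xz i g Gg; have [x0|<-] := xz i g Gg; last by right; rewrite xy.
by left; apply/eqP; rewrite -sgr_eq0 -xy // x0 sgr0.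
Qed.

Lemma face_le_on G x y i : face_le G x y -> G i (a i y) -> a i x = a i y.
Proof.
move=> xy Gy; apply/sg_side_eq0; have [->|->] := xy i _ Gy; first exact: sgr0.
exact/sg_side_eq0.
Qed.

Lemma face_le_dir G x y : face_le G x y -> (cell_dir G x <= cell_dir G y)%VS.
Proof.
move=> xy; apply/subvP => u /cell_dirP ux; apply/cell_dirP => i Gi.
by apply: ux; rewrite (face_le_on xy).
Qed.

Lemma face_le_same_cell G x y : face_le G x y ->
  \dim (cell_dir G x) = \dim (cell_dir G y) -> same_cell G x y.
Proof.
move=> xy dxy i g Gg; have [xg|//] := xy i g Gg.
have dE : cell_dir G x = cell_dir G y.
  by apply/eqP; rewrite eqEdim dxy leqnn face_le_dir.
have xyd : y - x \in cell_dir G x.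
  rewrite dE; apply/cell_dirP => j Gj.
  by rewrite linearB /= (face_le_on xy Gj) subrr.
have {}xg : a i x = g by apply/eqP; rewrite -side_eq0 xg.
have /cell_dirP/(_ i) := xyd; rewrite linearB /= xg => /(_ Gg)/eqP.
by rewrite subr_eq0 => /eqP yg; rewrite /side xg yg.
Qed.

Lemma face_le_segment G x y t : face_le G x y -> 0 < t -> t <= 1 ->
  same_cell G y (x + t *: (y - x)).
Proof.
move=> xy t0 t1 i g Gg; rewrite side_segment.
by apply/esym/sgr_mix => //; exact: xy.
Qed.

Lemma face_le_convex G z : segment_convex [set x | face_le G x z].
Proof.
move=> x y t xz yz t01 i g Gg; rewrite side_segment.
by apply: sgr_mix_closed => //; [exact: xz|exact: yz].
Qed.

Lemma cell_sub_flat G S x y :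
  in_levels G S x -> flat S x y -> cell G y `<=` flat S x.
Proof.
by move=> Sx xy z yz i iS; rewrite (same_cell_on yz) ?xy //; exact: Sx.
Qed.

Lemma cell_dir_flat G S x y : in_levels G S x -> flat S x y ->
  (cell_dir G y <= flat_dir S)%VS.
Proof.
move=> Sx xy; apply/subvP => u /cell_dirP uy; apply/flat_dirP => i iS.
by apply: uy; rewrite xy //; exact: Sx.
Qed.

Lemma forms_bound u : exists2 B, 0 < B & forall i, `|a i u| < B.
Proof.
exists (\sum_i `|a i u| + 1); first by rewrite ltr_wpDl // sumr_ge0.
by move=> i; rewrite (bigD1 i) //= -addrA ltrDl ltr_wpDl // sumr_ge0.
Qed.

Definition strip x (e : R) : set V :=
  [set y | forall i, `|side (a i) (a i x) y| < e].

Lemma strip_refl x e : 0 < e -> strip x e x.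
Proof. by move=> e0 i; rewrite /side subrr normr0. Qed.

Lemma relopen_strip x e : relopen_convex (strip x e) fullv.
Proof.
split=> [y z _ _|y u ye _|y z t ye ze t01 i]; first exact: memvf.
  have [B B0 uB] := forms_bound u.
  have [|d d0 dP] := @seq_lower_bound R _ (enum I)
    (fun i => e - `|side (a i) (a i x) y|); first by move=> i; rewrite subr_gt0.
  exists (d / B) => [|t tB i]; first exact: divr_gt0.
  rewrite side_line; apply: le_lt_trans (ler_normD _ _) _.
  rewrite -ltrBrDl; apply: lt_le_trans (dP i (mem_enum _ i)); rewrite normrM.
  apply: (@le_lt_trans _ _ (`|t| * B)); last by rewrite -ltr_pdivlMr.
  by rewrite ler_wpM2l // ltW.
by rewrite side_segment; exact: normr_mix_lt.
Qed.

Lemma relopen_flat S x : relopen_convex (flat S x) (flat_dir S).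
Proof.
split=> [y z yS zS|y u yS uS|]; [exact: flat_sub yS zS| |exact: flat_convex].
by exists 1 => // t _; apply: flat_add => //; exact: rpredZ.
Qed.

Section LocallyFinite.
Variable G : I -> set R.
Hypothesis Glf : locally_finite G.

Lemma level_gap i (r : R) :
  exists2 e, 0 < e & forall g, G i g -> g != r -> e <= `|r - g|.
Proof.
pose S := fset_set [set g | G i g /\ `|g| <= `|r| + 1].
pose F g := if g == r then 1 else `|r - g|.
have [|e e0 eF] := @seq_lower_bound R _ S F.
  move=> g; rewrite /F; case: eqVneq => // gr.
  by rewrite normr_gt0 subr_eq0 eq_sym.
exists (Num.min e 1) => [|g Gg gr]; first by rewrite lt_min e0 ltr01.
rewrite ge_min; apply/orP; have [gM|gM] := lerP `|g| (`|r| + 1).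
  left; have gS : g \in S by rewrite in_fset_set ?inE //; exact: Glf.
  by have := eF g gS; rewrite /F (negPf gr).
by right; have := lerB_dist g r; rewrite distrC; lra.
Qed.

Lemma levels_gap (r : I -> R) :
  exists2 e, 0 < e & forall i g, G i g -> g != r i -> e <= `|r i - g|.
Proof.
have /choice[e eP] : forall i, exists e, 0 < e /\
    forall g, G i g -> g != r i -> e <= `|r i - g|.
  by move=> i; have [e e0 eP] := level_gap i (r i); exists e.
have [i|d d0 de] := @seq_lower_bound R _ (enum I) e; first by have [] := eP i.
exists d => // i g Gg gr; have [_ ep] := eP i; apply: le_trans (ep g Gg gr).
by apply: de; rewrite mem_enum.
Qed.

Lemma strip_face_le x : exists2 e, 0 < e & strip x e `<=` face_le G x.
Proof.
have [e e0 gap] := levels_gap (fun i => a i x).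
exists e => // y xy i g Gg; have [->|gx] := eqVneq g (a i x).
  by left; exact: subrr.
right; have -> : side (a i) g y = side (a i) g x + side (a i) (a i x) y.
  by rewrite /side [RHS]addrC subrKA.
by rewrite sgr_addr_small //; apply: lt_le_trans (xy i) (gap i g Gg gx).
Qed.

Lemma relopen_cell x : relopen_convex (cell G x) (cell_dir G x).
Proof.
split=> [y z xy xz|y u xy ux|y z t xy xz /andP[t0 t1]].
- apply/cell_dirP => i Gi; rewrite linearB /=.
  by rewrite (same_cell_on xy Gi) (same_cell_on xz Gi) subrr.
- have [e e0 near] := strip_face_le y; have [B B0 uB] := forms_bound u.
  exists (e / B) => [|t tB]; first exact: divr_gt0.
  apply: same_cell_trans (xy) _ => i g Gg.
  have [|yg|//] := near (y + t *: u) _ i g Gg.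
    move=> j; rewrite side_line /side subrr add0r normrM.
    apply: le_lt_trans (_ : `|t| * B < e); last by rewrite -ltr_pdivlMr.
    by rewrite ler_wpM2l // ltW.
  have /cell_dirP uy : u \in cell_dir G y by rewrite -(same_cell_dir xy).
  have {}yg : a i y = g by apply/eqP; rewrite -side_eq0 yg.
  by rewrite side_line uy ?yg // mulr0 addr0.
- have [->|t0'] := eqVneq t 0; first by rewrite scale0r addr0.
  apply: same_cell_trans (xz) _; apply: face_le_segment; rewrite ?lt0r ?t0' //.
  exact/same_cell_face/(same_cell_trans (same_cell_sym xy) xz).
Qed.

Lemma euler_cells (K : set V) (W : {vspace V}) :
  relopen_convex K W -> K !=set0 ->
  (forall i, exists M, forall x, K x -> `|a i x| <= M) ->
  exists2 s, transversal_of (same_cell G) K s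
    & \sum_(x <- s) (-1) ^+ \dim (W :&: cell_dir G x) = (-1) ^+ \dim W :> int.
Proof.
move=> KW Kne /choice[M MP].
pose lev i : {fset R} := fset_set [set g | G i g /\ `|g| <= M i].
have levP i g : g \in lev i <-> G i g /\ `|g| <= M i.
  by rewrite in_fset_set ?inE //; exact: Glf.
pose fs := [seq (a i, g) | i <- enum I, g <- enum_fset (lev i)].
have fsP h : h \in fs <-> exists i, [/\ h.1 = a i, G i h.2 & `|h.2| <= M i].
  split=> [/allpairsPdep[i [g [_ /levP[Gg gM] ->]]]|[i [hi Gh hM]]].
    by exists i.
  apply/allpairsPdep; exists i, h.2; rewrite mem_enum -hi -surjective_pairing.
  by split=> //; apply/levP.
have [s s_trans s_sum] := euler_relopen fs KW Kne.
exists s.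
  apply: eq_transversal s_trans => x y Kx Ky; split=> [/allP xy i g Gg|xy].
    have [gM|gM] := lerP `|g| (M i).
      by apply/eqP/(xy (a i, g))/fsP; exists i.
    have side_far z : K z -> Num.sg (side (a i) g z) = - Num.sg g.
      move=> Kz; rewrite /side -sgrN addrC sgr_addr_small // normrN.
      exact: le_lt_trans (MP i z Kz) gM.
    by rewrite !side_far.
  by apply/allP => h /fsP[i [hi Gh _]]; rewrite hi xy.
rewrite -s_sum; apply: eq_big_seq => x xs; congr (_ ^+ \dim _).
have [sK _ _ _] := s_trans; congr (_ :&: _)%VS.
apply/vspaceP => u; apply/cell_dirP/sides_dirP => [ux h|ux i Gx].
  by move=> /fsP[i [hi Gh _]] hx; rewrite hi ux // -hi hx.
by apply: (ux (a i, a i x)) => //; apply/fsP; exists i; split=> //; exact/MP/sK.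
Qed.

End LocallyFinite.
End Arrangement.

(** * Periodic arrangements *)

Section Parity.
Variable m : nat.
Implicit Types k d : 'rV[int]_m.

Definition parity k : {ffun 'I_m -> bool} := [ffun j => odd (absz (k 0 j))].

Lemma parity_eqP k d : parity k = parity d -> exists l, k = d + (l + l).
Proof.
move=> /ffunP kd; exists (\row_j divz (k 0 j - d 0 j) 2).
apply/rowP => j; have := kd j; rewrite !ffunE !mxE.
by move: (k 0 j) (d 0 j) => p q; lia.
Qed.

Lemma parity_addr_double k d : parity (k + (d + d)) = parity k.
Proof.
by apply/ffunP => j; rewrite !ffunE !mxE; move: (k 0 j) (d 0 j) => p q; lia.
Qed.

Lemma addr_double_eq0 d : d + d = 0 -> d = 0.
Proof.
move=> dd; apply/rowP => j; have := congr1 (fun M : 'rV[int]_m => M 0 j) dd.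
by rewrite !mxE; move: (d 0 j) => p; lia.
Qed.

Lemma absz_sum_double d : d != 0 ->
  (\sum_j absz (d 0%R j) < \sum_j absz ((d + d)%R 0%R j))%N.
Proof.
move=> /rV0Pn[j dj].
rewrite (bigD1 j) //= [X in (_ < X)%N](bigD1 j) //= -addSn; apply: leq_add.
  by rewrite !mxE; move: (d 0 j) dj => p; lia.
by apply: leq_sum => i _; rewrite !mxE; move: (d 0 i) => p; lia.
Qed.

Lemma exists_odd (P : set 'rV[int]_m) : (forall d, P (d + d) -> P d) ->
  (exists2 k, k != 0 & P k) -> exists2 k, parity k != parity 0 & P k.
Proof.
move=> Phalf [k]; have [N] := ubnP (\sum_j absz (k 0%R j))%N.
elim: N k => // N IH k kN k0 Pk.
have [/parity_eqP[d]|k_odd] := eqVneq (parity k) (parity 0); last by exists k.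
rewrite add0r => kd; have d0 : d != 0.
  by apply: contraNneq k0 => d0; rewrite kd d0 addr0.
apply: (IH d) => //; last by apply: Phalf; rewrite -kd.
by apply: leq_trans (absz_sum_double d0) _; rewrite -kd -ltnS.
Qed.

End Parity.

Section Periodic.
Variables (R : realFieldType) (V : vectType R) (I : finType).
Variables (a : I -> 'Hom(V, R^o)) (m : nat) (lat : {additive 'rV[int]_m -> V}).
Implicit Types (G B : I -> set R) (S : {set I}) (x y z u v : V).
Implicit Types (k l : 'rV[int]_m) (s : seq V).

Definition periodic G := forall i g k, G i g -> G i (g + a i (lat k)).

Definition unbounded_levels G := forall i M,
  (exists2 g, G i g & M < g) /\ (exists2 g, G i g & g < M).

Definition free_translations G :=
  forall x k, same_cell a G x (x + lat k) -> k = 0.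

Definition translate_cell G x y := exists k, same_cell a G x (y + lat k).

Definition signed_count G s : int :=
  \sum_(x <- s) (-1) ^+ \dim (cell_dir a G x).

Lemma cell_bounded G x : unbounded_levels G ->
  forall i, exists M, forall y, cell a G x y -> `|a i y| <= M.
Proof.
move=> Gu i; have [[g Gg gx] [h Gh hx]] := Gu i (a i x).
exists (`|g| + `|h|) => y xy.
have : side (a i) g y < 0 by rewrite -sgr_lt0 -xy // sgr_lt0 subr_lt0.
have : 0 < side (a i) h y by rewrite -sgr_gt0 -xy // sgr_gt0 subr_gt0.
have := ler_norm g; have := ler_norm (- h); rewrite normrN /side.
have := normr_ge0 g; have := normr_ge0 h; rewrite ler_norml.
by move: (a i y : R) => r; lra.
Qed.

Section Translations.
Variable G : I -> set R.
Hypothesis Gp : periodic G.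

Lemma levels_shiftE i g k : G i (g + a i (lat k)) <-> G i g.
Proof.
split=> [/(Gp (- k))|]; last exact: Gp.
by rewrite raddfN linearN /= addrK.
Qed.

Lemma side_shift i g x k :
  side (a i) (g + a i (lat k)) (x + lat k) = side (a i) g x.
Proof. by rewrite /side linearD /= opprD addrACA subrr addr0. Qed.

Lemma same_cell_shift x y k :
  same_cell a G (x + lat k) (y + lat k) <-> same_cell a G x y.
Proof.
split=> xy i g Gg; first by rewrite -!(side_shift i g _ k) xy //; exact: Gp.
rewrite -(subrK (a i (lat k)) g) !side_shift xy //.
by apply/(levels_shiftE i _ k); rewrite subrK.
Qed.

Lemma face_le_shift x y k :
  face_le a G (x + lat k) (y + lat k) <-> face_le a G x y.
Proof.
split=> xy i g Gg.
  by rewrite -!(side_shift i g _ k); apply: xy; exact: Gp.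
rewrite -(subrK (a i (lat k)) g) !side_shift; apply: xy.
by apply/(levels_shiftE i _ k); rewrite subrK.
Qed.

Lemma same_cell_subl x y k :
  same_cell a G (x - lat k) y <-> same_cell a G x (y + lat k).
Proof. by rewrite -(same_cell_shift _ _ k) subrK. Qed.

Lemma cell_dir_shift x k : cell_dir a G (x + lat k) = cell_dir a G x.
Proof.
congr (flat_dir a _); apply/setP => i; rewrite !inE; apply: asbool_equiv_eq.
by rewrite linearD; exact: levels_shiftE.
Qed.

Lemma translate_cell_refl x : translate_cell G x x.
Proof. by exists 0; rewrite raddf0 addr0. Qed.

Lemma translate_cell_sym x y : translate_cell G x y -> translate_cell G y x.
Proof.
move=> [k /same_cell_subl xy]; exists (- k); rewrite raddfN.
exact: same_cell_sym.
Qed.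

Lemma translate_cell_trans x y z :
  translate_cell G x y -> translate_cell G y z -> translate_cell G x z.
Proof.
move=> [k xy] [l yz]; exists (l + k); rewrite raddfD addrA.
exact/(same_cell_trans xy)/same_cell_shift.
Qed.

Lemma translate_cell_dir x y :
  translate_cell G x y -> cell_dir a G x = cell_dir a G y.
Proof. by move=> [k /same_cell_dir ->]; exact: cell_dir_shift. Qed.

Lemma signed_count_transversal K s s' :
  transversal_of (translate_cell G) K s ->
  transversal_of (translate_cell G) K s' ->
  signed_count G s = signed_count G s'.
Proof.
apply: sum_transversal => [x y _ _|x y z _ _ _|x y _ _ xy].
- exact: translate_cell_sym.
- exact: translate_cell_trans.
- by rewrite (translate_cell_dir xy).
Qed.

End Translations.

Section Refinement.
Variables (G B : I -> set R) (S : {set I}) (x0 : V).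
Hypothesis Glf : locally_finite G.
Hypothesis GB : forall i, G i `<=` B i.
Hypothesis Gp : periodic G.
Hypothesis Bp : periodic B.
Hypothesis Gfree : free_translations G.
Hypothesis GS : in_levels a G S x0.

Lemma transversal_refine s (t : V -> seq V) :
  transversal_of (translate_cell G) (flat a S x0) s ->
  (forall x, transversal_of (same_cell a B) (cell a G x) (t x)) ->
  transversal_of (translate_cell B) (flat a S x0) [seq z | x <- s, z <- t x].
Proof.
move=> [sS s_cov s_inj s_uniq] tP.
have t_cell x z : z \in t x -> same_cell a G x z.
  by have [tx _ _ _] := tP x; exact: tx.
apply: transversal_allpairs => // [x _|x xs|y yS|].
- exact: translate_cell_refl.
- have [_ _ _ t_uniq] := tP x; split=> // z /t_cell.
  exact: (cell_sub_flat GS (sS x xs)).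
- have [x xs [k yx]] := s_cov y yS; have [_ t_cov _ _] := tP x.
  have /(same_cell_subl Gp)/same_cell_sym := yx.
  move=> /t_cov[z zt yz].
  by exists x, z; split=> //; exists k; exact/(same_cell_subl Bp).
move=> x x' xs xs' z z' zt zt' [k zz'].
have xx' : same_cell a G x (x' + lat k).
  apply: same_cell_trans (t_cell x z zt) _.
  apply: same_cell_trans (sub_same_cell GB zz') _.
  by apply/same_cell_shift => //; exact/same_cell_sym/t_cell.
have xE : x = x' by apply: s_inj => //; exists k.
rewrite -xE in xx' zt' *; split=> //; have [_ _ t_inj _] := tP x.
apply: t_inj => //.
by move: zz'; rewrite (Gfree xx') raddf0 addr0.
Qed.

Hypothesis Blf : locally_finite B.
Hypothesis Gu : unbounded_levels G.

Lemma signed_count_refine s :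
  transversal_of (translate_cell G) (flat a S x0) s ->
  exists2 t, transversal_of (translate_cell B) (flat a S x0) t
    & signed_count B t = signed_count G s.
Proof.
move=> sP; have /choice[t tP] : forall x, exists t,
    transversal_of (same_cell a B) (cell a G x) t /\
    signed_count B t = (-1) ^+ \dim (cell_dir a G x).
  move=> x; have xne : cell a G x !=set0 by exists x.
  have [t t_trans t_sum] :=
    euler_cells Blf (relopen_cell a Glf x) xne (cell_bounded x Gu).
  exists t; split=> //; rewrite -t_sum; apply: eq_big_seq => y yt.
  have [tx _ _ _] := t_trans; congr (_ ^+ \dim _).
  apply/esym/capv_idPr; rewrite (same_cell_dir (tx y yt)).
  by apply/subvP => u /cell_dirP uy; apply/cell_dirP => i /GB; exact: uy.
exists [seq z | x <- s, z <- t x].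
  by apply: transversal_refine => // x; exact: (tP x).1.
rewrite /signed_count big_allpairs_dep; apply: eq_bigr => x _.
exact: (tP x).2.
Qed.

End Refinement.

Section Halving.
Variable z0 : V.

Definition reflect_double x : V := x *+ 2 - z0.

Definition midpoint x : V := 2^-1 *: (x + z0).

(* The levels of the image of the arrangement under midpoint. *)
Definition halve G : I -> set R := fun i => [set h | G i (2 * h - a i z0)].

Lemma midpointK x : reflect_double (midpoint x) = x.
Proof.
have half2 : 2^-1 *+ 2 = 1 :> R by lra.
by rewrite /reflect_double /midpoint scalerMnl half2 scale1r addrK.
Qed.

Lemma form_double i x : a i (reflect_double x) = 2 * a i x - a i z0 :> R.
Proof. by rewrite linearB raddfMn /= mulr_natl. Qed.

Lemma reflect_double_shift x k :
  reflect_double (x + lat k) = reflect_double x + lat (k + k).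
Proof. by rewrite /reflect_double mulrnDl raddfD; exact: addrAC. Qed.

Lemma double_half (g c : R) : 2 * ((g + c) / 2) - c = g. Proof. by lra. Qed.

Lemma halve_level G i (g : R) : halve G i ((g + a i z0) / 2) <-> G i g.
Proof. by rewrite /halve /= double_half. Qed.

Lemma side_double i h x :
  side (a i) (2 * h - a i z0) (reflect_double x) = 2 * side (a i) h x.
Proof. by rewrite /side form_double opprB addrA subrK mulrBr. Qed.

Lemma same_cell_halve G x y :
  same_cell a (halve G) x y <->
  same_cell a G (reflect_double x) (reflect_double y).
Proof.
have sg2 (r : R) : Num.sg (2 * r) = Num.sg r by rewrite sgrM gtr0_sg ?mul1r.
split=> xy i g Gg; last by have := xy i _ Gg; rewrite !side_double !sg2.
by rewrite -(double_half g (a i z0)) !side_double !sg2; exact/xy/halve_level.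
Qed.

Lemma cell_dir_halve G x :
  cell_dir a (halve G) x = cell_dir a G (reflect_double x).
Proof. by congr (flat_dir a _); apply/setP => i; rewrite !inE form_double. Qed.

Lemma halve_periodic G : periodic G -> periodic (halve G).
Proof.
have E (h d c : R) : 2 * (h + d) - c = 2 * h - c + (d + d) by lra.
move=> Gp i h k /= Gh; have := Gp i _ (k + k) Gh.
by rewrite raddfD linearD /halve /= E.
Qed.

Lemma halve_locally_finite G : locally_finite G -> locally_finite (halve G).
Proof.
move=> Glf i M; set c : R := a i z0.
have := finite_image (fun g : R => (g + c) / 2) (Glf i (2 * M + `|c|)).
apply: sub_finite_set => h [/= Gh hM]; exists (2 * h - c); last by lra.
split=> //; apply: le_trans (ler_normB _ _) _; rewrite lerD2r normrM.
by rewrite ger0_norm // ler_wpM2l.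
Qed.

Lemma halve_unbounded G : unbounded_levels G -> unbounded_levels (halve G).
Proof.
move=> Gu i M; have [[g Gg gM] [h Gh hM]] := Gu i (2 * M - a i z0).
split; [exists ((g + a i z0) / 2)|exists ((h + a i z0) / 2)];
  try exact/halve_level.
  by move: gM; move: (a i z0 : R) => c; lra.
by move: hM; move: (a i z0 : R) => c; lra.
Qed.

Lemma halve_free_translations G :
  free_translations G -> free_translations (halve G).
Proof.
move=> Gfree x k /same_cell_halve; rewrite reflect_double_shift.
by move=> /Gfree /addr_double_eq0.
Qed.

Lemma in_levels_halve G S : in_levels a G S z0 -> in_levels a (halve G) S z0.
Proof.
by move=> GS i iS; rewrite /halve /= mulr_natl mulr2n addrK; exact: GS.
Qed.

Variables (G : I -> set R) (S : {set I}).
Hypothesis Gp : periodic G.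
Hypothesis Gfree : free_translations G.
Hypothesis GS : in_levels a G S z0.

(* The classes modulo 2 of the lattice vectors along the flat. *)
Definition parities : {set {ffun 'I_m -> bool}} :=
  [set p | `[< exists2 k, lat k \in flat_dir a S & parity k = p >]]%SET.

Lemma card_parities_gt1 : (exists2 k, k != 0 & lat k \in flat_dir a S) ->
  (1 < #|parities|)%N.
Proof.
have half_dir d : lat (d + d) \in flat_dir a S -> lat d \in flat_dir a S.
  rewrite raddfD => /flat_dirP dS; apply/flat_dirP => i iS.
  by have /eqP := dS i iS; rewrite linearD -mulr2n mulrn_eq0 => /eqP.
move=> /(exists_odd half_dir)[k k_odd kS].
apply/card_gt1P; exists (parity k), (parity 0); split=> //.
  by rewrite inE; apply/asboolP; exists k.
by rewrite inE; apply/asboolP; exists 0; rewrite // raddf0 mem0v.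
Qed.

Variable rep : {ffun 'I_m -> bool} -> 'rV[int]_m.
Hypothesis repP : {in parities, forall p, lat (rep p) \in flat_dir a S /\
  parity (rep p) = p}.

Definition halves x : seq V :=
  [seq midpoint (x + lat (rep p)) | p <- enum parities].

Lemma form_midpoint i x : a i (midpoint x) = 2^-1 * (a i x + a i z0) :> R.
Proof. by rewrite linearZ linearD. Qed.

Lemma midpoint_flat x u : flat a S z0 x -> u \in flat_dir a S ->
  flat a S z0 (midpoint (x + u)).
Proof.
move=> xS uS i iS; rewrite form_midpoint (flat_add xS uS iS) -mulr2n.
by rewrite mulrnAr -mulrnAl -mulr_natr mulVf ?mul1r // pnatr_eq0.
Qed.

Lemma reflect_double_flat y : flat a S z0 y -> flat a S z0 (reflect_double y).
Proof. by move=> yS i iS; rewrite form_double yS // mulr_natl mulr2n addrK. Qed.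

Lemma transversal_halves s :
  transversal_of (translate_cell G) (flat a S z0) s ->
  transversal_of (translate_cell (halve G)) (flat a S z0)
    [seq y | x <- s, y <- halves x].
Proof.
move=> [sS s_cov s_inj s_uniq].
have inj x x' p p' k :
    x \in s -> x' \in s -> p \in parities -> p' \in parities ->
    same_cell a (halve G) (midpoint (x + lat (rep p)))
      (midpoint (x' + lat (rep p')) + lat k) -> x = x' /\ p = p'.
  move=> xs xs' pP pP' /same_cell_halve.
  rewrite reflect_double_shift !midpointK -addrA -raddfD => xx'.
  have [_ pE] := repP pP; have [_ pE'] := repP pP'.
  have {}xx' : same_cell a G x (x' + lat (rep p' + (k + k) - rep p)).
    by apply/(same_cell_shift Gp _ _ (rep p)); rewrite -addrA -raddfD subrK.
  have xE : x = x' by apply: s_inj => //; exists (rep p' + (k + k) - rep p).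
  split=> //; rewrite -xE in xx'; have /eqP := Gfree xx'.
  by rewrite subr_eq0 => /eqP repE; rewrite -pE -repE parity_addr_double.
apply: transversal_allpairs => // [x _|x xs|y yS|x x' xs xs' z z' zx zx'].
- exact: translate_cell_refl.
- split=> [_ /mapP[p + ->]|].
    rewrite mem_enum => /repP[pS _]; exact: midpoint_flat (sS x xs) pS.
  rewrite map_inj_in_uniq ?enum_uniq // => p p'; rewrite !mem_enum => pP pP' E.
  by have [|//] := inj x x p p' 0 xs xs pP pP'; rewrite raddf0 addr0 E.
- have [x xs [k yx]] := s_cov _ (reflect_double_flat yS).
  have kS : lat k \in flat_dir a S.
    have := flat_sub (sS x xs) (cell_sub_flat GS (reflect_double_flat yS) yx).
    by rewrite addrC addKr.
  have kP : parity k \in parities by rewrite inE; apply/asboolP; exists k.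
  have [_ /esym/parity_eqP[d kd]] := repP kP.
  exists x, (midpoint (x + lat (rep (parity k)))); split=> //.
    by apply: map_f; rewrite mem_enum.
  exists d; apply/same_cell_halve.
  by rewrite reflect_double_shift midpointK -addrA -raddfD -kd.
- case/mapP: zx => p + ->; case/mapP: zx' => p' + ->; rewrite !mem_enum.
  by move=> pP' pP [k /inj[]// -> ->].
Qed.

Lemma signed_count_halves s :
  signed_count (halve G) [seq y | x <- s, y <- halves x] =
  #|parities|%:R * signed_count G s.
Proof.
rewrite /signed_count big_allpairs_dep mulr_sumr; apply: eq_bigr => x _.
rewrite big_map -sum1_card -big_enum natr_sum mulr_suml; apply: eq_bigr => p _.
by rewrite cell_dir_halve midpointK cell_dir_shift // mul1r.
Qed.

End Halving.

Lemma locally_finiteU G B : locally_finite G -> locally_finite B ->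
  locally_finite (fun i => G i `|` B i).
Proof.
move=> Glf Blf i M.
have : finite_set
    ([set g | G i g /\ `|g| <= M] `|` [set g | B i g /\ `|g| <= M]).
  by rewrite finite_setU.
by apply: sub_finite_set => g [[Gg|Bg] gM]; [left|right].
Qed.

(* The count for G is unchanged by superposing the image of the arrangement
   under the homothety of ratio 1/2, and so is the count for that image; but
   the latter is the former multiplied by the number of parities. *)
Lemma signed_count_eq0 G S x0 s :
  locally_finite G -> periodic G -> unbounded_levels G -> free_translations G ->
  in_levels a G S x0 -> transversal_of (translate_cell G) (flat a S x0) s ->
  (exists2 k, k != 0 & lat k \in flat_dir a S) -> signed_count G s = 0.
Proof.
move=> Glf Gp Gu Gfree GS sP /card_parities_gt1; set Gh := halve x0 G.
have /choice[rep repP] : forall p, exists k, p \in parities S ->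
    lat k \in flat_dir a S /\ parity k = p.
  move=> p; case: (boolP (p \in parities S)) => [|_]; last by exists 0.
  by rewrite inE => /asboolP[k kS kp]; exists k.
have hP := transversal_halves Gp Gfree GS repP sP.
have Ghp : periodic Gh := halve_periodic Gp.
have Ghlf : locally_finite Gh := halve_locally_finite x0 Glf.
pose B i := G i `|` Gh i.
have Blf : locally_finite B := locally_finiteU Glf Ghlf.
have Bp : periodic B.
  by move=> i g k [Gg|Gg]; [left; exact: Gp|right; exact: Ghp].
have [t tP tE] := signed_count_refine Glf (fun i => @subsetUl _ _ _) Gp Bp Gfree
  GS Blf Gu sP.
have [t' tP' tE'] := signed_count_refine Ghlf (fun i => @subsetUr _ _ _) Ghp Bp
  (halve_free_translations Gfree) (in_levels_halve GS) Blf
  (halve_unbounded x0 Gu) hP.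
have := signed_count_halves x0 S Gp rep s.
rewrite -tE' -(signed_count_transversal Bp tP tP') tE natz.
by move: #|_| (signed_count G s) => c X; nia.
Qed.

End Periodic.

(** * The topology of the torus *)

Lemma connected_component_eq (T : topologicalType) (E D : set T) (x : T) :
  connected D -> D `<=` E -> D x ->
  (forall p, E p -> nbhs p [set q | E q -> (D q <-> D p)]) ->
  connected_component E x = D.
Proof.
move=> Dconn DE Dx loc; apply/seteqP.
split; last exact: connected_component_max.
set C := connected_component E x.
have CE : C `<=` E by exact: connected_component_sub.
have Cx : C x by apply: connected_component_refl; exact: DE.
suff CD : C `&` D = C by rewrite -CD; exact: subIsetr.
apply: (component_connected (A := E) (x := x)); first by exists x.
  exists [set q | E q -> D q]°; first exact: open_interior.
  apply/seteqP; split=> p [Cp]; last first.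
    by move=> /nbhs_singleton /= Dp; split=> //; apply: Dp; exact: CE.
  move=> Dp; split=> //; apply: filterS (loc p (CE p Cp)) => q /= H Eq.
  by apply/(H Eq).
exists (~` [set q | E q -> ~ D q]°).
  by apply: open_closedC; exact: open_interior.
apply/seteqP; split=> p [Cp].
  by move=> Dp; split=> // /nbhs_singleton /= /(_ (CE p Cp)).
move=> Op; split=> //; apply: contrapT => nDp; apply: Op.
by apply: filterS (loc p (CE p Cp)) => q /= H Eq /(H Eq).
Qed.

Lemma segment_convex_connected (R : realType) (V : normedModType R)
    (F : set V) :
  segment_convex F -> connected F.
Proof.
move=> Fc; have [->|/set0P[x Fx]] := eqVneq F set0; first exact: connected0.
have -> : F =
    \bigcup_(y in F) ((fun t : R => x + t *: (y - x)) @` `[0, 1]%classic).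
  apply/seteqP; split=> [y Fy|_ [y Fy [t /= t01 <-]]].
    exists y => //; exists 1; first by rewrite /= in_itv /= ler01 lexx.
    by rewrite scale1r addrC subrK.
  by apply: Fc => //; rewrite in_itv in t01.
apply: bigcup_connected => [|y _].
  exists x => y _; exists 0; first by rewrite /= in_itv /= lexx ler01.
  by rewrite scale0r addr0.
apply: connected_continuous_connected; first exact: segment_connected.
apply: continuous_subspaceT => t; apply: cvgD; first exact: cvg_cst.
by apply: cvgZr_tmp; exact: cvg_id.
Qed.

Lemma convex_setP (R : realType) n (F : set 'rV[R]_n) :
  convex_set F <-> segment_convex F.
Proof.
have E x y (t : R) : t *: y + (1 - t) *: x = x + t *: (y - x) :> 'rV[R]_n.
  by rewrite scalerBl scalerBr scale1r addrCA.
split=> [Fc x y t Fx Fy /andP[t0 t1]|Fc x y t].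
  have := Fc y x (Itv01 t0 t1); rewrite !inE => /(_ Fy Fx).
  by rewrite /conv /= /unstable.onem E.
rewrite !inE => Fx Fy; rewrite /conv /= /unstable.onem E; apply: Fc => //.
by rewrite ge0 le1.
Qed.

Lemma unit_interval_pigeonhole (R : realType) (T : countType) (f : R -> T) :
  exists t s, [/\ 0 <= t <= 1, 0 <= s <= 1, t != s & f t = f s].
Proof.
apply: contrapT => nf.
have : countable (`[0, 1]%classic : set R).
  apply/countable_injP; exists (choice.pickle \o f) => t s.
  rewrite !inE /= !in_itv /= => t01 s01 /(pcan_inj choice.pickleK) fts.
  apply: contrapT => ts; apply: nf.
  by exists t, s; split=> //; exact/eqP.
move=> /countable_lebesgue_measure0.
rewrite lebesgue_measure_itv /= lte_fin ltr01.
by rewrite oppr0 adde0 => /eqP; rewrite eqe oner_eq0.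
Qed.

Section IntegerVectors.
Variables (R : realType) (n : nat).
Implicit Types (x : 'rV[R]_n) (k : 'rV[int]_n).

Definition int_vec k : 'rV[R]_n := map_mx intr k.

Lemma int_vec_is_zmod_morphism : zmod_morphism int_vec.
Proof. by move=> k l; exact: map_mxB. Qed.

HB.instance Definition _ := GRing.isZmodMorphism.Build 'rV[int]_n 'rV[R]_n
  int_vec int_vec_is_zmod_morphism.

Lemma normr_entry x j : `|x 0 j| <= `|x|.
Proof.
rewrite [leRHS]/Num.norm /= mx_normrE.
by apply/bigmax_geP; right; exists (0, j).
Qed.

Lemma int_vec_small k : `|int_vec k| < 1 -> k = 0.
Proof.
move=> k1; apply/rowP => j; rewrite [RHS]mxE.
have := le_lt_trans (normr_entry (int_vec k) j) k1.
by rewrite mxE -intr_norm -[1]/(1%:~R) ltr_int; move: (k 0 j) => c; lia.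
Qed.

End IntegerVectors.

Section TorusTopology.
Variables (R : realType) (n : nat).
Implicit Types (x y z : 'rV[R]_n) (k : 'rV[int]_n) (P Q : torus R n).
Implicit Types F : set 'rV[R]_n.
Local Notation pr := (@torus_proj R n).
Local Notation Zv := (@int_vec R n).

Lemma torus_projP x y : pr x = pr y <-> exists k, x = y + Zv k.
Proof.
split=> [/eqmodP/asboolP[k xy]|[k ->]].
  by exists k; rewrite /int_vec -xy addrC subrK.
by apply/eqmodP/asboolP; exists k; rewrite addrC addKr.
Qed.

Lemma torus_projD x k : pr (x + Zv k) = pr x.
Proof. by apply/torus_projP; exists k. Qed.

Lemma torus_proj_surj P : exists x, P = pr x.
Proof. by exists (repr P); rewrite /torus_proj reprK. Qed.

Lemma torus_proj_continuous : continuous pr.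
Proof. exact: pi_continuous. Qed.

Lemma torus_proj_ball_open x (e : R) : open (pr @` ball x e).
Proof.
rewrite /open /= /quotient_open.
have -> : \pi_(torus R n)%qT @^-1` (pr @` ball x e) =
    \bigcup_(k in setT) ball (x + Zv k) e.
  apply/seteqP; split=> [y [z xz /torus_projP[k zy]]|y [k _]].
    exists (- k) => //; move: xz; rewrite zy -!ball_normE /= raddfN.
    by rewrite opprD addrCA addrC.
  rewrite -ball_normE /= => xy; exists (y - Zv k); last first.
    by rewrite -raddfN; exact: torus_projD.
  by rewrite /= opprB addrA.
by apply: bigcup_open => k _; exact: ball_open.
Qed.

Lemma nbhs_torusP x (W : set (torus R n)) :
  nbhs (pr x) W <-> exists2 e, 0 < e & forall y, `|y - x| < e -> W (pr y).
Proof.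
split=> [/torus_proj_continuous /nbhs_ballP[e /= e0 xe]|[e e0 xe]].
  by exists e => // y yx; apply: xe; rewrite -ball_normE /= distrC.
rewrite nbhsE; exists (pr @` ball x e); last first.
  by move=> _ [y + <-]; rewrite -ball_normE /= distrC; exact: xe.
by split; [exact: torus_proj_ball_open|exists x => //; exact: ballxx].
Qed.

Lemma connected_convex_image F : segment_convex F -> connected (pr @` F).
Proof.
move=> Fc; apply: connected_continuous_connected.
  exact: segment_convex_connected.
exact/continuous_subspaceT/torus_proj_continuous.
Qed.

(* A segment of F1 is uncountable, so two of its points lie in the same
   translate of F2. *)
Lemma affine_hull_dim_le F1 F2 d1 d2 : segment_convex F1 ->
  affine_hull_dim F1 d1 -> affine_hull_dim F2 d2 -> pr @` F1 `<=` pr @` F2 ->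
  (d1 <= d2)%N.
Proof.
move=> F1c [p1 [V1 [Fp1 _ V1min <-]]] [p2 [V2 [Fp2 FV2 _ <-]]] F12.
apply: dimvS; apply: V1min => y Fy.
have /choice[k kP] : forall t, exists k, 0 <= t <= 1 ->
    p1 + t *: (y - p1) + Zv k - p2 \in V2.
  move=> t; have [t01|nt01] := pselect (0 <= t <= 1); last by exists 0.
  have [z Fz /torus_projP[k zE]] : (pr @` F2) (pr (p1 + t *: (y - p1))).
    by apply: F12; exists (p1 + t *: (y - p1)) => //; exact: F1c.
  by exists k => _; rewrite -zE; exact: FV2.
have [t [s [t01 s01 ts kts]]] := unit_interval_pigeonhole k.
have := rpredB (kP t t01) (kP s s01); rewrite kts.
have -> : p1 + t *: (y - p1) + Zv (k s) - p2 -
    (p1 + s *: (y - p1) + Zv (k s) - p2) = (t - s) *: (y - p1).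
  by rewrite opprD addrACA subrr addr0 opprD addrACA subrr addr0 opprD addrACA
    subrr add0r scalerBl.
by move=> /(rpredZ (t - s)^-1); rewrite scalerA mulVf ?scale1r // subr_eq0.
Qed.

Lemma torus_dimE F d : segment_convex F -> affine_hull_dim F d ->
  torus_dim (pr @` F) = d.
Proof.
move=> Fc Fd; apply: xget_unique.
  by exists F; split=> //; exact/convex_setP.
move=> e [F' [/convex_setP Fc' FF' Fe]]; apply/eqP; rewrite eqn_leq.
rewrite (affine_hull_dim_le Fc' Fe Fd) ?FF' //.
by rewrite (affine_hull_dim_le Fc Fd Fe) ?FF'.
Qed.

End TorusTopology.

(** * Loops in the closure of a ball cell *)

Lemma continuous_comp_within (T U V : topologicalType) (A : set U)
    (h : T -> U) (g : U -> V) :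
  continuous h -> (forall t, A (h t)) -> {within A, continuous g} ->
  continuous (g \o h).
Proof.
move=> hc hA /subspace_continuousP gc t W Wg.
have nearA : nbhs t (h @^-1` [set u | A u -> W (g u)]).
  exact: hc t _ (gc (h t) (hA t) W Wg).
change (nbhs t ((g \o h) @^-1` W)).
by apply: filterS nearA => s /=; apply; exact: hA.
Qed.

Section Clamp.
Variable R : realType.

Definition clamp (r : R) : R := Num.max 0 (Num.min 1 r).

Lemma clamp_continuous : continuous clamp.
Proof.
move=> r; apply: (@continuous_max R R (fun=> 0) ((fun=> 1) \min id)).
  exact: cvg_cst.
by apply: continuous_min; [exact: cvg_cst|exact: cvg_id].
Qed.

Lemma clamp_id r : 0 <= r <= 1 -> clamp r = r.
Proof. by move=> /andP[r0 r1]; rewrite /clamp (min_idPr r1) (max_idPr r0). Qed.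

Lemma clamp01 r : 0 <= clamp r <= 1.
Proof. by rewrite /clamp le_max lexx ge_max ler01 ge_min lexx. Qed.

End Clamp.

Section Winding.
Variables (R : realType) (n : nat).
Implicit Types (x y u v : 'rV[R]_n) (k : 'rV[int]_n) (P Q S : torus R n).
Implicit Type N : nat.
Local Notation pr := (@torus_proj R n).
Local Notation Zv := (@int_vec R n).

Definition torus_close (e : R) P Q :=
  exists x u, [/\ P = pr x, Q = pr (x + u) & `|u| < e].

Lemma torus_close_lift e x Q : torus_close e (pr x) Q ->
  exists2 u, Q = pr (x + u) & `|u| < e.
Proof.
move=> [y [u [/torus_projP[k ->] -> ue]]]; exists u => //.
by rewrite addrAC torus_projD.
Qed.

Lemma torus_close_trans P Q S e d :
  torus_close e Q P -> torus_close d Q S -> torus_close (e + d) P S.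
Proof.
move=> [x [u [-> -> ue]]] /torus_close_lift[v -> vd]; exists (x + u), (v - u).
split=> //; first by rewrite addrACA subrr addr0 addrC.
by rewrite (addrC e); apply: le_lt_trans (ler_normB _ _) _; exact: ltrD.
Qed.

Lemma torus_proj_inj_small x y : pr x = pr y -> `|x - y| < 1 -> x = y.
Proof.
move=> /torus_projP[k ->]; rewrite addrC addKr => /int_vec_small ->.
by rewrite raddf0 addr0.
Qed.

Definition torus_diff P Q : 'rV[R]_n :=
  xget 0 [set u | `|u| < 4^-1 /\ exists2 x, P = pr x & Q = pr (x + u)].

Lemma torus_diffE x u : `|u| < 4^-1 -> torus_diff (pr x) (pr (x + u)) = u.
Proof.
move=> u4; apply: xget_unique => [|v [v4 [y /torus_projP[k ->]]]].
  by split=> //; exists x.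
rewrite addrAC torus_projD => /torus_proj_inj_small yuv.
apply: (addrI y); rewrite yuv // opprD addrACA subrr add0r.
by apply: le_lt_trans (ler_normB _ _) _; lra.
Qed.

Lemma torus_diff_square P Q P' Q' :
  torus_close 4^-1 P Q -> torus_close 4^-1 Q Q' ->
  torus_close 4^-1 P P' -> torus_close 4^-1 P' Q' ->
  torus_diff P Q + torus_diff Q Q' = torus_diff P P' + torus_diff P' Q'.
Proof.
move=> [x [u [-> -> u4]]] /torus_close_lift[v -> v4].
move=> /torus_close_lift[w -> w4] /torus_close_lift[z xz z4].
rewrite {2}xz !torus_diffE //; apply: (addrI x).
apply: torus_proj_inj_small; first by rewrite !addrA.
rewrite opprD addrACA subrr add0r.
apply: le_lt_trans (ler_normB _ _) _.
have := ler_normD u v; have := ler_normD w z; lra.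
Qed.

Definition winding N (p : nat -> torus R n) : 'rV[R]_n :=
  \sum_(0 <= j < N) torus_diff (p j) (p j.+1).

Lemma winding_cst N P : winding N (fun=> P) = 0.
Proof.
rewrite /winding big1 // => j _; have [x ->] := torus_proj_surj P.
by rewrite -{2}(addr0 x) torus_diffE // normr0 invr_gt0.
Qed.

Lemma winding_line N x u : (0 < N)%N -> `|N%:R^-1 *: u| < 4^-1 ->
  winding N (fun j => pr (x + (j%:R / N%:R) *: u)) = u.
Proof.
move=> N0 Nu; transitivity (\sum_(0 <= j < N) N%:R^-1 *: u).
  apply: eq_bigr => j _; rewrite -natr1 mulrDl mul1r scalerDl addrA.
  exact: torus_diffE.
rewrite sumr_const_nat subn0 scalerMnl -mulr_natl mulfV ?scale1r //.
by rewrite pnatr_eq0 -lt0n.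
Qed.

Lemma winding_homotopy N (p q : nat -> torus R n) :
  (forall j, (j < N)%N -> torus_close 4^-1 (p j) (p j.+1)) ->
  (forall j, (j < N)%N -> torus_close 4^-1 (q j) (q j.+1)) ->
  (forall j, (j <= N)%N -> torus_close 4^-1 (p j) (q j)) ->
  p N = p 0%N -> q N = q 0%N -> winding N p = winding N q.
Proof.
move=> pp qq pq pN qN; apply/eqP; rewrite -subr_eq0; apply/eqP.
transitivity (\sum_(0 <= j < N)
  (torus_diff (p j) (q j) - torus_diff (p j.+1) (q j.+1))); last first.
  under eq_bigr do rewrite -opprB.
  by rewrite sumrN telescope_sumr // pN qN subrr oppr0.
rewrite /winding -sumrB; apply: eq_big_nat => j /andP[_ jN]; apply/eqP.
rewrite subr_eq addrAC eq_sym subr_eq eq_sym.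
by apply/eqP/torus_diff_square; auto using ltnW.
Qed.

Lemma torus_close_uniform (h : R * R -> torus R n) : continuous h ->
  exists2 d, 0 < d & forall s t s' t', 0 <= s <= 1 -> 0 <= t <= 1 ->
    `|s' - s| < d -> `|t' - t| < d -> torus_close 4^-1 (h (s, t)) (h (s', t')).
Proof.
move=> hc; pose K : set (R * R) := `[0, 1]%classic `*` `[0, 1]%classic.
have Kc : compact K by apply: compact_setX; exact: segment_compact.
pose close_at (d : R) (p : R * R) := forall s' t',
  `|s' - p.1| < d -> `|t' - p.2| < d -> torus_close 4^-1 (h p) (h (s', t')).
have := (compact_near_coveringP K).1 Kc R (at_right 0) close_at _.
move=> /(_ _)[p Kp|e /= e0 eP]; last first.
  exists (e / 2) => [|s t s' t' s01 t01 ss' tt']; first by lra.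
  apply: (eP (e / 2)) => //=; last by lra.
  by rewrite sub0r normrN gtr0_norm; lra.
have : nbhs (h p) (torus_close 8^-1 (h p)).
  have [x ->] := torus_proj_surj (h p); apply/nbhs_torusP.
  exists 8^-1 => // y yx.
  by exists x, (y - x); rewrite addrC subrK.
move=> /hc /nbhs_ballP[r /= r0 rP].
have hr s t : `|s - p.1| < r -> `|t - p.2| < r ->
    torus_close 8^-1 (h p) (h (s, t)).
  by move=> sr tr; apply: rP; split; rewrite /= /ball /= distrC.
exists (ball p (r / 2), [set d : R | 0 < d < r / 2]) => /=.
  split; first by apply: nbhsx_ballx; lra.
  exists (r / 2); first by rewrite /=; lra.
  by move=> d /=; rewrite sub0r normrN => dr d0; rewrite d0 -(gtr0_norm d0).
move=> [[s t] d] /= [[]]; rewrite /ball /= => ps pt /andP[d0 dr] s' t' ss' tt'.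
have -> : 4^-1 = 8^-1 + 8^-1 :> R by lra.
apply: torus_close_trans; apply: hr.
- by rewrite distrC; lra.
- by rewrite distrC; lra.
- by rewrite /= in ss'; have := ler_distD s s' p.1; rewrite (distrC s p.1); lra.
- by rewrite /= in tt'; have := ler_distD t t' p.2; rewrite (distrC t p.2); lra.
Qed.

Lemma exists_fine_subdivision (e : R) u : 0 < e ->
  exists N, [/\ (0 < N)%N, N%:R^-1 < e & `|N%:R^-1 *: u| < 4^-1].
Proof.
move=> e0; have u0 : 0 < 4 * `|u| + 1 by rewrite ltr_wpDl // mulr_ge0.
have d0 : 0 < Num.min e (4 * `|u| + 1)^-1 by rewrite lt_min e0 invr_gt0.
have [N] := ltr_add_invr d0; rewrite add0r lt_min => /andP[Ne Nu].
exists N.+1; split=> //; rewrite normrZ gtr0_norm ?invr_gt0 //.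
have Nu' : 4 * `|u| + 1 < N.+1%:R by rewrite -ltf_pV2 ?posrE.
by rewrite mulrC ltr_pdivrMr //; lra.
Qed.

(* The winding number of the loops t |-> h (s, t) does not depend on s. *)
Lemma null_homotopic_loop (h : R * R -> torus R n) x k : continuous h ->
  (forall s, h (s, 1) = h (s, 0)) -> (forall t, h (0, t) = h (0, 0)) ->
  (forall t, 0 <= t <= 1 -> h (1, t) = pr (x + t *: Zv k)) -> k = 0.
Proof.
move=> hc h_loop h_cst h_line; have [e e0 eP] := torus_close_uniform hc.
have [N [N0 Ne Nk]] := exists_fine_subdivision (Zv k) e0.
have NR : N%:R != 0 :> R by rewrite pnatr_eq0 -lt0n.
pose c (j : nat) : R := j%:R / N%:R.
have c01 j : (j <= N)%N -> 0 <= c j <= 1.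
  by move=> jN; rewrite divr_ge0 //= ler_pdivrMr ?ltr0n // mul1r ler_nat.
have cS j : `|c j.+1 - c j| < e.
  rewrite -mulrBl -natr1 [_ + 1]addrC addrK mul1r gtr0_norm //.
  by rewrite invr_gt0 ltr0n.
have cc j : `|c j - c j| < e by rewrite subrr normr0.
have c0 : c 0%N = 0 by rewrite /c mul0r.
have cN : c N = 1 by rewrite /c mulfV.
pose row i j := h (c i, c j).
have row_winding i : (i <= N)%N -> winding N (row i) = 0.
  elim: i => [_|i IH iN].
    rewrite -(winding_cst N (h (0, 0))); apply: eq_bigr => j _.
    by rewrite /row c0 !(h_cst (c _)).
  transitivity (winding N (row i)); last exact: IH (ltnW iN).
  apply/esym; apply: winding_homotopy => [j jN|j jN|j jN||].
  - by apply: eP => //; apply: c01; exact: ltnW.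
  - by apply: eP => //; apply: c01; [|exact: ltnW].
  - by apply: eP => //; apply: c01; first exact: ltnW.
  - by rewrite /row cN c0.
  - by rewrite /row cN c0.
apply: (@int_vec_small R); rewrite -(winding_line x N0 Nk).
have -> : winding N (fun j => pr (x + (j%:R / N%:R) *: Zv k)) =
    winding N (row N).
  apply: eq_big_nat => j /andP[_ jN].
  by rewrite /row cN !h_line ?c01 // ltnW.
by rewrite row_winding // normr0 ltr01.
Qed.

(* A loop in a closed ball is contracted by scaling. *)
Lemma ball_cell_loop (C : set (torus R n)) d x k : ball_cell R d C ->
  (forall t, 0 <= t <= 1 -> closure C (pr (x + t *: Zv k))) -> k = 0.
Proof.
move=> [f [g [fc gc fK fC _]]] xC.
pose loop (t : R) := pr (x + clamp t *: Zv k).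
have loopC t : closure C (loop t) by apply: xC; exact: clamp01.
have loop_cont : continuous loop.
  move=> t; apply: (@continuous_comp _ _ _ (fun t => x + clamp t *: Zv k) pr).
    apply: cvgD; first exact: cvg_cst.
    by apply: cvgZr_tmp; exact: clamp_continuous.
  exact: torus_proj_continuous.
have g_cont : continuous (g \o loop).
  exact: continuous_comp_within loop_cont loopC gc.
have gP t : closed_disk (g (loop t)) /\ f (g (loop t)) = loop t.
  by have := loopC t; rewrite -fC => -[w wD <-]; rewrite fK ?inE.
pose scaled (p : R * R) := clamp p.1 *: g (loop p.2).
have scaledD p : closed_disk (scaled p).
  have [+ _] := gP p.2; rewrite /closed_disk /=; apply: le_trans.
  apply: ler_sum => i _; rewrite mxE exprMn ler_piMl ?sqr_ge0 //.
  by have /andP[? ?] := clamp01 p.1; rewrite exprn_ile1.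
have scaled_cont : continuous scaled.
  move=> p; apply: (@cvgZ _ _ _ _ _ (fun p : R * R => clamp p.1)
    (fun p => g (loop p.2))).
    apply: (@continuous_comp _ _ _ fst (@clamp R)); first exact: cvg_fst.
    exact: clamp_continuous.
  apply: (@continuous_comp _ _ _ snd (g \o loop)); first exact: cvg_snd.
  exact: g_cont.
apply: (@null_homotopic_loop (f \o scaled) x k).
- exact: continuous_comp_within scaled_cont scaledD fc.
- move=> s /=; congr (f (_ *: g _)).
  by rewrite /loop !clamp_id ?lexx ?ler01 // scale1r scale0r addr0 torus_projD.
- by move=> t; rewrite /scaled /= clamp_id ?lexx ?ler01 // !scale0r.
- move=> t t01; rewrite /scaled /= clamp_id ?lexx ?ler01 // scale1r.
  by rewrite (gP t).2 /loop clamp_id.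
Qed.

End Winding.

(** * Toric arrangements *)

Lemma form_norm (R : realType) n (f : 'Hom('rV[R]_n, R^o)) (x : 'rV[R]_n) :
  `|f x| <= (\sum_j `|f (delta_mx 0 j)|) * `|x|.
Proof.
rewrite {1}[x]row_sum_delta linear_sum mulr_suml.
apply: le_trans (ler_norm_sum _ _ _) _; apply: ler_sum => j _.
by rewrite linearZ normrM mulrC ler_wpM2l // normr_entry.
Qed.

Lemma forms_near (R : realType) n (I : finType) (a : I -> 'Hom('rV[R]_n, R^o))
    (e : R) : 0 < e ->
  exists2 d, 0 < d & forall u, `|u| < d -> forall i, `|a i u| < e.
Proof.
move=> e0; pose B := \sum_i \sum_j `|a i (delta_mx 0 j)| + 1.
have B0 : 0 < B by rewrite ltr_wpDl // sumr_ge0 // => i _; rewrite sumr_ge0.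
exists (e / B) => [|u ud i]; first exact: divr_gt0.
apply: le_lt_trans (form_norm _ _) _.
apply: (@le_lt_trans _ _ (B * `|u|)); last by rewrite mulrC -ltr_pdivlMr.
rewrite ler_wpM2r // /B (bigD1 i) //= -addrA lerDl addr_ge0 // sumr_ge0 //.
move=> l _.
by rewrite sumr_ge0.
Qed.

Lemma relopen_affine_hull_dim (R : realType) n (K : set 'rV[R]_n) W x :
  relopen_convex K W -> K x -> affine_hull_dim K (\dim W).
Proof.
move=> [KW Kopen _] Kx; exists x, W; split=> // [y Ky|W' KW']; first exact: KW.
apply/subvP => u uW; have [e e0 Ke] := Kopen x u Kx uW.
have e2 : 0 < e / 2 by lra.
have := KW' _ (Ke (e / 2) _); rewrite gtr0_norm // addrC addKr.
move=> /(_ _)/(rpredZ (e / 2)^-1).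
by rewrite scalerA mulVf ?scale1r ?lt0r_neq0 //; apply; lra.
Qed.

Lemma common_denominator n (v : 'rV[rat]_n) : exists (D : int) (k : 'rV[int]_n),
  0 < D /\ forall j, v 0 j * D%:~R = (k 0 j)%:~R.
Proof.
pose D : int := \prod_j denq (v 0 j).
exists D, (\row_j (numq (v 0 j) * \prod_(l | l != j) denq (v 0 l))).
split=> [|j]; first by rewrite prodr_gt0 // => j _; exact: denq_gt0.
rewrite mxE /D (bigD1 j) //= !intrM mulrA; congr (_ * _).
by rewrite -{1}[v 0 j]divq_num_den divfK // intr_eq0 denq_neq0.
Qed.

Lemma common_denominator_ratr (R : realType) n (v : 'rV[rat]_n) :
  exists (D : int) (k : 'rV[int]_n),
    0 < D /\ forall j, ratr (v 0 j) * D%:~R = (k 0 j)%:~R :> R.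
Proof.
have [D [k [D0 kE]]] := common_denominator v; exists D, k; split=> // j.
by have := congr1 (@ratr R) (kE j); rewrite rmorphM /= !ratr_int.
Qed.

Lemma finite_int_bounded (R : realType) (M : R) :
  finite_set [set z : int | `|z%:~R| <= M :> R].
Proof.
have [M0|M0] := ltrP M 0.
  apply: (@sub_finite_set _ _ set0) => // z /=.
  by rewrite leNgt (lt_le_trans M0) // normr_ge0.
pose N := Num.bound M; have NM : M < N%:R := archi_boundP M0.
apply: (@sub_finite_set _ _ ((fun m : nat => m%:Z - N%:Z) @` `I_(N + N).+1)).
  move=> z /= zM; have : `|z%:~R| < N%:R :> R by exact: le_lt_trans NM.
  rewrite -intr_norm -[N%:R]/(N%:Z%:~R) ltr_int => zN.
  by exists (absz (z + N%:Z)); rewrite /=; lia.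
exact/finite_image/finite_II.
Qed.

Lemma int_multiple_gt (R : realType) (r M : R) : r != 0 ->
  exists z : int, M < r * z%:~R.
Proof.
move=> r0; pose N := Num.bound (`|M| / `|r|); exists (sgz r * N%:Z).
have NP : `|M| < N%:R * `|r|.
  by rewrite -ltr_pdivrMr ?normr_gt0 // archi_boundP // divr_ge0.
apply: le_lt_trans (ler_norm _) (lt_le_trans NP _).
by rewrite intrM -sgrEz mulrA [r * _]mulrC -normrEsg mulrC.
Qed.

Section RationalForm.
Variables (R : realType) (n : nat) (v : 'rV[rat]_n).
Local Notation Zv := (@int_vec R n).

Definition dot (x : 'rV[R]_n) : R^o := \sum_j ratr (v 0 j) * x 0 j.

Lemma dot_is_linear : linear dot.
Proof.
move=> k x y; rewrite /dot scaler_sumr -big_split; apply: eq_bigr => j _ /=.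
by rewrite !mxE mulrDr mulrCA.
Qed.

HB.instance Definition _ :=
  GRing.isLinear.Build R 'rV[R]_n R^o _ dot dot_is_linear.

Definition rat_form : 'Hom('rV[R]_n, R^o) := linfun dot.

Lemma rat_formE x : rat_form x = \sum_j ratr (v 0 j) * x 0 j.
Proof. by rewrite lfunE. Qed.

Lemma rat_form_int_values : exists2 D : int, 0 < D &
  forall k, exists z : int, rat_form (Zv k) = z%:~R / D%:~R.
Proof.
have [D [w [D0 wE]]] := common_denominator_ratr R v; exists D => // k.
have D0R : D%:~R != 0 :> R by rewrite intr_eq0 gt_eqF.
exists (\sum_j w 0 j * k 0 j); apply: (canRL (mulfK D0R)).
rewrite rat_formE mulr_suml rmorph_sum; apply: eq_bigr => j _.
by rewrite mxE mulrAC wE rmorphM.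
Qed.

Lemma rat_form_unbounded :
  v != 0 -> forall M : R, exists k, M < rat_form (Zv k).
Proof.
move=> /rV0Pn[j vj] M; have rj : ratr (v 0 j) != 0 :> R by rewrite fmorph_eq0.
have [z Mz] := int_multiple_gt M rj; exists (z *: delta_mx 0 j).
rewrite rat_formE (bigD1 j) //= !mxE !eqxx mulr1 big1 ?addr0 // => l lj.
by rewrite !mxE (negPf lj) andbF mulr0 mulr0.
Qed.

End RationalForm.

Lemma rat_kernel_neq0 (R : realType) n p (M : 'M[rat]_(n, p)) (u : 'rV[R]_n) :
  u != 0 -> u *m map_mx ratr M = 0 ->
  exists2 v : 'rV[rat]_n, v != 0 & v *m M = 0.
Proof.
move=> u0 uM; have : kermx M != 0.
  rewrite -(map_mx_eq0 (@ratr R)) map_kermx; apply: contraNneq u0 => k0.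
  by have /sub_kermxP := uM; rewrite k0 submx0.
by case/rowV0Pn => v /sub_kermxP vM v0; exists v.
Qed.

Lemma int_kernel_neq0 (R : realType) n p (M : 'M[rat]_(n, p)) (u : 'rV[R]_n) :
  u != 0 -> u *m map_mx ratr M = 0 ->
  exists2 k : 'rV[int]_n, k != 0 & int_vec R k *m map_mx ratr M = 0.
Proof.
move=> u0 uM; have [v v0 vM] := rat_kernel_neq0 u0 uM.
have [D [k [D0 kE]]] := common_denominator_ratr R v.
have kvE : int_vec R k = D%:~R *: map_mx ratr v.
  by apply/rowP => j; rewrite !mxE -kE mulrC.
exists k; last by rewrite kvE -scalemxAl -map_mxM vM map_mx0 scaler0.
apply: contraNneq v0 => k0; move/eqP: kvE; rewrite k0 raddf0 eq_sym scaler_eq0.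
by rewrite intr_eq0 (gt_eqF D0) /= map_mx_eq0.
Qed.

Section ToricArrangement.
Variables (R : realType) (n : nat) (I : finType).
Variables (normal : I -> 'rV[rat]_n) (offset : I -> R).
Hypothesis normal_neq0 : forall i, normal i != 0.
Implicit Types (x y z u p q : 'rV[R]_n) (k : 'rV[int]_n) (P Q : torus R n).
Implicit Types S T : {set I}.
Local Notation pr := (@torus_proj R n).
Local Notation Zv := (@int_vec R n).

Definition form i : 'Hom('rV[R]_n, R^o) := rat_form R (normal i).

Definition toric_hyp i : set (torus R n) := pr @` [set x | form i x = offset i].

Definition levels i : set R := [set g | exists k, g = offset i + form i (Zv k)].

Local Notation "x ~~ y" := (same_cell form levels x y) (at level 70).
Local Notation "x ==> y" := (face_le form levels x y).
Local Notation cell := (cell form levels).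
Local Notation cell_dir := (cell_dir form levels).
Local Notation through := (through form levels).
Local Notation flat := (flat form).
Local Notation flat_dir := (flat_dir form).
Local Notation in_levels := (in_levels form levels).
Local Notation translate_cell := (translate_cell form Zv levels).

Lemma toric_hypP i x : toric_hyp i (pr x) <-> levels i (form i x).
Proof.
split=> [[y yb /torus_projP[k yx]]|[k xk]].
  by exists (- k); rewrite raddfN linearN /= -yb yx linearD /= addrK.
exists (x - Zv k); last by rewrite -raddfN torus_projD.
by rewrite /= linearB /= xk addrK.
Qed.

Lemma levels_periodic : periodic form Zv levels.
Proof.
by move=> i g k [l ->]; exists (l + k); rewrite raddfD linearD /= addrA.
Qed.

Lemma levels_locally_finite : locally_finite levels.
Proof.
move=> i M; have [D D0 DP] := rat_form_int_values R (normal i).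
have DR0 : 0 < D%:~R :> R by rewrite ltr0z.
have := finite_image (fun z : int => offset i + z%:~R / D%:~R)
  (finite_int_bounded (D%:~R * (M + `|offset i|) : R)).
apply: sub_finite_set => g [[k gE] gM]; have [z zE] := DP k; exists z.
  rewrite /= -[X in `|X|](divfK (lt0r_neq0 DR0)) normrM (gtr0_norm DR0) mulrC.
  rewrite ler_pM2l // -zE -[rat_form R _]/(form i).
  have -> : form i (Zv k) = g - offset i by rewrite gE addrC addKr.
  by apply: le_trans (ler_normB _ _) _; rewrite lerD2r.
by rewrite gE /form zE.
Qed.

Lemma levels_unbounded : unbounded_levels levels.
Proof.
move=> i M; split.
  have [k Mk] := rat_form_unbounded (normal_neq0 i) (M - offset i).
  by exists (offset i + form i (Zv k)); [exists k|rewrite -ltrBlDl].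
have [k Mk] := rat_form_unbounded (normal_neq0 i) (offset i - M).
exists (offset i + form i (Zv (- k))); first by exists (- k).
by rewrite raddfN linearN /= ltrBlDr -ltrBlDl.
Qed.

Let Gp := levels_periodic.
Let Glf := levels_locally_finite.
Let Gu := levels_unbounded.

Lemma face_le_nbhs y : exists2 d, 0 < d & forall z, `|z - y| < d -> y ==> z.
Proof.
have [e e0 eP] := strip_face_le form Glf y.
have [d d0 dP] := forms_near form e0.
exists d => // z zy; apply: eP => i.
by rewrite /side -[form i y]/(form i y) -linearB; exact: dP.
Qed.

Lemma cell_imageP x y : (pr @` cell x) (pr y) <-> translate_cell y x.
Proof.
split=> [[z xz /torus_projP[k zy]]|[k yx]].
  exists (- k); rewrite raddfN.
  by apply/same_cell_sym/(same_cell_subl Gp); rewrite -zy.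
exists (y - Zv k); last by rewrite -raddfN torus_projD.
by apply/same_cell_sym/(same_cell_subl Gp).
Qed.

Lemma eq_cell_image x y : pr @` cell x = pr @` cell y <-> translate_cell y x.
Proof.
split=> [xy|yx]; first by apply/cell_imageP; rewrite xy; exists y.
apply/seteqP; split=> P; have [z ->] := torus_proj_surj P => /cell_imageP zP;
  apply/cell_imageP; apply: (translate_cell_trans Gp zP) => //.
exact: translate_cell_sym.
Qed.

Lemma same_cell_image x y : x ~~ y -> pr @` cell x = pr @` cell y.
Proof.
move=> xy; apply/eq_cell_image; exists 0; rewrite raddf0 addr0.
exact: same_cell_sym.
Qed.

Lemma flat_imageP S x y :
  (pr @` flat S x) (pr y) <-> exists k, flat S x (y + Zv k).
Proof.
split=> [[z xz /torus_projP[k zy]]|[k xy]]; first by exists k; rewrite -zy.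
by exists (y + Zv k); rewrite ?torus_projD.
Qed.

Lemma eq_flat_image S x y :
  (pr @` flat S x) (pr y) -> pr @` flat S x = pr @` flat S y.
Proof.
move=> /flat_imageP[l xy]; rewrite (flat_eq xy).
apply/seteqP; split=> P; have [z ->] := torus_proj_surj P => /flat_imageP[k zk];
  apply/flat_imageP.
  exists (k - l); apply/(flat_shift _ _ _ _ (Zv l)).
  by rewrite -addrA -raddfD subrK.
by exists (k + l); rewrite raddfD addrA; apply/flat_shift.
Qed.

Lemma in_levels_image S x y :
  in_levels S x -> (pr @` flat S x) (pr y) -> in_levels S y.
Proof.
move=> Sx /flat_imageP[k xy] i iS; apply/(levels_shiftE Gp _ _ k).
by rewrite -linearD /= xy //; exact: Sx.
Qed.

Lemma cell_image_sub_flat S x y : in_levels S x -> (pr @` flat S x) (pr y) ->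
  pr @` cell y `<=` pr @` flat S x.
Proof.
move=> Sx yX; rewrite (eq_flat_image yX) => _ [z yz <-]; exists z => //.
exact: (cell_sub_flat (in_levels_image Sx yX) (@flat_refl _ _ _ _ S y)).
Qed.

Lemma flat_through_sub S x y : in_levels S x -> (pr @` flat S x) (pr y) ->
  pr @` flat (through y) y `<=` pr @` flat S x.
Proof.
move=> Sx yX; rewrite (eq_flat_image yX) => _ [z zA <-]; exists z => // i iS.
by apply/zA/throughP/(in_levels_image Sx yX).
Qed.

Lemma cell_component x :
  connected_component
    [set Q | forall i, toric_hyp i Q <-> toric_hyp i (pr x)] (pr x)
  = pr @` cell x.
Proof.
apply: connected_component_eq.
- by apply: connected_convex_image; have [] := relopen_cell form Glf x.
- move=> _ [y xy <-] i; rewrite !toric_hypP.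
  split=> [Gy|Gx]; first by rewrite (same_cell_on (same_cell_sym xy)).
  by rewrite (same_cell_on xy).
- by exists x.
move=> P; have [y ->] := torus_proj_surj P => Ey; apply/nbhs_torusP.
have [d d0 dP] := face_le_nbhs y; exists d => // z zy Ez.
have yz : y ~~ z.
  move=> i g Gg; have [/eqP|//] := dP z zy i g Gg; rewrite side_eq0 => /eqP yg.
  have Gz : levels i (form i z).
    by apply/toric_hypP/(Ez i)/(Ey i)/toric_hypP; rewrite yg.
  by rewrite /side -(face_le_on (dP z zy) Gz).
have yzT : translate_cell y z by exists 0; rewrite raddf0 addr0.
split=> /cell_imageP tx; apply/cell_imageP.
  exact: translate_cell_trans yzT tx.
exact/(translate_cell_trans Gp)/tx/translate_cell_sym.
Qed.

Lemma flat_component S x : in_levels S x ->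
  connected_component [set Q | forall i, i \in S -> toric_hyp i Q] (pr x)
  = pr @` flat S x.
Proof.
move=> Sx; apply: connected_component_eq.
- by apply: connected_convex_image; exact: flat_convex.
- by move=> _ [y xy <-] i iS; apply/toric_hypP; rewrite xy //; exact: Sx.
- by exists x.
move=> P; have [y ->] := torus_proj_surj P => Ey; apply/nbhs_torusP.
have [d d0 dP] := face_le_nbhs y; exists d => // z zy Ez.
have yz : flat S y z.
  by move=> i iS; rewrite (face_le_on (dP z zy)) //; exact/toric_hypP/Ez.
split=> xP; rewrite (eq_flat_image xP); last by exists z.
by exists y => //; rewrite -(flat_eq yz).
Qed.

Lemma closure_face p q : p ==> q -> closure (pr @` cell q) (pr p).
Proof.
move=> pq W /nbhs_torusP[e e0 eW]; set D := `|q - p|.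
have De : 0 < D + e by rewrite ltr_wpDl ?normr_ge0.
exists (pr (p + (e / (D + e)) *: (q - p))); split.
  exists (p + (e / (D + e)) *: (q - p)) => //.
  apply: face_le_segment; rewrite ?divr_gt0 // ler_pdivrMr // mul1r lerDr.
  exact: normr_ge0.
apply: eW; rewrite addrC addKr normrZ gtr0_norm ?divr_gt0 //.
by rewrite mulrAC ltr_pdivrMr // ltr_pM2l // ltrDl.
Qed.

Lemma closure_cellP p q : pr @` cell p `<=` closure (pr @` cell q) <->
  exists2 q', pr @` cell q = pr @` cell q' & p ==> q'.
Proof.
split=> [pq|[q' -> pq'] _ [y py <-]]; last first.
  exact/closure_face/(same_cell_face_le py).
have [d d0 dP] := face_le_nbhs p.
have : closure (pr @` cell q) (pr p) by apply: pq; exists p.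
move=> /(_ [set Q | exists2 z, Q = pr z & p ==> z])[].
  by apply/nbhs_torusP; exists d => // z /dP pz; exists z.
move=> P [qP [z Pz pz]]; exists z => //; apply/eq_cell_image.
by apply/cell_imageP; rewrite -Pz.
Qed.

Lemma dim_cell x : torus_dim (pr @` cell x) = \dim (cell_dir x).
Proof.
have xK := relopen_cell form Glf x.
by apply: torus_dimE; [have [] := xK|exact: relopen_affine_hull_dim xK _].
Qed.

Lemma dim_flat S x : torus_dim (pr @` flat S x) = \dim (flat_dir S).
Proof.
apply: torus_dimE; first exact: flat_convex.
exact: relopen_affine_hull_dim (relopen_flat form S x) _.
Qed.

Lemma flat_image_dir S T x : in_levels T x ->
  pr @` flat S x `<=` pr @` flat T x -> (flat_dir S <= flat_dir T)%VS.
Proof.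
move=> Tx ST; apply/subvP => u uS; apply/flat_dirP => i iT.
have [d d0 dP] := face_le_nbhs x.
pose t := d / (`|u| + 1); have t0 : 0 < t by rewrite divr_gt0 // ltr_wpDl.
have Ttu : (pr @` flat T x) (pr (x + t *: u)).
  by apply: ST; exists (x + t *: u) => //; apply: flat_add => //; exact: rpredZ.
have xtu : x ==> x + t *: u.
  apply: dP; rewrite addrC addKr normrZ gtr0_norm //.
  by rewrite /t mulrAC ltr_pdivrMr ?ltr_wpDl // ltr_pM2l // ltrDl.
have := face_le_on xtu (in_levels_image Tx Ttu iT).
rewrite linearD linearZ /= => /eqP; rewrite -subr_eq0 opprD addNKr oppr_eq0.
by rewrite scaler_eq0 gt_eqF //= => /eqP.
Qed.

Lemma flat_image_dim_lt S T x y : in_levels S x -> in_levels T y ->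
  pr @` flat S x `<=` pr @` flat T y -> pr @` flat S x <> pr @` flat T y ->
  (\dim (flat_dir S) < \dim (flat_dir T))%N.
Proof.
move=> Sx Ty ST neST.
have xT : (pr @` flat T y) (pr x) by apply: ST; exists x.
rewrite (eq_flat_image xT) in ST neST; have Tx := in_levels_image Ty xT.
have dST := flat_image_dir Tx ST.
rewrite ltn_neqAle dimvS // andbT; apply/eqP => dE; apply: neST.
have E : flat_dir S = flat_dir T by apply/eqP; rewrite eqEdim dST dE leqnn.
congr (_ @` _); apply/seteqP; split=> z xz.
  have := flat_sub (@flat_refl _ _ _ form S x) xz; rewrite E => zT.
  by rewrite -[z](subrK x) addrC; apply: flat_add.
have := flat_sub (@flat_refl _ _ _ form T x) xz; rewrite -E => zT.
by rewrite -[z](subrK x) addrC; apply: flat_add.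
Qed.

Lemma rational_direction S : (0 < \dim (flat_dir S))%N ->
  exists2 k, k != 0 & Zv k \in flat_dir S.
Proof.
move=> dS; pose M : 'M[rat]_(n, #|I|) :=
  \matrix_(j, c) (if enum_val c \in S then normal (enum_val c) 0 j else 0).
have memM (u : 'rV[R]_n) : u *m map_mx ratr M = 0 <-> u \in flat_dir S.
  have entryE c : (u *m map_mx ratr M) 0 c =
      if enum_val c \in S then form (enum_val c) u else 0.
    rewrite /form rat_formE mxE; case: ifP => cS.
      by apply: eq_bigr => j _; rewrite !mxE cS mulrC.
    by rewrite big1 // => j _; rewrite !mxE cS raddf0 mulr0.
  split=> [uM|/flat_dirP uS].
    apply/flat_dirP => i iS; have := entryE (enum_rank i).
    by rewrite uM mxE enum_rankK iS.
  by apply/rowP => c; rewrite entryE mxE; case: ifP => // /uS.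
have u0 : vpick (flat_dir S) != 0 by rewrite vpick0 -dimv_eq0 -lt0n.
have [k k0 kM] := int_kernel_neq0 u0 (proj2 (memM _) (memv_pick _)).
by exists k => //; exact/memM.
Qed.

Section BallCells.
Hypothesis cells_ball : forall x, exists d, ball_cell R d (pr @` cell x).

(* The segment from p to p + k projects to a loop in the closure of a cell. *)
Lemma face_le_shift_eq0 p q k : p ==> q -> p + Zv k ==> q -> k = 0.
Proof.
move=> pq pkq; have [d dq] := cells_ball q.
apply: (ball_cell_loop (x := p) dq) => t t01; apply: closure_face.
by have := face_le_convex pq pkq t01; rewrite [p + Zv k - p]addrAC subrr add0r.
Qed.

Lemma levels_free_translations : free_translations form Zv levels.
Proof.
move=> x k xk; apply: (face_le_shift_eq0 (q := x)); first exact: same_cell_face.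
exact/same_cell_face/same_cell_sym.
Qed.

Variable cells : {fset set (torus R n)}.
Hypothesis mem_cells : forall C, C \in cells <-> exists x, C = pr @` cell x.

Section Star.
Variables (S : {set I}) (p : 'rV[R]_n) (e : R).
Hypothesis Sp : in_levels S p.
Hypothesis e_gt0 : 0 < e.
Hypothesis strip_face : strip form p e `<=` face_le form levels p.

Let star : set 'rV[R]_n := flat S p `&` strip form p e.

Lemma relopen_star : relopen_convex star (flat_dir S).
Proof.
rewrite -[flat_dir S]capvf; apply: relopenI; first exact: relopen_flat.
exact: relopen_strip.
Qed.

Lemma star_bounded i : exists M, forall y, star y -> `|form i y| <= M.
Proof.
exists (e + `|form i p|) => y [_ /(_ i) yp].
rewrite -[form i y](subrK (form i p)).
by apply: le_trans (ler_normD _ _) _; rewrite lerD2r ltW.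
Qed.

Lemma star_cell_inj y z : star y -> star z ->
  pr @` cell y = pr @` cell z -> y ~~ z.
Proof.
move=> [_ /strip_face py] [_ /strip_face pz] /eq_cell_image[k zy].
have pky : p + Zv (- k) ==> y.
  apply/(face_le_shift Gp _ _ k); rewrite raddfN subrK => i g Gg.
  by rewrite -(zy i g Gg); exact: pz.
move: zy; rewrite -[k]opprK (face_le_shift_eq0 py pky) oppr0 raddf0 addr0.
exact: same_cell_sym.
Qed.

Lemma star_meets q : p ==> q -> (pr @` flat S p) (pr q) ->
  exists2 y, star y & q ~~ y.
Proof.
move=> pq qS; have qp : flat S p q.
  by move=> i iS; rewrite (face_le_on pq) //; exact: in_levels_image Sp qS _ iS.
have [B B0 uB] := forms_bound form (q - p).
pose t := Num.min 1 (e / B).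
have t0 : 0 < t by rewrite lt_min ltr01 divr_gt0.
have t1 : t <= 1 by rewrite ge_min lexx.
exists (p + t *: (q - p)); last exact: face_le_segment.
split; first by apply: flat_convex; rewrite ?(ltW t0).
move=> i; rewrite side_line /side subrr add0r normrM gtr0_norm //.
apply: (@lt_le_trans _ _ (t * B)); first by rewrite ltr_pM2l.
by rewrite -ler_pdivlMr // ge_min lexx orbT.
Qed.

Lemma perm_star_cells s : transversal_of (same_cell form levels) star s ->
  perm_eq [seq pr @` cell y | y <- s]
    [seq D <- cells | `[< pr @` cell p `<=` closure D >]
                      && `[< D `<=` pr @` flat S p >]].
Proof.
move=> [sK s_cov s_inj s_uniq]; apply: uniq_perm.
- rewrite map_inj_in_uniq // => y z ys zs yz.
  by apply: s_inj => //; apply: star_cell_inj yz; exact: sK.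
- exact/filter_uniq/fset_uniq.
move=> D; rewrite mem_filter; apply/mapP/idP => [[y ys ->]|].
  have [yS /strip_face py] := sK y ys.
  rewrite (asboolT (proj2 (closure_cellP _ _) (ex_intro2 _ _ y erefl py))) /=.
  rewrite asboolT; first by apply/mem_cells; exists y.
  by move=> _ [z yz <-]; exists z => //; exact: (cell_sub_flat Sp yS).
move=> /andP[/andP[/asboolP pD /asboolP DS] /mem_cells[q qE]].
rewrite qE in pD DS *; have [q' qq' pq'] := (closure_cellP _ _).1 pD.
rewrite qq' in DS *.
have q'S : (pr @` flat S p) (pr q') by apply: DS; exists q'.
have [z zK q'z] := star_meets pq' q'S; have [y ys zy] := s_cov z zK.
by exists y => //; apply: same_cell_image; exact: same_cell_trans q'z zy.
Qed.

End Star.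

Lemma euler_star S x p : in_levels S x -> (pr @` flat S x) (pr p) ->
  \sum_(D <- cells | `[< pr @` cell p `<=` closure D >]
                     && `[< D `<=` pr @` flat S x >]) (-1) ^+ torus_dim D
  = (-1) ^+ \dim (flat_dir S) :> int.
Proof.
move=> Sx pX; rewrite (eq_flat_image pX); have Sp := in_levels_image Sx pX.
have [e e0 eP] := strip_face_le form Glf p.
have star_p : (flat S p `&` strip form p e) !=set0.
  by exists p; split=> //; exact: strip_refl.
have [s s_trans <-] := euler_cells Glf (relopen_star S p e) star_p
  (@star_bounded S p e).
rewrite -big_filter -(perm_big _ (perm_star_cells Sp e0 eP s_trans)) big_map.
apply: eq_big_seq => y ys; rewrite dim_cell; congr (_ ^+ \dim _).
have [sK _ _ _] := s_trans; have [yS _] := sK y ys.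
exact/esym/capv_idPr/(cell_dir_flat Sp yS).
Qed.

Lemma signed_count_cells S x : in_levels S x ->
  exists2 s, transversal_of translate_cell (flat S x) s &
    signed_count form levels s =
    \sum_(D <- cells | `[< D `<=` pr @` flat S x >]) (-1) ^+ torus_dim D.
Proof.
move=> Sx; set X := pr @` flat S x.
have /choice[rep repP] : forall D, exists y, D \in cells /\ D `<=` X ->
    flat S x y /\ D = pr @` cell y.
  move=> D; have [[/mem_cells[y ->] yX]|nD] :=
    pselect (D \in cells /\ D `<=` X);
    last by exists 0 => /nD.
  have /flat_imageP[k yk] : X (pr y) by apply: yX; exists y.
  exists (y + Zv k) => _; split=> //; apply/eq_cell_image; exists k.
  exact: same_cell_refl.
pose l := [seq D <- cells | `[< D `<=` X >]].
have lP D : D \in l -> flat S x (rep D) /\ D = pr @` cell (rep D).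
  by rewrite mem_filter => /andP[/asboolP DX DC]; exact: repP.
exists (map rep l); last first.
  rewrite /signed_count big_map -[RHS]big_filter -/l; apply: eq_big_seq => D Dl.
  by have [_ {2}->] := lP D Dl; rewrite dim_cell.
split.
- by move=> _ /mapP[D /lP[rS _] ->].
- move=> y yS; have yl : pr @` cell y \in l.
    rewrite mem_filter; apply/andP; split; last by apply/mem_cells; exists y.
    apply/asboolP => _ [z yz <-]; exists z => //.
    exact: (cell_sub_flat Sx yS).
  have [_ /esym/eq_cell_image yr] := lP _ yl.
  by exists (rep (pr @` cell y)); first exact: map_f.
- move=> _ _ /mapP[D /lP[_ DE] ->] /mapP[E /lP[_ EE] ->] DE'.
  by congr rep; rewrite DE EE; apply/eq_cell_image/(translate_cell_sym Gp).
- rewrite map_inj_in_uniq ?filter_uniq ?fset_uniq // => D E Dl El DE.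
  by have [_ ->] := lP _ Dl; have [_ ->] := lP _ El; rewrite DE.
Qed.

Lemma signed_count_point S x s : in_levels S x ->
  transversal_of translate_cell (flat S x) s -> \dim (flat_dir S) = 0%N ->
  signed_count form levels s = 1.
Proof.
move=> Sx [sS s_cov _ s_uniq] /eqP; rewrite dimv_eq0 => /eqP dS0.
have flat_x y : flat S x y -> y = x.
  move=> yS; have := flat_sub (@flat_refl _ _ _ form S x) yS.
  by rewrite dS0 memv0 subr_eq0 => /eqP.
have [y ys _] := s_cov x (@flat_refl _ _ _ form S x).
have sE : perm_eq s [:: x].
  apply: uniq_perm => // z; rewrite inE; apply/idP/eqP => [/sS/flat_x//|->].
  by rewrite -(flat_x y (sS y ys)).
rewrite /signed_count (perm_big _ sE) big_seq1.
have := cell_dir_flat Sx (@flat_refl _ _ _ form S x).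
by rewrite dS0 subv0 => /eqP ->; rewrite dimv0 expr0.
Qed.

Lemma euler_flat S x : in_levels S x ->
  \sum_(D <- cells | `[< D `<=` pr @` flat S x >]) (-1) ^+ torus_dim D
  = (\dim (flat_dir S) == 0)%N%:R :> int.
Proof.
move=> Sx; have [s s_trans <-] := signed_count_cells Sx.
have [d0|d_gt0] := posnP (\dim (flat_dir S)).
  exact: signed_count_point Sx s_trans d0.
apply: (signed_count_eq0 Glf Gp Gu levels_free_translations Sx s_trans).
exact: rational_direction.
Qed.

End BallCells.
End ToricArrangement.

(** * The posets of flats and of cells *)

Section FlatsAndCells.
Variables (R : realType) (n : nat) (H : set (set (torus R n))).
Variables (I : finType) (normal : I -> 'rV[rat]_n) (offset : I -> R).
Hypothesis normal_neq0 : forall i, normal i != 0.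
Hypothesis arrangementP :
  forall h, H h <-> exists i, h = toric_hyp normal offset i.
Hypothesis H_reg : regular_cell_complex R (toric_cells H) (@torus_dim R n).
Implicit Types x y p q : 'rV[R]_n.
Local Notation pr := (@torus_proj R n).
Local Notation form := (form R normal).
Local Notation levels := (levels normal offset).
Local Notation cell := (cell form levels).
Local Notation flat := (flat form).
Local Notation in_levels := (in_levels form levels).
Local Notation through := (through form levels).

Lemma toric_cellsP C : toric_cells H C <-> exists x, C = pr @` cell x.
Proof.
have E P : [set y | forall h, H h -> (h y <-> h P)] =
    [set Q | forall i,
      toric_hyp normal offset i Q <-> toric_hyp normal offset i P].
  apply/seteqP; split=> Q QP.
    by move=> i; apply: QP; apply/arrangementP; exists i.
  by move=> h /arrangementP[i ->].
split=> [[P ->]|[x ->]].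
  by have [x ->] := torus_proj_surj P; exists x; rewrite E cell_component.
by exists (pr x); rewrite E cell_component.
Qed.

Lemma bigcap_hyps (B : set (set (torus R n))) (S : {set I}) :
  (forall i, i \in S <-> B (toric_hyp normal offset i)) -> B `<=` H ->
  \bigcap_(h in B) h =
  [set Q | forall i, i \in S -> toric_hyp normal offset i Q].
Proof.
move=> SB BH; apply/seteqP; split=> Q QB; first by move=> i /SB; exact: QB.
move=> h Bh; have /arrangementP[i hE] := BH h Bh; rewrite hE in Bh *.
by apply: QB; apply/SB.
Qed.

Lemma flatsP X : flats H X <-> exists S x, in_levels S x /\ X = pr @` flat S x.
Proof.
split=> [[B BH [P PB ->]]|[S [x [Sx ->]]]].
  pose S : {set I} := [set i | `[< B (toric_hyp normal offset i) >]]%SET.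
  have SB i : i \in S <-> B (toric_hyp normal offset i).
    by rewrite inE; split=> /asboolP.
  have [x xE] := torus_proj_surj P; subst P; exists S, x.
  have Sx : in_levels S x by move=> i /SB Bi; apply/toric_hypP; exact: PB.
  by split=> //; rewrite (bigcap_hyps SB BH) flat_component.
exists (toric_hyp normal offset @` [set` S]).
  by move=> _ [i _ <-]; apply/arrangementP; exists i.
have capE : \bigcap_(h in toric_hyp normal offset @` [set` S]) h =
    [set Q | forall i, i \in S -> toric_hyp normal offset i Q].
  apply/seteqP; split=> Q QB; first by move=> i iS; apply: QB; exists i.
  by move=> _ [i iS <-]; exact: QB.
exists (pr x); last by rewrite capE flat_component.
by rewrite capE => i iS; apply/toric_hypP; exact: Sx.
Qed.

Lemma cells_finite : finite_set (toric_cells H).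
Proof. by have [] := H_reg. Qed.

Lemma cells_ball x : exists d, ball_cell R d (pr @` cell x).
Proof.
have [_ _ _ _ Hb] := H_reg.
have [|Hx _] := Hb (pr @` cell x); first by apply/toric_cellsP; exists x.
by eexists; exact: Hx.
Qed.

Lemma mem_cells C : C \in fset_set (toric_cells H) <-> toric_cells H C.
Proof. by rewrite in_fset_set ?inE //; exact: cells_finite. Qed.

Lemma flats_finite : finite_set (flats H).
Proof.
pose union (B : {set fset_set (toric_cells H)}) : set (torus R n) :=
  \bigcup_(C in [set C | C \in B]) val C.
apply: (@sub_finite_set _ _ (range union)); last first.
  exact/finite_image/finite_finset.
move=> X /flatsP[S [x [Sx ->]]].
exists [set C | `[< val C `<=` pr @` flat S x >]]%SET => //.
apply/seteqP; split=> [P [C /=]|P]; first by rewrite inE => /asboolP; exact.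
have [y ->] := torus_proj_surj P => yX.
have yC : pr @` cell y \in fset_set (toric_cells H).
  by apply/mem_cells/toric_cellsP; exists y.
exists [` yC]%fset; last by exists y.
by rewrite /= inE; apply/asboolP; exact: cell_image_sub_flat.
Qed.

Lemma mem_flats X : X \in fset_set (flats H) <-> flats H X.
Proof. by rewrite in_fset_set ?inE //; exact: flats_finite. Qed.

Lemma flat_neq0 X : flats H X -> X != set0.
Proof. by move=> /flatsP[S [x [_ ->]]]; apply/set0P; exists (pr x), x. Qed.

Lemma dimv_rV_le (W : {vspace 'rV[R]_n}) : (\dim W <= n)%N.
Proof.
by apply: leq_trans (dimvS (subvf W)) _; rewrite dimvf /dim /= mul1n.
Qed.

Lemma dim_cell_le C : toric_cells H C -> (torus_dim C <= n)%N.
Proof.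
by move=> /toric_cellsP[x ->]; rewrite (dim_cell normal offset) dimv_rV_le.
Qed.

Lemma dim_flat_le X : flats H X -> (torus_dim X <= n)%N.
Proof. by move=> /flatsP[S [x [_ ->]]]; rewrite dim_flat dimv_rV_le. Qed.

Lemma dim_flat_lt X Y : flats H X -> flats H Y -> X <> Y -> Y `<=` X ->
  (torus_dim Y < torus_dim X)%N.
Proof.
move=> /flatsP[S [x [Sx ->]]] /flatsP[T [y [Ty ->]]] XY YX; rewrite !dim_flat.
by apply: flat_image_dim_lt Ty Sx YX _ => /esym.
Qed.

Lemma cell_closureP C D : toric_cells H C -> toric_cells H D ->
  D `<=` closure C -> exists p q,
    [/\ D = pr @` cell p, C = pr @` cell q & face_le form levels p q].
Proof.
move=> /toric_cellsP[q ->] /toric_cellsP[p ->] /closure_cellP[q' qq' pq'].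
by exists p, q'.
Qed.

Lemma dim_face_lt C D : toric_cells H C -> toric_cells H D -> D <> C ->
  D `<=` closure C -> (torus_dim D < torus_dim C)%N.
Proof.
move=> CC DC DneC /(cell_closureP CC DC)[p [q [DE CE pq]]].
rewrite DE CE !(dim_cell normal offset) ltn_neqAle dimvS ?face_le_dir // andbT.
apply/eqP => /(face_le_same_cell pq)/same_cell_image E.
by apply: DneC; rewrite DE CE E.
Qed.

Lemma face_sub_flat C D X : toric_cells H C -> toric_cells H D -> flats H X ->
  D `<=` closure C -> C `<=` X -> D `<=` X.
Proof.
move=> CC DC /flatsP[S [x [Sx ->]]] /(cell_closureP CC DC)[p [q [-> -> pq]]] qX.
have qS : (pr @` flat S x) (pr q) by apply: qX; exists q.
rewrite (eq_flat_image qS); have Sq := in_levels_image Sx qS.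
apply: cell_image_sub_flat => //; exists p => // i iS.
by rewrite (face_le_on pq) //; exact: Sq.
Qed.

Lemma cell_support C : toric_cells H C -> exists2 X, flats H X &
  torus_dim X = torus_dim C /\ (forall Y, flats H Y -> X `<=` Y <-> C `<=` Y).
Proof.
move=> /toric_cellsP[x ->]; have xx := @in_levels_through _ _ _ form levels x.
exists (pr @` flat (through x) x); first by apply/flatsP; exists (through x), x.
split=> [|Y /flatsP[S [y [Sy ->]]]].
  by rewrite dim_flat (dim_cell normal offset).
split=> xY.
  by apply: subset_trans xY; apply: cell_image_sub_flat => //; exists x.
by apply: flat_through_sub => //; apply: xY; exists x.
Qed.

Lemma sum_cells_star X E : flats H X -> toric_cells H E -> E `<=` X ->
  \sum_(C <- fset_set (toric_cells H) |
         `[< E `<=` closure C >] && `[< C `<=` X >])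
     (-1) ^+ torus_dim C = (-1) ^+ torus_dim X :> int.
Proof.
move=> /flatsP[S [x [Sx ->]]] /toric_cellsP[p ->] pX; rewrite dim_flat.
apply: (euler_star cells_ball) => [C||]; last by apply: pX; exists p.
  exact: iff_trans (mem_cells C) (toric_cellsP C).
exact: Sx.
Qed.

Lemma sum_cells_flat X : flats H X ->
  \sum_(C <- fset_set (toric_cells H) | `[< C `<=` X >]) (-1) ^+ torus_dim C
  = (torus_dim X == 0)%N%:R :> int.
Proof.
move=> /flatsP[S [x [Sx ->]]]; rewrite dim_flat.
apply: (euler_flat normal_neq0 cells_ball) Sx => C.
exact: iff_trans (mem_cells C) (toric_cellsP C).
Qed.

Local Notation flatT := (fset_set (flats H)).
Local Notation cellT := (fset_set (toric_cells H)).
Local Notation flat_poset := (intersection_poset_bot H).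
Local Notation dual_face_poset := (dual_poset (toric_face_poset H)).

Implicit Types (X Y : flatT) (C D : cellT).

Let flat_elt (X : flatT) : rp_type flat_poset := Some (val X).
Let cell_elt (C : cellT) : rp_type dual_face_poset := Cell (val C).

Let flatT_flat (X : flatT) : flats H (val X).
Proof. exact/mem_flats/valP. Qed.

Let cellT_cell (C : cellT) : toric_cells H (val C).
Proof. exact/mem_cells/valP. Qed.

Lemma flat_rank X : rp_rank (flat_elt X) = (n.+1 - torus_dim (val X))%N.
Proof.
rewrite /= /intersection_rank (negPf (flat_neq0 (flatT_flat X))) subSn //.
exact/dim_flat_le/flatT_flat.
Qed.

Lemma cell_rank C : rp_rank (cell_elt C) = (n.+1 - torus_dim (val C))%N.
Proof. by rewrite /= subSS. Qed.

Lemma flat_ltE X Y :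
  rp_lt (flat_elt X) (flat_elt Y) = (X != Y) && `[< val Y `<=` val X >].
Proof. by rewrite /rp_lt /= (inj_eq Some_inj) (inj_eq val_inj). Qed.

Lemma cell_gtE C D :
  rp_lt (cell_elt C) (cell_elt D) =
  (C != D) && `[< val D `<=` closure (val C) >].
Proof.
rewrite /rp_lt /=; congr (~~ _ && _); first by apply/eqP/eqP => [[/val_inj]|->].
apply/asboolP/asboolP => DC; first exact: subset_trans (@subset_closure _ _) DC.
have := closureS DC; rewrite -(closure_id (closure _)).1 //.
exact: closed_closure.
Qed.

Lemma flat_lt_rank X Y : rp_lt (flat_elt X) (flat_elt Y) ->
  (rp_rank (flat_elt X) < rp_rank (flat_elt Y))%N.
Proof.
rewrite flat_ltE !flat_rank => /andP[/eqP XY /asboolP YX].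
have := dim_flat_lt (flatT_flat X) (flatT_flat Y) (fun E => XY (val_inj E)) YX.
by have := dim_flat_le (flatT_flat X); lia.
Qed.

Lemma cell_gt_rank C D : rp_lt (cell_elt C) (cell_elt D) ->
  (rp_rank (cell_elt C) < rp_rank (cell_elt D))%N.
Proof.
rewrite cell_gtE !cell_rank => /andP[/eqP CD /asboolP DC].
have DneC : val D <> val C by move=> /val_inj DC'; apply: CD.
have := dim_face_lt (cellT_cell C) (cellT_cell D) DneC DC.
by have := dim_cell_le (cellT_cell C); lia.
Qed.

Lemma flat_lt_trans : transitive (fun X Y => rp_lt (flat_elt X) (flat_elt Y)).
Proof.
move=> Y X Z XY YZ; have := ltn_trans (flat_lt_rank XY) (flat_lt_rank YZ).
move: XY YZ; rewrite !flat_ltE => /andP[_ /asboolP YX] /andP[_ /asboolP ZY] rXZ.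
apply/andP; split; last by apply/asboolP; exact: subset_trans ZY YX.
by apply: contraTneq rXZ => ->; rewrite ltnn.
Qed.

Lemma support_exists : exists supp : cellT -> flatT,
  (forall C, torus_dim (val (supp C)) = torus_dim (val C)) /\
  (forall C X, val (supp C) `<=` val X <-> val C `<=` val X).
Proof.
have /choice[supp suppP] : forall C, exists X : flatT,
    torus_dim (val X) = torus_dim (val C) /\
    forall Y : flatT, val X `<=` val Y <-> val C `<=` val Y.
  move=> C; have [X /mem_flats XF [XC XP]] := cell_support (cellT_cell C).
  by exists [` XF]%fset; split=> // Y; exact/XP/flatT_flat.
by exists supp; split=> C; have [] := suppP C.
Qed.

Let sign_codim d : (d <= n.+1)%N ->
  (-1) ^+ (n.+1 - d) = (-1) ^+ n.+1 * (-1) ^+ d :> int.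
Proof.
by move=> dn; rewrite -[in RHS](subnK dn) exprD -mulrA -expr2 sqrr_sign mulr1.
Qed.

Section Support.
Variable supp : cellT -> flatT.
Hypothesis dim_supp : forall C, torus_dim (val (supp C)) = torus_dim (val C).
Hypothesis supp_subP : forall C X, val (supp C) `<=` val X <-> val C `<=` val X.

Lemma flat_leE X C : (X == supp C) || rp_lt (flat_elt X) (flat_elt (supp C)) =
  `[< val C `<=` val X >].
Proof.
rewrite flat_ltE; apply/idP/asboolP => [XC|CX].
  by apply/supp_subP; case/orP: XC => [/eqP ->|/andP[_ /asboolP]].
by case: eqVneq => //= XC; apply/asboolP/supp_subP.
Qed.

Lemma cell_geE C D : (C == D) || rp_lt (cell_elt C) (cell_elt D) =
  `[< val D `<=` closure (val C) >].
Proof.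
rewrite cell_gtE; case: eqVneq => //= ->; apply/esym/asboolP.
exact: subset_closure.
Qed.

Lemma cell_gt_supp C D : rp_lt (cell_elt C) (cell_elt D) ->
  rp_lt (flat_elt (supp C)) (flat_elt (supp D)).
Proof.
move=> CD; have := cell_gt_rank CD; rewrite !cell_rank => rCD.
move: CD; rewrite cell_gtE flat_ltE => /andP[_ /asboolP DC].
apply/andP; split.
  apply: contraTneq rCD => E; rewrite -(dim_supp C) E dim_supp.
  by rewrite ltnn.
apply/asboolP/supp_subP/(face_sub_flat (cellT_cell C)) => //.
exact/supp_subP.
Qed.

Lemma euler_star_rank X E : rp_lt (flat_elt X) (flat_elt (supp E)) ->
  \sum_(C | ((C == E) || rp_lt (cell_elt C) (cell_elt E)) &&
            ((X == supp C) || rp_lt (flat_elt X) (flat_elt (supp C))))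
     (-1) ^+ rp_rank (cell_elt C) = (-1) ^+ rp_rank (flat_elt X) :> int.
Proof.
move=> XE; have EX : val E `<=` val X.
  by apply/asboolP; rewrite -flat_leE XE orbT.
rewrite flat_rank sign_codim ?(leqW (dim_flat_le (flatT_flat X))) //.
rewrite -(sum_cells_star (flatT_flat X) (cellT_cell E) EX).
rewrite big_seq_fsetE mulr_sumr.
apply: eq_big => [C|C _]; first by rewrite flat_leE cell_geE.
by rewrite cell_rank sign_codim // leqW // dim_cell_le.
Qed.

Lemma euler_flat_rank X :
  \sum_(C | (X == supp C) || rp_lt (flat_elt X) (flat_elt (supp C)))
     (-1) ^+ rp_rank (cell_elt C)
  = (if rp_rank (flat_elt X) == n.+1 then (-1) ^+ n.+1 else 0) :> int.
Proof.
have dX := dim_flat_le (flatT_flat X); rewrite flat_rank.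
transitivity ((-1) ^+ n.+1 * (torus_dim (val X) == 0)%N%:R : int); last first.
  have -> : (n.+1 - torus_dim (val X) == n.+1)%N = (torus_dim (val X) == 0)%N.
    by lia.
  by case: eqP; rewrite ?mulr1 ?mulr0.
rewrite -(sum_cells_flat (flatT_flat X)) big_seq_fsetE mulr_sumr.
apply: eq_big => [C|C _]; first by rewrite flat_leE.
by rewrite cell_rank sign_codim // leqW // dim_cell_le.
Qed.

End Support.

(* The rank of the maximum is computed through a classical test of equality,
   so that this equation does not hold by conversion. *)
Lemma rp_N_flat_poset : rp_N flat_poset = n.+1.
Proof. by rewrite /rp_N /= /intersection_rank eqxx. Qed.

Lemma ab_index_flat_poset : ab_index flat_poset =
  upper_sum ab_b ab_c (@rp_lt flat_poset) (codom flat_elt) (@rp_rank flat_poset)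
    n.+1 None.
Proof.
rewrite -rp_N_flat_poset; apply: (@ab_index_upper_sum flat_poset) => //.
- by apply/injectiveP => X Y [/val_inj].
- move=> x; rewrite rp_N_flat_poset; split=> [/codomP[X ->]|].
    split; first by left; exact: flatT_flat.
    by rewrite flat_rank subn_gt0 ltnS leq_subr (dim_flat_le (flatT_flat X)).
  case: x => [X|[//]] [/= [XF|->] /andP[_]]; last first.
    by rewrite /intersection_rank eqxx ltnn.
  by move/mem_flats: XF => XF _; apply/codomP; exists [` XF]%fset.
- move=> _ /codomP[X ->]; rewrite /rp_lt /= (inj_eq Some_inj).
  rewrite (flat_neq0 (flatT_flat X)).
  by apply/asboolP; exact: sub0set.
- by rewrite /rp_lt /=; exact/asboolP.
Qed.

Lemma ab_index_dual_face_poset : ab_index dual_face_poset =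
  upper_sum ab_b ab_c (@rp_lt dual_face_poset) (codom cell_elt)
    (@rp_rank dual_face_poset) n.+1 WholeSpace.
Proof.
apply: (@ab_index_upper_sum dual_face_poset) => /=.
- by apply/injectiveP => C D [/val_inj].
- move=> x; rewrite /rp_N /=; split=> [/codomP[C ->]|].
    split; first exact: cellT_cell.
    by have := dim_cell_le (cellT_cell C); rewrite /=; lia.
  case: x => [|C|] [//= CC]; rewrite ?subn0 ?subnn ?ltnn ?andbF // => _.
  by move/mem_cells: CC => CC; apply/codomP; exists [` CC]%fset.
- move=> _ /codomP[C ->]; rewrite /rp_lt /=.
  by apply/andP; split; [exact/eqP|exact/asboolP].
- by rewrite /rp_lt /=; apply/andP; split; [exact/eqP|exact/asboolP].
- exact: subnn.
Qed.

Let flat_sum X : abpoly := upper_sum ab_b ab_c (@rp_lt flat_poset)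
  (codom flat_elt) (@rp_rank flat_poset) n.+1 (flat_elt X).
Let cell_sum C : abpoly := upper_sum ab_b ab_c (@rp_lt dual_face_poset)
  (codom cell_elt) (@rp_rank dual_face_poset) n.+1 (cell_elt C).

Let flat_rank_le X : (rp_rank (flat_elt X) <= n.+1)%N.
Proof. by rewrite flat_rank leq_subr. Qed.

Let cell_rank_le C : (rp_rank (cell_elt C) <= n.+1)%N.
Proof. by rewrite cell_rank leq_subr. Qed.

Lemma flat_sum_rec X :
  flat_sum X = ab_c ^+ (n.+1 - rp_rank (flat_elt X))
    + \sum_(Y | rp_lt (flat_elt X) (flat_elt Y))
        ab_c ^+ (rp_rank (flat_elt Y) - rp_rank (flat_elt X)).-1 * ab_b
          * flat_sum Y.
Proof. by apply: upper_sum_codom => // Y; exact: flat_lt_rank. Qed.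

Lemma cell_sum_rec C :
  cell_sum C = ab_c ^+ (n.+1 - rp_rank (cell_elt C))
    + \sum_(D | rp_lt (cell_elt C) (cell_elt D))
        ab_c ^+ (rp_rank (cell_elt D) - rp_rank (cell_elt C)).-1 * ab_b
          * cell_sum D.
Proof. by apply: upper_sum_codom => // D; exact: cell_gt_rank. Qed.

Lemma ab_index_flats : ab_index flat_poset =
  ab_c ^+ n.+1 + \sum_X ab_c ^+ (rp_rank (flat_elt X)).-1 * ab_b * flat_sum X.
Proof.
apply: etrans ab_index_flat_poset (upper_sum_codom_bot _ _ _ _ _ _) => // X.
- by rewrite /rp_lt /=; exact/asboolP.
- by rewrite flat_rank subn_gt0 ltnS (dim_flat_le (flatT_flat X)).
Qed.

Lemma ab_index_cells : ab_index dual_face_poset =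
  ab_c ^+ n.+1 + \sum_C ab_c ^+ (rp_rank (cell_elt C)).-1 * ab_b * cell_sum C.
Proof.
apply: etrans ab_index_dual_face_poset (upper_sum_codom_bot _ _ _ _ _ _) => //.
- exact: subnn.
- by move=> C; rewrite /rp_lt /=; apply/andP; split; [exact/eqP|exact/asboolP].
- by move=> C; rewrite cell_rank subn_gt0 ltnS (dim_cell_le (cellT_cell C)).
Qed.

Lemma ab_rev_face_poset :
  ab_rev (ab_index (toric_face_poset H)) = phi_t (ab_index flat_poset).
Proof.
have [supp [dim_supp supp_subP]] := support_exists.
rewrite -ab_index_dual // phi_tE ab_index_flats ab_index_cells.
pose tl s : {additive abpoly -> abpoly} := tail_op s.
pose ph : {additive abpoly -> abpoly} := phi_op.
have tl_cX := @tail_cX abpoly ab_a ab_b tl tail_op1 tail_op_letter.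
have tl_cXb := @tail_cXb abpoly ab_a ab_b tl tail_op_letter.
have ph_cX := @phi_cX abpoly ab_a ab_b tl ph phi_op1 phi_op_letter.
have ph_cXb := @phi_cXb abpoly ab_a ab_b tl ph phi_op_letter.
apply/esym/(@phi_flats abpoly ab_b ab_c (tl 0%N) ph tl_cX tl_cXb ph_cX ph_cXb
  flatT cellT n.+1 (fun X Y => rp_lt (flat_elt X) (flat_elt Y))
  (fun C D => rp_lt (cell_elt C) (cell_elt D)) supp
  (fun X => rp_rank (flat_elt X)) (fun C => rp_rank (cell_elt C))).
- exact: flat_rank_le.
- exact: flat_lt_rank.
- exact: flat_lt_trans.
- by move=> C; rewrite cell_rank flat_rank dim_supp.
- exact: cell_gt_supp.
- exact: euler_star_rank.
- exact: euler_flat_rank.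
- exact: flat_sum_rec.
- exact: cell_sum_rec.
Qed.

End FlatsAndCells.

Lemma arrangement_data (R : realType) n (H : set (set (torus R n))) :
  toric_arrangement H ->
  exists (I : finType) (normal : I -> 'rV[rat]_n) (offset : I -> R),
    (forall i, normal i != 0) /\
    (forall h, H h <-> exists i, h = toric_hyp normal offset i).
Proof.
move=> [Hfin Hhyp].
have memH h : h \in fset_set H <-> H h by rewrite in_fset_set ?inE.
have /choice[f fP] : forall h : fset_set H, exists ab : 'rV[rat]_n * R,
    ab.1 != 0 /\
    val h = @torus_proj R n @`
      [set x : 'rV[R]_n | \sum_(j < n) ratr (ab.1 0 j) * x 0 j = ab.2].
  by move=> h; have /memH/Hhyp[a [b [a0 hE]]] := valP h; exists (a, b).
exists (fset_set H), (fun h => (f h).1), (fun h => (f h).2).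
have hypE h : val h = toric_hyp (fun h => (f h).1) (fun h => (f h).2) h.
  rewrite (fP h).2; congr (_ @` _); apply/seteqP; split=> x /=;
    by rewrite /form rat_formE.
split=> [h|h]; first exact: (fP h).1.
split=> [/memH hH|[i ->]]; first by exists [` hH]%fset; rewrite -hypE.
by rewrite -hypE; exact/memH/valP.
Qed.

Theorem theorem3p17 (R : realType) (n : nat) (H : set (set (torus R n))) :
  toric_arrangement H ->
  regular_cell_complex R (toric_cells H) (@torus_dim R n) ->
  ab_rev (ab_index (toric_face_poset H))
  = phi_t (ab_index (intersection_poset_bot H)).
Proof.
move=> /arrangement_data[I [normal [offset [normal_neq0 arrangementP]]]] H_reg.
exact: ab_rev_face_poset normal_neq0 arrangementP H_reg.
Qed.
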